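(* Let $t$ and $m$ be positive integers with $m(t-1)\leq 24$ and let $\mu=\frac{m(t-1)}{24}$. As $n\to\infty$, $$c_t^{(m)}(n)=\frac{\mu^{1/4}}{\sqrt{2t}}\,\frac{e^{4\pi\sqrt{\mu(n-\mu)}/t}}{(n-\mu)^{3/4}}\left(\alpha_t^{(m)}(n)+O\left((n-\mu)^{-1/2}\right)\right).$$
   Context: For positive integers $t,m$, the integers $c_t^{(m)}(n)$ are defined by $\sum_{n\ge 0}c_t^{(m)}(n)q^n=\frac{(q;q)_\infty^m}{(q^t;q^t)_\infty^m}$, where $(a;q)_\infty=\prod_{n=0}^\infty(1-aq^n)$, $|q|<1$. For a positive integer $k$ and an integer $h$ with $\gcd(h,k)=1$, the Dedekind sum is $s(h,k)=\sum_{r=1}^{k-1}\frac{r}{k}\left(\frac{hr}{k}-\left\lfloor\frac{hr}{k}\right\rfloor-\frac12\right)$, with $s(h,1)=0$. Define $$\alpha_t^{(m)}(n)=\sum_{0\le h<t,\ \gcd(h,t)=1}\exp\left(-m\pi i\, s(h,t)-\frac{2\pi i n h}{t}\right).$$ Here $t$ and $m$ are fixed, so the implied constant may depend on $t$ and $m$. *)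

(* Defs.v *)
From Stdlib Require Import Reals ZArith Arith.
From Coquelicot Require Import Coquelicot.

Definition Cexp (z : C) : C := (exp (Re z) * (cos (Im z), sin (Im z)))%C.

(* As for [C_lim]: the limit whenever [u] converges, unspecified otherwise. *)
Definition C_lim_seq (u : nat -> C) : C :=
  (real (Lim_seq (fun n => Re (u n))), real (Lim_seq (fun n => Im (u n)))).

Fixpoint qpoch_fin (a q : C) (N : nat) : C :=
  match N with
  | O => 1%C
  | S N' => (qpoch_fin a q N' * (1 - a * q ^ N'))%C
  end.

Definition qpoch_inf (a q : C) : C := C_lim_seq (qpoch_fin a q).

(* Power series coefficients are unique, so this determines [c]. *)
Definition is_ct_coeffs (t m : nat) (c : nat -> Z) : Prop :=
  forall q : C, (Cmod q < 1)%R ->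
    is_pseries (K := C_AbsRing) (V := C_NormedModule)
      (fun n => RtoC (IZR (c n))) q
      (qpoch_inf q q ^ m / qpoch_inf (q ^ t) (q ^ t) ^ m)%C.

(* [Int_part] is the floor function.  For [k = 1] the sum is empty. *)
Definition dedekind_sum (h : Z) (k : nat) : R :=
  (sum_n_m (fun r : nat =>
     INR r / INR k *
       (IZR h * INR r / INR k - IZR (Int_part (IZR h * INR r / INR k)) - 1 / 2))
     1 (k - 1))%R.

Definition alpha (t m n : nat) : C :=
  sum_n (fun h : nat =>
    if Nat.eqb (Nat.gcd h t) 1 then
      Cexp (- INR m * PI * Ci * dedekind_sum (Z.of_nat h) t
            - 2 * PI * Ci * INR n * INR h / INR t)%C
    else RtoC 0) (t - 1).

Definition mu (t m : nat) : R := (INR m * (INR t - 1) / 24)%R.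

(* The fourth root of [mu] is written with [sqrt] because [mu = 0] when [t = 1],
   and [Rpower 0 (1/4)] is 1, not 0. *)
Definition main_factor (t m n : nat) : R :=
  (sqrt (sqrt (mu t m)) / sqrt (2 * INR t) *
   (exp (4 * PI * sqrt (mu t m * (INR n - mu t m)) / INR t) /
    Rpower (INR n - mu t m) (3 / 4)))%R.

Definition is_bigO (f : nat -> C) (g : nat -> R) : Prop :=
  exists K : R, eventually (fun n => (Cmod (f n) <= K * Rabs (g n))%R).

(* Main.v *)
Require Import Defs.
From Stdlib Require Import Reals ZArith Arith Lra Lia Psatz.
From Coquelicot Require Import Coquelicot.

(** The series is [F(q)^m], where [F(q)] is the product of the factors [1 - q^n] over all [n]
    not divisible by [t]. Its coefficients are found by the circle method, and the point is
    that no modular transformation is needed. Since [zeta^n <> 1] whenever [zeta] is a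
    primitive [t]-th root of unity and [t] does not divide [n], no factor of [F] degenerates
    when [q] tends to [zeta], so elementary summation gives the behaviour of [F] there.

    Near such a [zeta = e^(2 pi i h/t)], put [q = zeta e^(-x)] with [x] in a cone around the
    positive axis. For each residue [r] the sum of [log (1 - zeta^r e^(-n x))] over
    [n = r (mod t)] is a Riemann sum with step [t x] of a smooth function, and Euler-Maclaurin
    summation to first order yields
    [log F = A/x + sum_r (1/2 - r/t) log (1 - zeta^r) + O(x)].
    The antiderivative of the logarithm is the dilogarithm, and summing it over the roots of
    unity reduces [A] to the Basel sum: [A = (1 - 1/t) pi^2/(6 t)]. The argument of
    [1 - e^(2 pi i phi)] is the sawtooth [pi (phi - 1/2)] and the reflection [r -> t - r] kills
    the real part, so the constant term is [- pi i s(h,t)]: this is where the Dedekind sum comes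
    from ([quotient_near_root], [dedekind_constant]).

    Elsewhere on the circle [|q| = e^(-y)] the Lambert series
    [log |F| = Re sum_k (1/k) (W(q^(t k)) - W(q^k))], [W(w) = w/(1-w)], suffices. As
    [Re W(w) >= - |w|], the terms of the second series with [t] not dividing [k] contribute at
    most a logarithm, and [|W(w)| <= 1/log (1/|w|)] bounds the rest by exactly [A/y]. An amount
    proportional to [1/y] is gained if [q^t] is not close to 1, from [k = 1] in the first series,
    or if [q] is close to an imprimitive root of unity, of order [t' < t] say, from the term
    [k = t'] of the second ([quotient_minor_bound]).

    Put [N = n - mu], [a = m A = 4 pi^2 mu/t^2] and take the saddle point [y = sqrt (a/N)]. With
    [x = y (1 - i v)] and [L = a/y = N y], the integrand [exp (a/x + N x)] is [e^(2 L)] times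
    [exp (- L v^2/(1 - i v)) = e^(- L v^2) (1 - i L v^3) + O(e^(- L v^2/4)/L)]. The cubic term is
    odd and integrates to zero, so the Gaussian integral gives the main term with relative error
    [O(1/L) = O(N^(-1/2))]; summation over [h] produces [alpha]
    ([arc_estimate], [circle_method], [coefficient_estimate]). *)

Open Scope R_scope.

(** * Complex exponential, finite sums and limits *)

Lemma C_eq (z w : C) : Re z = Re w -> Im z = Im w -> z = w.
Proof. destruct z, w; simpl; intros -> ->; reflexivity. Qed.

Lemma re_opp (a : C) : Re (- a)%C = - Re a.
Proof. reflexivity. Qed.
Lemma im_opp (a : C) : Im (- a)%C = - Im a.
Proof. reflexivity. Qed.
Lemma re_minus (a b : C) : Re (a - b)%C = Re a - Re b.
Proof. reflexivity. Qed.
Lemma im_minus (a b : C) : Im (a - b)%C = Im a - Im b.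
Proof. reflexivity. Qed.

Lemma im_le_Cmod (z : C) : Rabs (Im z) <= Cmod z.
Proof. eapply Rle_trans; [|apply Rmax_Cmod]. apply Rmax_r. Qed.

Lemma re_le (z : C) : Re z <= Cmod z.
Proof. eapply Rle_trans; [apply Rle_abs|apply re_le_Cmod]. Qed.

Lemma Cmod_le_abs (z : C) : Cmod z <= Rabs (Re z) + Rabs (Im z).
Proof.
  pose proof (Rabs_pos (Re z)); pose proof (Rabs_pos (Im z)).
  apply Rsqr_incr_0_var; [|lra]. unfold Rsqr.
  replace (Cmod z * Cmod z) with (Re z ^ 2 + Im z ^ 2)
    by (rewrite <- Cmod2_alt; ring).
  rewrite <- (pow2_abs (Re z)), <- (pow2_abs (Im z)). nra.
Qed.

Lemma Cmod_sqr (z : C) : Cmod z * Cmod z = Re z * Re z + Im z * Im z.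
Proof. replace (Cmod z * Cmod z) with (Cmod z ^ 2) by ring. rewrite Cmod2_alt; ring. Qed.

Lemma Cmod_minus_sym (a b : C) : Cmod (a - b) = Cmod (b - a).
Proof. rewrite <- Cmod_opp. f_equal; ring. Qed.

Lemma Cmod_triangle_minus (a b : C) : Cmod (a - b) <= Cmod a + Cmod b.
Proof. unfold Cminus. rewrite <- (Cmod_opp b). apply Cmod_triangle. Qed.

Lemma Cmod_triangle_inv (a b : C) : Cmod a - Cmod b <= Cmod (a - b).
Proof.
  pose proof (Cmod_triangle (a - b) b) as H.
  replace (a - b + b)%C with a in H by ring. lra.
Qed.

Lemma RtoC_nz (x : R) : x <> 0 -> RtoC x <> 0%C.
Proof. intros H E. apply H, RtoC_inj, E. Qed.

Lemma Rabs_mult_self (x : R) : Rabs x * Rabs x = x * x.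
Proof. rewrite <- Rabs_mult. apply Rabs_pos_eq; nra. Qed.

Lemma exp_mult_opp (x : R) : exp x * exp (- x) = 1.
Proof. rewrite <- exp_plus, Rplus_opp_r. apply exp_0. Qed.

Lemma exp_neg_le_half (x : R) : 0 <= x <= 1 -> exp (- x) <= 1 - x / 2.
Proof.
  intros H. pose proof (exp_ineq1_le x). pose proof (exp_mult_opp x). pose proof (exp_pos (- x)). nra.
Qed.

Lemma Cexp_plus (a b : C) : Cexp (a + b) = (Cexp a * Cexp b)%C.
Proof.
  apply C_eq; unfold Cexp; destruct a as [a1 a2], b as [b1 b2]; simpl;
    rewrite exp_plus, ?cos_plus, ?sin_plus; ring.
Qed.

Lemma Cexp_0 : Cexp 0 = 1%C.
Proof. apply C_eq; unfold Cexp; simpl; rewrite exp_0, ?cos_0, ?sin_0; ring. Qed.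

Lemma Cmod_Cexp (z : C) : Cmod (Cexp z) = exp (Re z).
Proof.
  unfold Cexp. rewrite Cmod_mult, Cmod_R, Rabs_pos_eq by (left; apply exp_pos).
  replace (Cmod (cos (Im z), sin (Im z))) with 1; [ring|].
  unfold Cmod; simpl. rewrite <- sqrt_1 at 1. f_equal.
  pose proof (sin2_cos2 (Im z)) as H; unfold Rsqr in H; lra.
Qed.

Lemma Cexp_nz (z : C) : Cexp z <> 0%C.
Proof. apply Cmod_gt_0. rewrite Cmod_Cexp. apply exp_pos. Qed.

Lemma Cexp_opp (z : C) : Cexp (- z) = (/ Cexp z)%C.
Proof.
  pose proof (Cexp_nz z).
  assert (E : (Cexp z * Cexp (- z))%C = 1%C).
  { rewrite <- Cexp_plus. replace (z + - z)%C with (RtoC 0) by ring. apply Cexp_0. }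
  replace (Cexp (- z)) with (Cexp z * Cexp (- z) / Cexp z)%C by (field; auto).
  rewrite E. field; auto.
Qed.

Lemma Cexp_minus (a b : C) : Cexp (a - b) = (Cexp a / Cexp b)%C.
Proof. unfold Cminus. rewrite Cexp_plus, Cexp_opp. reflexivity. Qed.

Lemma Cexp_pow (z : C) (n : nat) : (Cexp z ^ n)%C = Cexp (INR n * z).
Proof.
  induction n as [|n IH].
  - simpl. rewrite <- Cexp_0. f_equal. ring.
  - rewrite Cpow_S, IH, <- Cexp_plus. f_equal. rewrite S_INR, RtoC_plus. ring.
Qed.

Lemma Cexp_RtoC (x : R) : Cexp (RtoC x) = RtoC (exp x).
Proof. apply C_eq; unfold Cexp; simpl; rewrite ?cos_0, ?sin_0; ring. Qed.

Lemma Cexp_Ci (x : R) : Cexp (Ci * x) = (cos x, sin x).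
Proof.
  apply C_eq; unfold Cexp; simpl.
  - replace (0 * x - 1 * 0) with 0 by ring. replace (0 * 0 + 1 * x) with x by ring.
    rewrite exp_0; ring.
  - replace (0 * x - 1 * 0) with 0 by ring. replace (0 * 0 + 1 * x) with x by ring.
    rewrite exp_0; ring.
Qed.

Fixpoint csum (f : nat -> C) (n : nat) : C :=
  match n with O => 0%C | S k => (csum f k + f k)%C end.

Fixpoint rsum (f : nat -> R) (n : nat) : R :=
  match n with O => 0 | S k => rsum f k + f k end.

Lemma csum_S (f : nat -> C) n : csum f (S n) = (csum f n + f n)%C.
Proof. reflexivity. Qed.

Lemma rsum_S (f : nat -> R) n : rsum f (S n) = rsum f n + f n.
Proof. reflexivity. Qed.

Lemma csum_ext (f g : nat -> C) n :
  (forall k, (k < n)%nat -> f k = g k) -> csum f n = csum g n.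
Proof.
  induction n as [|n IH]; intros H; simpl; [reflexivity|].
  rewrite IH by (intros; apply H; lia). rewrite H by lia. reflexivity.
Qed.

Lemma csum_plus (f g : nat -> C) n :
  csum (fun k => f k + g k)%C n = (csum f n + csum g n)%C.
Proof. induction n as [|n IH]; simpl; [ring|rewrite IH; ring]. Qed.

Lemma csum_minus (f g : nat -> C) n :
  csum (fun k => f k - g k)%C n = (csum f n - csum g n)%C.
Proof. induction n as [|n IH]; simpl; [ring|rewrite IH; ring]. Qed.

Lemma csum_scal (a : C) (f : nat -> C) n :
  csum (fun k => a * f k)%C n = (a * csum f n)%C.
Proof. induction n as [|n IH]; simpl; [ring|rewrite IH; ring]. Qed.

Lemma csum_opp (f : nat -> C) n : csum (fun k => - f k)%C n = (- csum f n)%C.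
Proof. induction n as [|n IH]; simpl; [ring|rewrite IH; ring]. Qed.

Lemma csum_const (a : C) n : csum (fun _ => a) n = (INR n * a)%C.
Proof. induction n as [|n IH]; [simpl; ring|]. rewrite S_INR, RtoC_plus; simpl. rewrite IH; ring. Qed.

Lemma csum_swap (f : nat -> nat -> C) n m :
  csum (fun i => csum (f i) m) n = csum (fun j => csum (fun i => f i j) n) m.
Proof.
  induction n as [|n IH]; simpl.
  - induction m as [|m IHm]; simpl; [reflexivity|rewrite <- IHm; ring].
  - rewrite IH, <- csum_plus. apply csum_ext; reflexivity.
Qed.

Lemma csum_add (f : nat -> C) n m :
  csum f (n + m) = (csum f n + csum (fun k => f (n + k)%nat) m)%C.
Proof.
  induction m as [|m IH]; simpl.
  - rewrite Nat.add_0_r; ring.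
  - rewrite Nat.add_succ_r; simpl. rewrite IH; ring.
Qed.

Lemma csum_rev (f : nat -> C) n : csum (fun k => f (n - 1 - k)%nat) n = csum f n.
Proof.
  revert f; induction n as [|n IH]; intros f; [reflexivity|].
  transitivity (csum (fun k => f (1 + k)%nat) n + f O)%C.
  - rewrite <- (IH (fun k => f (1 + k)%nat)). simpl csum. f_equal; [|f_equal; lia].
    apply csum_ext; intros k Hk. f_equal; lia.
  - change (csum f (S n)) with (csum f (1 + n)). rewrite csum_add. simpl; ring.
Qed.

Lemma Cconj_csum f n : Cconj (csum f n) = csum (fun k => Cconj (f k)) n.
Proof.
  induction n as [|n IH]; [apply C_eq; simpl; lra|]. rewrite !csum_S, Cplus_conj, IH. reflexivity.
Qed.

Lemma Re_csum f n : Re (csum f n) = rsum (fun k => Re (f k)) n.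
Proof. induction n as [|n IH]; simpl; [reflexivity|rewrite <- IH; reflexivity]. Qed.
Lemma Im_csum f n : Im (csum f n) = rsum (fun k => Im (f k)) n.
Proof. induction n as [|n IH]; simpl; [reflexivity|rewrite <- IH; reflexivity]. Qed.

Lemma Cmod_csum f n : Cmod (csum f n) <= rsum (fun k => Cmod (f k)) n.
Proof.
  induction n as [|n IH]; simpl; [rewrite Cmod_0; lra|].
  eapply Rle_trans; [apply Cmod_triangle|lra].
Qed.

Lemma rsum_ext (f g : nat -> R) n :
  (forall k, (k < n)%nat -> f k = g k) -> rsum f n = rsum g n.
Proof.
  induction n as [|n IH]; intros H; simpl; [reflexivity|].
  rewrite IH by (intros; apply H; lia). rewrite H by lia. reflexivity.
Qed.

Lemma rsum_le (f g : nat -> R) n :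
  (forall k, (k < n)%nat -> f k <= g k) -> rsum f n <= rsum g n.
Proof.
  induction n as [|n IH]; intros H; simpl; [lra|].
  apply Rplus_le_compat; [apply IH; intros; apply H; lia|apply H; lia].
Qed.

Lemma rsum_plus (f g : nat -> R) n :
  rsum (fun k => f k + g k) n = rsum f n + rsum g n.
Proof. induction n as [|n IH]; simpl; [ring|rewrite IH; ring]. Qed.
Lemma rsum_minus (f g : nat -> R) n :
  rsum (fun k => f k - g k) n = rsum f n - rsum g n.
Proof. induction n as [|n IH]; simpl; [ring|rewrite IH; ring]. Qed.
Lemma rsum_scal (a : R) (f : nat -> R) n :
  rsum (fun k => a * f k) n = a * rsum f n.
Proof. induction n as [|n IH]; simpl; [ring|rewrite IH; ring]. Qed.
Lemma rsum_const (a : R) n : rsum (fun _ => a) n = INR n * a.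
Proof. induction n as [|n IH]; [simpl; ring|]. rewrite S_INR; simpl. rewrite IH; ring. Qed.

Lemma rsum_add (f : nat -> R) n m :
  rsum f (n + m) = rsum f n + rsum (fun k => f (n + k)%nat) m.
Proof.
  induction m as [|m IH]; simpl.
  - rewrite Nat.add_0_r; ring.
  - rewrite Nat.add_succ_r; simpl. rewrite IH; ring.
Qed.

Lemma rsum_pos (f : nat -> R) n :
  (forall k, (k < n)%nat -> 0 <= f k) -> 0 <= rsum f n.
Proof.
  intros H. apply Rle_trans with (rsum (fun _ => 0) n).
  - rewrite rsum_const; lra.
  - apply rsum_le; auto.
Qed.

Lemma rsum_geom_le (x : R) n : 0 <= x < 1 -> rsum (fun k => x ^ k) n <= / (1 - x).
Proof.
  intros Hx.
  assert (E : rsum (fun k => x ^ k) n = (1 - x ^ n) / (1 - x)).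
  { induction n as [|n IH]; simpl; [field; lra|rewrite IH; field; lra]. }
  rewrite E. unfold Rdiv. rewrite <- (Rmult_1_l (/ (1 - x))) at 2.
  apply Rmult_le_compat_r; [left; apply Rinv_0_lt_compat; lra|].
  pose proof (pow_le x n (proj1 Hx)); lra.
Qed.

Lemma csum_geom (w : C) n : (1 - w)%C <> 0%C ->
  csum (fun k => w ^ k)%C n = ((1 - w ^ n) / (1 - w))%C.
Proof.
  intros H. induction n as [|n IH].
  - simpl. field; auto.
  - simpl csum. rewrite IH, Cpow_S. field; auto.
Qed.

Definition Clim (u : nat -> C) (l : C) : Prop :=
  is_lim_seq (fun n => Cmod (u n - l)) 0.

Lemma Clim_squeeze (u : nat -> C) (l : C) (b : nat -> R) :
  (forall n, Cmod (u n - l) <= b n) -> is_lim_seq b 0 -> Clim u l.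
Proof.
  intros H Hb. unfold Clim.
  apply (is_lim_seq_le_le (fun _ => 0) _ b); auto.
  - intros n; split; [apply Cmod_ge_0|apply H].
  - apply is_lim_seq_const.
Qed.

Lemma lim0_plus (a b : nat -> R) :
  is_lim_seq a 0 -> is_lim_seq b 0 -> is_lim_seq (fun n => a n + b n) 0.
Proof.
  intros Ha Hb. replace (Finite 0) with (Finite (0 + 0)) by (f_equal; ring).
  apply (is_lim_seq_plus' a b 0 0); auto.
Qed.

Lemma lim0_scal (k : R) (a : nat -> R) :
  is_lim_seq a 0 -> is_lim_seq (fun n => k * a n) 0.
Proof.
  intros Ha. replace (Finite 0) with (Rbar_mult k 0) by (simpl; f_equal; ring).
  apply is_lim_seq_scal_l; auto.
Qed.

Lemma lim_const_plus (a : R) (b : nat -> R) :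
  is_lim_seq b 0 -> is_lim_seq (fun n => a + b n) a.
Proof.
  intros Hb. replace (Finite a) with (Finite (a + 0)) by (f_equal; ring).
  apply (is_lim_seq_plus' (fun _ => a)); [apply is_lim_seq_const|exact Hb].
Qed.

Lemma lim_of_error (u b : nat -> R) (l : R) :
  (forall n, Rabs (u n - l) <= b n) -> is_lim_seq b 0 -> is_lim_seq u l.
Proof.
  intros H Hb. apply is_lim_seq_ext with (fun n => l + (u n - l)); [intros; ring|].
  apply lim_const_plus, is_lim_seq_abs_0.
  eapply is_lim_seq_le_le; [|apply is_lim_seq_const|apply Hb].
  intros n; split; [apply Rabs_pos|apply H].
Qed.

Lemma lim_subseq (u : nat -> R) (l : Rbar) (phi : nat -> nat) :
  (forall n, (n <= phi n)%nat) -> is_lim_seq u l -> is_lim_seq (fun n => u (phi n)) l.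
Proof.
  intros Hphi H. apply (is_lim_seq_subseq u l phi); auto.
  intros P [N HN]. exists N. intros n Hn. apply HN. specialize (Hphi n); lia.
Qed.

Lemma Clim_const (l : C) : Clim (fun _ => l) l.
Proof.
  unfold Clim. replace (l - l)%C with (RtoC 0) by ring. rewrite Cmod_0.
  apply is_lim_seq_const.
Qed.

Lemma Clim_ext (u v : nat -> C) l : (forall n, u n = v n) -> Clim u l -> Clim v l.
Proof.
  unfold Clim; intros H. apply is_lim_seq_ext. intros n; rewrite H; reflexivity.
Qed.

Lemma Clim_plus (u v : nat -> C) a b :
  Clim u a -> Clim v b -> Clim (fun n => u n + v n)%C (a + b)%C.
Proof.
  intros Hu Hv. eapply Clim_squeeze; [|apply (lim0_plus _ _ Hu Hv)].
  intros n; simpl. replace (u n + v n - (a + b))%C with ((u n - a) + (v n - b))%C by ring.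
  apply Cmod_triangle.
Qed.

Lemma Clim_opp (u : nat -> C) a : Clim u a -> Clim (fun n => - u n)%C (- a)%C.
Proof.
  intros Hu. eapply Clim_squeeze; [|apply Hu].
  intros n; simpl. rewrite <- (Cmod_opp (u n - a)). right; f_equal; ring.
Qed.

Lemma Clim_minus (u v : nat -> C) a b :
  Clim u a -> Clim v b -> Clim (fun n => u n - v n)%C (a - b)%C.
Proof. intros Hu Hv. apply (Clim_plus u _ a _ Hu (Clim_opp v b Hv)). Qed.

Lemma Clim_Re (u : nat -> C) a : Clim u a -> is_lim_seq (fun n => Re (u n)) (Re a).
Proof.
  intros H. apply lim_of_error with (2 := H). intros n. rewrite <- re_minus. apply re_le_Cmod.
Qed.

Lemma Clim_Im (u : nat -> C) a : Clim u a -> is_lim_seq (fun n => Im (u n)) (Im a).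
Proof.
  intros H. apply lim_of_error with (2 := H). intros n. rewrite <- im_minus. apply im_le_Cmod.
Qed.

Lemma is_lim_seq_Finite_minus0 (u : nat -> R) (l : R) :
  is_lim_seq u l -> is_lim_seq (fun n => Rabs (u n - l)) 0.
Proof.
  intros H. apply -> is_lim_seq_abs_0.
  replace (Finite 0) with (Finite (l - l)) by (f_equal; ring).
  apply is_lim_seq_minus'; [exact H|apply is_lim_seq_const].
Qed.

Lemma Clim_of_components (u : nat -> C) (l : C) :
  is_lim_seq (fun n => Re (u n)) (Re l) -> is_lim_seq (fun n => Im (u n)) (Im l) -> Clim u l.
Proof.
  intros H1 H2.
  eapply Clim_squeeze; [|exact (lim0_plus _ _ (is_lim_seq_Finite_minus0 _ _ H1)
    (is_lim_seq_Finite_minus0 _ _ H2))].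
  intros n; simpl. eapply Rle_trans; [apply Cmod_le_abs|].
  rewrite re_minus, im_minus. lra.
Qed.

Lemma Clim_unique (u : nat -> C) a b : Clim u a -> Clim u b -> a = b.
Proof.
  intros Ha Hb. apply C_eq.
  - pose proof (is_lim_seq_unique _ _ (Clim_Re _ _ Ha)) as E1.
    rewrite (is_lim_seq_unique _ _ (Clim_Re _ _ Hb)) in E1. congruence.
  - pose proof (is_lim_seq_unique _ _ (Clim_Im _ _ Ha)) as E1.
    rewrite (is_lim_seq_unique _ _ (Clim_Im _ _ Hb)) in E1. congruence.
Qed.

Lemma Clim_C_lim_seq (u : nat -> C) l : Clim u l -> C_lim_seq u = l.
Proof.
  intros H. unfold C_lim_seq.
  rewrite (is_lim_seq_unique _ _ (Clim_Re _ _ H)), (is_lim_seq_unique _ _ (Clim_Im _ _ H)).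
  destruct l; reflexivity.
Qed.

Lemma Clim_Cmod (u : nat -> C) a : Clim u a -> is_lim_seq (fun n => Cmod (u n)) (Cmod a).
Proof.
  intros H. apply lim_of_error with (2 := H). intros n. apply Rabs_le.
  pose proof (Cmod_triangle_inv (u n) a). pose proof (Cmod_triangle_inv a (u n)) as H1.
  rewrite (Cmod_minus_sym a (u n)) in H1. lra.
Qed.

Lemma Clim_mult (u v : nat -> C) a b :
  Clim u a -> Clim v b -> Clim (fun n => u n * v n)%C (a * b)%C.
Proof.
  intros Hu Hv.
  assert (L : is_lim_seq (fun n => Cmod (u n) * Cmod (v n - b) + Cmod b * Cmod (u n - a)) 0).
  { apply lim0_plus.
    - replace (Finite 0) with (Finite (Cmod a * 0)) by (f_equal; ring).
      apply (is_lim_seq_mult' _ _ _ 0); [apply Clim_Cmod, Hu|apply Hv].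
    - apply lim0_scal, Hu. }
  eapply Clim_squeeze; [|exact L]. intros n; simpl.
  replace (u n * v n - a * b)%C with (u n * (v n - b) + b * (u n - a))%C by ring.
  eapply Rle_trans; [apply Cmod_triangle|]. rewrite !Cmod_mult; lra.
Qed.

Lemma Clim_le (u : nat -> C) l a b : Clim u l -> (forall n, Cmod (u n - a) <= b) -> Cmod (l - a) <= b.
Proof.
  intros H Hb.
  apply (is_lim_seq_le (fun n => Cmod (u n - a)) (fun _ => b) (Cmod (l - a)) b);
    [exact Hb| |apply is_lim_seq_const].
  apply Clim_Cmod. apply Clim_minus; [exact H|apply Clim_const].
Qed.

Lemma Clim_subseq (u : nat -> C) l (phi : nat -> nat) :
  (forall n, (n <= phi n)%nat) -> Clim u l -> Clim (fun n => u (phi n)) l.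
Proof. intros Hphi H. exact (lim_subseq (fun n => Cmod (u n - l)) 0 phi Hphi H). Qed.

Lemma Clim_Cexp (u : nat -> C) a : Clim u a -> Clim (fun n => Cexp (u n)) (Cexp a).
Proof.
  intros H. pose proof (Clim_Re _ _ H) as HR. pose proof (Clim_Im _ _ H) as HI.
  assert (HC : is_lim_seq (fun n => cos (Im (u n))) (cos (Im a))).
  { apply is_lim_seq_continuous; [apply derivable_continuous_pt, derivable_pt_cos|exact HI]. }
  assert (HS : is_lim_seq (fun n => sin (Im (u n))) (sin (Im a))).
  { apply is_lim_seq_continuous; [apply derivable_continuous_pt, derivable_pt_sin|exact HI]. }
  assert (HE : is_lim_seq (fun n => exp (Re (u n))) (exp (Re a))).
  { apply is_lim_seq_continuous; [apply derivable_continuous_pt, derivable_pt_exp|exact HR]. }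
  apply Clim_of_components; unfold Cexp.
  - apply is_lim_seq_ext with (fun n => exp (Re (u n)) * cos (Im (u n))).
    { intros n; simpl; ring. }
    replace (Re _) with (exp (Re a) * cos (Im a)) by (simpl; ring).
    apply is_lim_seq_mult'; auto.
  - apply is_lim_seq_ext with (fun n => exp (Re (u n)) * sin (Im (u n))).
    { intros n; simpl; ring. }
    replace (Im _) with (exp (Re a) * sin (Im a)) by (simpl; ring).
    apply is_lim_seq_mult'; auto.
Qed.

Lemma csum_converges (f : nat -> C) (b : nat -> R) :
  (forall k, Cmod (f k) <= b k) -> ex_series b -> exists l, Clim (csum f) l.
Proof.
  intros Hf Hb.
  assert (S1 : forall g : nat -> R, (forall k, Rabs (g k) <= b k) ->
    exists l : R, is_lim_seq (rsum g) l).
  { intros g Hg. destruct (@ex_series_le R_AbsRing R_CompleteNormedModule g b Hg Hb) as [l Hl].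
    exists l. apply is_lim_seq_incr_1.
    apply is_lim_seq_ext with (sum_n g); [|exact Hl].
    intros n. induction n as [|n IH].
    - rewrite sum_O. simpl. ring.
    - rewrite sum_Sn, IH. reflexivity. }
  destruct (S1 (fun k => Re (f k))) as [lr Hr].
  { intros k. eapply Rle_trans; [apply re_le_Cmod|apply Hf]. }
  destruct (S1 (fun k => Im (f k))) as [li Hi].
  { intros k. eapply Rle_trans; [apply im_le_Cmod|apply Hf]. }
  exists (lr, li). apply Clim_of_components.
  - eapply is_lim_seq_ext; [|exact Hr]. intros n; rewrite Re_csum; reflexivity.
  - eapply is_lim_seq_ext; [|exact Hi]. intros n; rewrite Im_csum; reflexivity.
Qed.

(** * Differential calculus of curves in the complex plane *)

Lemma continuous_of_ex_derive (f : R -> R) (x : R) : ex_derive f x -> continuous f x.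
Proof. apply (@ex_derive_continuous R_AbsRing R_NormedModule). Qed.

Definition cderive (f : R -> C) (s : R) (l : C) : Prop :=
  is_derive (fun x => Re (f x)) s (Re l) /\ is_derive (fun x => Im (f x)) s (Im l).

Lemma cderive_eq f s l l' : cderive f s l -> l = l' -> cderive f s l'.
Proof. intros H <-; exact H. Qed.

Lemma cderive_const (a : C) s : cderive (fun _ => a) s 0%C.
Proof. split; apply (is_derive_const (K := R_AbsRing) (V := R_NormedModule)). Qed.

Lemma cderive_plus f g s a b :
  cderive f s a -> cderive g s b -> cderive (fun x => f x + g x)%C s (a + b)%C.
Proof.
  intros [H1 H2] [H3 H4]; split.
  - apply (is_derive_plus (K := R_AbsRing) (V := R_NormedModule) _ _ _ _ _ H1 H3).
  - apply (is_derive_plus (K := R_AbsRing) (V := R_NormedModule) _ _ _ _ _ H2 H4).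
Qed.

Lemma cderive_opp f s a : cderive f s a -> cderive (fun x => - f x)%C s (- a)%C.
Proof.
  intros [H1 H2]; split.
  - apply (is_derive_opp (K := R_AbsRing) (V := R_NormedModule) _ _ _ H1).
  - apply (is_derive_opp (K := R_AbsRing) (V := R_NormedModule) _ _ _ H2).
Qed.

Lemma cderive_minus f g s a b :
  cderive f s a -> cderive g s b -> cderive (fun x => f x - g x)%C s (a - b)%C.
Proof. intros H1 H2. apply cderive_plus; [exact H1|apply cderive_opp, H2]. Qed.

Lemma cderive_mult f g s a b :
  cderive f s a -> cderive g s b ->
  cderive (fun x => f x * g x)%C s (a * g s + f s * b)%C.
Proof.
  intros [H1 H2] [H3 H4]; split; simpl.
  - evar_last.
    + apply (is_derive_minus (K := R_AbsRing) (V := R_NormedModule)).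
      * apply (is_derive_mult (K := R_AbsRing) _ _ _ _ _ H1 H3 Rmult_comm).
      * apply (is_derive_mult (K := R_AbsRing) _ _ _ _ _ H2 H4 Rmult_comm).
    + unfold minus, plus, opp, mult; simpl. unfold Re, Im. ring.
  - evar_last.
    + apply (is_derive_plus (K := R_AbsRing) (V := R_NormedModule)).
      * apply (is_derive_mult (K := R_AbsRing) _ _ _ _ _ H1 H4 Rmult_comm).
      * apply (is_derive_mult (K := R_AbsRing) _ _ _ _ _ H2 H3 Rmult_comm).
    + unfold minus, plus, opp, mult; simpl. unfold Re, Im. ring.
Qed.

Lemma cderive_scal k f s a : cderive f s a -> cderive (fun x => k * f x)%C s (k * a)%C.
Proof.
  intros H. eapply cderive_eq; [apply cderive_mult; [apply cderive_const|exact H]|].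
  cbv beta; ring.
Qed.

Lemma cderive_RtoC (f : R -> R) s (l : R) : is_derive f s l -> cderive (fun x => RtoC (f x)) s (RtoC l).
Proof.
  intros H; split; [exact H|].
  exact (@is_derive_const R_AbsRing R_NormedModule 0 s).
Qed.

Lemma cderive_id s : cderive (fun x => RtoC x) s 1%C.
Proof. exact (cderive_RtoC (fun x => x) s 1 (@is_derive_id R_AbsRing s)). Qed.

Lemma cderive_pow f s a (n : nat) :
  cderive f s a -> cderive (fun x => f x ^ S n)%C s (INR (S n) * a * f s ^ n)%C.
Proof.
  intros H. induction n as [|n IH].
  - eapply cderive_eq.
    + apply (cderive_mult f (fun _ => 1%C)); [exact H|apply cderive_const].
    + cbv beta; simpl; ring.
  - eapply cderive_eq.
    + apply (cderive_mult f (fun x => f x ^ S n)%C); [exact H|exact IH].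
    + cbv beta. rewrite (S_INR (S n)), RtoC_plus, !Cpow_S. ring.
Qed.

Lemma cderive_csum (F : nat -> R -> C) (D : nat -> C) s n :
  (forall k, (k < n)%nat -> cderive (F k) s (D k)) ->
  cderive (fun x => csum (fun k => F k x) n) s (csum D n).
Proof.
  induction n as [|n IH]; intros H; simpl; [apply cderive_const|].
  apply cderive_plus; [apply IH; intros; apply H; lia|apply H; lia].
Qed.

Lemma cderive_Cexp f s a : cderive f s a -> cderive (fun x => Cexp (f x)) s (a * Cexp (f s))%C.
Proof.
  intros [H1 H2].
  set (u := fun x => Re (f x)) in *. set (v := fun x => Im (f x)) in *.
  change (is_derive u s (Re a)) in H1. change (is_derive v s (Im a)) in H2.
  assert (E1 : ex_derive u s) by (eexists; exact H1).
  assert (E2 : ex_derive v s) by (eexists; exact H2).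
  split.
  - apply is_derive_ext with (fun x => exp (u x) * cos (v x)).
    { intros x; unfold u, v, Cexp; simpl; ring. }
    auto_derive; [repeat split; auto|].
    change (fun x : R => u x) with u; change (fun x : R => v x) with v; rewrite (is_derive_unique _ _ _ H1), (is_derive_unique _ _ _ H2).
    unfold u, v, Cexp; simpl. unfold Re, Im; ring.
  - apply is_derive_ext with (fun x => exp (u x) * sin (v x)).
    { intros x; unfold u, v, Cexp; simpl; ring. }
    auto_derive; [repeat split; auto|].
    change (fun x : R => u x) with u; change (fun x : R => v x) with v; rewrite (is_derive_unique _ _ _ H1), (is_derive_unique _ _ _ H2).
    unfold u, v, Cexp; simpl. unfold Re, Im; ring.
Qed.

Lemma C_nz_sqr (z : C) : z <> 0%C -> 0 < Re z * Re z + Im z * Im z.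
Proof. intros H. rewrite <- Cmod_sqr. apply Cmod_gt_0 in H. nra. Qed.

Lemma cderive_inv f s a : cderive f s a -> f s <> 0%C ->
  cderive (fun x => / f x)%C s (- a / (f s * f s))%C.
Proof.
  intros [H1 H2] Hz. apply C_nz_sqr in Hz as Hp.
  set (u := fun x => Re (f x)) in *. set (v := fun x => Im (f x)) in *.
  change (is_derive u s (Re a)) in H1. change (is_derive v s (Im a)) in H2.
  assert (E1 : ex_derive u s) by (eexists; exact H1).
  assert (E2 : ex_derive v s) by (eexists; exact H2).
  assert (E : (- a / (f s * f s))%C =
    (- a * (Cconj (f s) * Cconj (f s)) * RtoC (/ ((Re (f s) * Re (f s) + Im (f s) * Im (f s)) ^ 2)))%C).
  { rewrite <- Cmod_sqr.
    rewrite RtoC_inv; [|apply pow_nonzero; rewrite Cmod_sqr; lra].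
    rewrite RtoC_pow.
    replace (Cmod (f s) * Cmod (f s)) with (Cmod (f s) ^ 2) by ring.
    rewrite Cmod2_conj.
    assert (Cconj (f s) <> 0%C).
    { intros Hc. apply Hz. rewrite <- (Cconj_conj (f s)), Hc. apply C_eq; simpl; lra. }
    field; auto. }
  rewrite E. split.
  - apply is_derive_ext with (fun x => u x / (u x * u x + v x * v x)).
    { intros x; unfold u, v; simpl. unfold Re, Im; f_equal; ring. }
    auto_derive; [repeat split; auto; unfold u, v; lra|].
    change (fun x : R => u x) with u; change (fun x : R => v x) with v; rewrite (is_derive_unique _ _ _ H1), (is_derive_unique _ _ _ H2).
    unfold u, v; simpl. unfold Re, Im in *. field. nra.
  - apply is_derive_ext with (fun x => - v x / (u x * u x + v x * v x)).
    { intros x; unfold u, v; simpl. unfold Re, Im; f_equal; ring. }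
    auto_derive; [repeat split; auto; unfold u, v; lra|].
    change (fun x : R => u x) with u; change (fun x : R => v x) with v; rewrite (is_derive_unique _ _ _ H1), (is_derive_unique _ _ _ H2).
    unfold u, v; simpl. unfold Re, Im in *. field. nra.
Qed.

Lemma cderive_div f g s a b : cderive f s a -> cderive g s b -> g s <> 0%C ->
  cderive (fun x => f x / g x)%C s ((a * g s - f s * b) / (g s * g s))%C.
Proof.
  intros H1 H2 Hz. eapply cderive_eq.
  - apply cderive_mult; [exact H1|apply cderive_inv; [exact H2|exact Hz]].
  - cbv beta; field; auto.
Qed.

(** The principal branch; [atan] gives the argument only in the right half-plane, which
    contains every [1 - z] used below. *)
Definition Clog (w : C) : C :=
  (ln (Re w * Re w + Im w * Im w) / 2, atan (Im w / Re w)).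

Lemma cderive_Clog f s a : cderive f s a -> 0 < Re (f s) ->
  cderive (fun x => Clog (f x)) s (a / f s)%C.
Proof.
  intros [H1 H2] Hp.
  set (u := fun x => Re (f x)) in *. set (v := fun x => Im (f x)) in *.
  change (is_derive u s (Re a)) in H1. change (is_derive v s (Im a)) in H2.
  assert (E1 : ex_derive u s) by (eexists; exact H1).
  assert (E2 : ex_derive v s) by (eexists; exact H2).
  split; unfold Clog; simpl.
  - apply is_derive_ext with (fun x => ln (u x * u x + v x * v x) / 2); [intros; reflexivity|].
    auto_derive; [repeat split; auto; unfold u, v; nra|].
    change (fun x : R => u x) with u; change (fun x : R => v x) with v; rewrite (is_derive_unique _ _ _ H1), (is_derive_unique _ _ _ H2).
    unfold u, v; unfold Re, Im in *; simpl. field. nra.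
  - apply is_derive_ext with (fun x => atan (v x / u x)); [intros; reflexivity|].
    auto_derive; [repeat split; auto; unfold u, v; lra|].
    change (fun x : R => u x) with u; change (fun x : R => v x) with v; rewrite (is_derive_unique _ _ _ H1), (is_derive_unique _ _ _ H2).
    unfold u, v; unfold Re, Im in *; simpl. field. split; nra.
Qed.

Lemma Cexp_Clog (w : C) : 0 < Re w -> Cexp (Clog w) = w.
Proof.
  intros Hp. unfold Cexp, Clog; cbv [Re Im fst snd]. destruct w as [x y]; simpl in *.
  assert (Hs : 0 < x * x + y * y) by nra.
  assert (Q : exp (ln (x * x + y * y) / 2) = x * sqrt (1 + (y / x)²)).
  { rewrite <- (sqrt_Rsqr x) at 3 by lra. rewrite <- sqrt_mult; [|unfold Rsqr; nra|].
    2:{ pose proof (Rle_0_sqr (y / x)); lra. }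
    replace (x² * (1 + (y / x)²)) with (x * x + y * y) by (unfold Rsqr; field; lra).
    apply Rsqr_inj; [left; apply exp_pos|apply sqrt_pos|].
    rewrite Rsqr_sqrt by lra. unfold Rsqr. rewrite <- exp_plus.
    replace (ln (x * x + y * y) / 2 + ln (x * x + y * y) / 2) with (ln (x * x + y * y)) by lra.
    apply exp_ln; lra. }
  assert (Hq : 0 < sqrt (1 + (y / x)²)).
  { apply sqrt_lt_R0. pose proof (Rle_0_sqr (y / x)); lra. }
  rewrite Q, cos_atan, sin_atan. apply C_eq; simpl; field; lra.
Qed.

(** * The mean value inequality *)

Lemma decreasing_of_derive (f df : R -> R) a b : a <= b ->
  (forall s, a <= s <= b -> is_derive f s (df s)) ->
  (forall s, a <= s <= b -> df s <= 0) -> f b <= f a.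
Proof.
  intros Hab Hd Hn.
  destruct (MVT_gen f a b df) as [c [Hc E]].
  - rewrite Rmin_left, Rmax_right by lra. intros; apply Hd; lra.
  - rewrite Rmin_left, Rmax_right by lra. intros x Hx.
    apply continuity_pt_filterlim. apply continuous_of_ex_derive. exists (df x); apply Hd; lra.
  - rewrite Rmin_left, Rmax_right in Hc by lra. specialize (Hn c Hc). nra.
Qed.

(** Apply the real mean value inequality to the projection of [f] on the direction of
    [f b - f a]; this loses no constant. *)
Lemma mean_value_ineq (f df : R -> C) (m dm : R -> R) a b : a <= b ->
  (forall s, a <= s <= b -> cderive f s (df s)) ->
  (forall s, a <= s <= b -> is_derive m s (dm s)) ->
  (forall s, a <= s <= b -> Cmod (df s) <= dm s) ->
  Cmod (f b - f a) <= m b - m a.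
Proof.
  intros Hab Hf Hm Hle.
  assert (Hmm : m a <= m b).
  { pose proof (decreasing_of_derive (fun s => - m s) (fun s => - dm s) a b Hab) as K.
    assert (- m b <= - m a); [|lra]. apply K.
    - intros s Hs. exact (@is_derive_opp R_AbsRing R_NormedModule _ _ _ (Hm s Hs)).
    - intros s Hs. specialize (Hle s Hs). pose proof (Cmod_ge_0 (df s)); lra. }
  set (w := (f b - f a)%C) in *.
  destruct (Req_dec (Cmod w) 0) as [E|Hw]; [lra|].
  assert (Hw0 : 0 < Cmod w) by (pose proof (Cmod_ge_0 w); lra).
  pose proof (decreasing_of_derive
    (fun s => Re (Cconj w * f s) - Cmod w * m s)
    (fun s => Re (Cconj w * df s) - Cmod w * dm s) a b Hab) as K.
  assert (K2 : Re (Cconj w * f b) - Cmod w * m b <= Re (Cconj w * f a) - Cmod w * m a).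
  { apply K.
    - intros s Hs. apply (@is_derive_minus R_AbsRing R_NormedModule).
      + apply (cderive_scal (Cconj w) f s _ (Hf s Hs)).
      + apply (is_derive_scal m s (Cmod w) (dm s)). apply Hm; auto.
    - intros s Hs. pose proof (re_le (Cconj w * df s)) as R1.
      rewrite Cmod_mult, Cmod_conj in R1. specialize (Hle s Hs). nra. }
  assert (E2 : Re (Cconj w * f b) - Re (Cconj w * f a) = Cmod w * Cmod w).
  { rewrite <- re_minus. replace (Cconj w * f b - Cconj w * f a)%C with (w * Cconj w)%C
      by (unfold w; ring).
    rewrite <- Cmod2_conj, <- ?RtoC_pow. change (Cmod w ^ 2 = Cmod w * Cmod w). ring. }
  nra.
Qed.

Lemma mean_value_const (f df : R -> C) M a b : a <= b ->
  (forall s, a <= s <= b -> cderive f s (df s)) ->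
  (forall s, a <= s <= b -> Cmod (df s) <= M) ->
  Cmod (f b - f a) <= M * (b - a).
Proof.
  intros Hab Hf HM.
  replace (M * (b - a)) with (M * b - M * a) by ring.
  apply (mean_value_ineq f df (fun s => M * s) (fun _ => M) a b Hab Hf); auto.
  intros s _. auto_derive; auto; ring.
Qed.

Lemma Cexp_minus_1_le (z : C) : Cmod (Cexp z - 1) <= Cmod z * exp (Rmax 0 (Re z)).
Proof.
  rewrite <- Cexp_0.
  replace (Cmod z * exp (Rmax 0 (Re z))) with (Cmod z * exp (Rmax 0 (Re z)) * (1 - 0)) by ring.
  replace (Cexp z) with (Cexp (z * RtoC 1)) by (f_equal; ring).
  replace (Cexp 0) with (Cexp (z * RtoC 0)) by (f_equal; ring).
  apply (mean_value_const (fun s => Cexp (z * s)) (fun s => z * 1 * Cexp (z * s))%C); [lra| |].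
  - intros s _. apply (cderive_Cexp (fun s => z * s)%C), cderive_scal, cderive_id.
  - intros s Hs. rewrite Cmult_1_r, Cmod_mult, Cmod_Cexp, re_scal_r.
    apply Rmult_le_compat_l; [apply Cmod_ge_0|].
    assert (Re z * s <= Rmax 0 (Re z)).
    { pose proof (Rmax_l 0 (Re z)). pose proof (Rmax_r 0 (Re z)). nra. }
    destruct (Req_dec (Re z * s) (Rmax 0 (Re z))) as [->|]; [lra|].
    left; apply exp_increasing; lra.
Qed.

Lemma exp_le (x y : R) : x <= y -> exp x <= exp y.
Proof. intros [H| ->]; [left; apply exp_increasing; auto|lra]. Qed.

Lemma Cexp_minus_1_nonpos (z : C) : Re z <= 0 -> Cmod (Cexp z - 1) <= Cmod z.
Proof.
  intros H. pose proof (Cexp_minus_1_le z) as K. rewrite Rmax_left, exp_0 in K by lra. lra.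
Qed.

Lemma Cexp_minus_1_gen (z : C) : Cmod (Cexp z - 1) <= Cmod z * exp (Cmod z).
Proof.
  eapply Rle_trans; [apply Cexp_minus_1_le|].
  apply Rmult_le_compat_l; [apply Cmod_ge_0|]. apply exp_le.
  apply Rmax_lub; [apply Cmod_ge_0|apply re_le].
Qed.

Lemma Cexp_taylor2 (z : C) : Cmod (Cexp z - 1 - z) <= Cmod z * Cmod z * exp (Rmax 0 (Re z)).
Proof.
  pose proof (Cmod_ge_0 z) as Hz.
  replace (Cexp z - 1 - z)%C with ((Cexp (z * RtoC 1) - z * RtoC 1) - (Cexp (z * RtoC 0) - z * RtoC 0))%C.
  2:{ replace (z * RtoC 0)%C with (RtoC 0) by ring. rewrite Cexp_0, Cmult_1_r. ring. }
  replace (Cmod z * Cmod z * exp (Rmax 0 (Re z))) with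
    (Cmod z * Cmod z * exp (Rmax 0 (Re z)) * (1 - 0)) by ring.
  apply (mean_value_const (fun s => Cexp (z * s) - z * s)%C
    (fun s => z * 1 * Cexp (z * s) - z * 1)%C); [lra| |].
  - intros s _. apply cderive_minus.
    + apply (cderive_Cexp (fun s => z * s)%C), cderive_scal, cderive_id.
    + apply cderive_scal, cderive_id.
  - intros s Hs. replace (z * 1 * Cexp (z * s) - z * 1)%C with (z * (Cexp (z * s) - 1))%C by ring.
    rewrite Cmod_mult, Rmult_assoc. apply Rmult_le_compat_l; [auto|].
    eapply Rle_trans; [apply Cexp_minus_1_le|].
    rewrite Cmod_mult, Cmod_R, Rabs_pos_eq by lra.
    apply Rmult_le_compat; [nra|left; apply exp_pos|nra|].
    apply exp_le. rewrite re_scal_r. pose proof (Rmax_l 0 (Re z)). pose proof (Rmax_r 0 (Re z)).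
    apply Rmax_lub; nra.
Qed.

(** * The logarithmic series and the infinite product *)

Lemma INR_S_pos (k : nat) : 0 < INR (S k).
Proof. apply lt_0_INR; lia. Qed.

Lemma RtoC_INR_S_nz (k : nat) : RtoC (INR (S k)) <> 0%C.
Proof. apply RtoC_nz. pose proof (INR_S_pos k); lra. Qed.

Lemma pow_le_1 (x : R) n : 0 <= x <= 1 -> x ^ n <= 1.
Proof. intros H. rewrite <- (pow1 n). apply pow_incr; lra. Qed.

Lemma Clog_1 : Clog 1 = 0%C.
Proof.
  unfold Clog; apply C_eq; simpl.
  - replace (1 * 1 + 0 * 0) with 1 by ring. rewrite ln_1; lra.
  - replace (0 / 1) with 0 by field. apply atan_0.
Qed.

(** Along the segment from 0 to [z] the remainder has derivative
    [- z (z s)^K / (1 - z s)]. Unlike the usual bound by [1/(1 - |z|)], this one stays useful on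
    the unit circle away from 1, where it gives uniform convergence in [1/K]. *)
Lemma Clog_series_remainder (z : C) (c : R) (K : nat) :
  0 < c -> Re z < 1 -> (forall s, 0 <= s <= 1 -> c <= Cmod (1 - z * RtoC s)) ->
  Cmod (Clog (1 - z) + csum (fun k => z ^ S k / INR (S k))%C K)
    <= Cmod z ^ S K / (c * INR (S K)).
Proof.
  intros Hc Hz Hlow. pose proof (INR_S_pos K) as HK.
  set (gam := fun s : R => (Clog (1 - z * s) + csum (fun k => / INR (S k) * (z * s) ^ S k) K)%C).
  set (dgam := fun s : R => (- z * (z * s) ^ K / (1 - z * s))%C).
  assert (Hnz : forall s, 0 <= s <= 1 -> (1 - z * RtoC s)%C <> 0%C).
  { intros s Hs. apply Cmod_gt_0. specialize (Hlow s Hs); lra. }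
  pose proof (mean_value_ineq gam dgam
    (fun s => Cmod z ^ S K / (c * INR (S K)) * s ^ S K)
    (fun s => Cmod z ^ S K / c * s ^ K) 0 1 ltac:(lra)) as HM.
  assert (E0 : gam 0 = 0%C).
  { unfold gam. replace (1 - z * RtoC 0)%C with (RtoC 1) by ring. rewrite Clog_1.
    rewrite (csum_ext _ (fun _ => 0%C)); [rewrite csum_const; ring|].
    intros k _. rewrite Cpow_S. ring. }
  assert (E1 : gam 1 = (Clog (1 - z) + csum (fun k => z ^ S k / INR (S k))%C K)%C).
  { unfold gam. rewrite !Cmult_1_r. f_equal. apply csum_ext. intros k _.
    unfold Cdiv; ring. }
  rewrite E0, E1 in HM.
  replace (Clog (1 - z) + csum (fun k => z ^ S k / INR (S k)) K - 0)%C
    with (Clog (1 - z) + csum (fun k => z ^ S k / INR (S k)) K)%C in HM by ring.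
  replace (Cmod z ^ S K / (c * INR (S K))) with
    (Cmod z ^ S K / (c * INR (S K)) * 1 ^ S K - Cmod z ^ S K / (c * INR (S K)) * 0 ^ S K).
  2:{ rewrite pow1. simpl. ring. }
  apply HM.
  - intros s Hs. unfold gam, dgam. eapply cderive_eq.
    + apply cderive_plus.
      * apply (cderive_Clog (fun s => 1 - z * s)%C).
        -- apply cderive_minus; [apply cderive_const|apply cderive_scal, cderive_id].
        -- rewrite re_minus, re_scal_r. simpl.
           destruct (Rle_dec (Re z) 0); nra.
      * apply (cderive_csum (fun k s => / INR (S k) * (z * s) ^ S k)%C
          (fun k => z * (z * s) ^ k)%C).
        intros k _. eapply cderive_eq.
        -- apply cderive_scal, cderive_pow, cderive_scal, cderive_id.
        -- pose proof (RtoC_INR_S_nz k). cbv beta. field. auto.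
    + rewrite csum_scal, csum_geom by auto. field. auto.
  - intros s Hs. auto_derive; auto.
    change (match K with O => 1 | S _ => INR K + 1 end) with (INR (S K)). change (Cmod z ^ S K) with (Cmod z * Cmod z ^ K). field. lra.
  - intros s Hs. unfold dgam. rewrite Cmod_div by auto.
    rewrite Cmod_mult, Cmod_opp, Cmod_pow, Cmod_mult, Cmod_R, Rabs_pos_eq by lra.
    rewrite Rpow_mult_distr.
    replace (Cmod z ^ S K / c * s ^ K) with (Cmod z * (Cmod z ^ K * s ^ K) * / c)
      by (simpl; field; lra).
    apply Rmult_le_compat_l.
    + pose proof (Cmod_ge_0 z). repeat apply Rmult_le_pos; auto; apply pow_le; lra.
    + apply Rinv_le_contravar; auto.
Qed.

Lemma Cmod_1_minus_ge (z : C) : 1 - Cmod z <= Cmod (1 - z).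
Proof. pose proof (Cmod_triangle_inv 1 z) as H. rewrite Cmod_1 in H; exact H. Qed.

Lemma Clog_series_disc (z : C) (K : nat) : Cmod z < 1 ->
  Cmod (Clog (1 - z) + csum (fun k => z ^ S k / INR (S k))%C K) <= Cmod z ^ S K / (1 - Cmod z).
Proof.
  intros Hz. pose proof (Cmod_ge_0 z) as H0.
  eapply Rle_trans; [apply (Clog_series_remainder z (1 - Cmod z))|].
  - lra.
  - pose proof (re_le z); lra.
  - intros s Hs. eapply Rle_trans; [|apply Cmod_1_minus_ge].
    rewrite Cmod_mult, Cmod_R, Rabs_pos_eq by lra. nra.
  - apply Rmult_le_compat_l; [apply pow_le; auto|].
    apply Rinv_le_contravar; [lra|].
    assert (1 <= INR (S K)). { rewrite S_INR. pose proof (pos_INR K); lra. } nra.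
Qed.

Lemma Clog_le (z : C) : Cmod z < 1 -> Cmod (Clog (1 - z)) <= Cmod z / (1 - Cmod z).
Proof.
  intros Hz. pose proof (Clog_series_disc z 0 Hz) as H. simpl in H.
  rewrite Cplus_0_r, Rmult_1_r in H. exact H.
Qed.

Lemma Re_1_minus_pos (z : C) : Cmod z < 1 -> 0 < Re (1 - z).
Proof. intros H. rewrite re_minus. pose proof (re_le z). simpl. lra. Qed.

Lemma Cmod_pow_lt_1 (q : C) n : Cmod q < 1 -> (0 < n)%nat -> Cmod (q ^ n) < 1.
Proof.
  intros H Hn. rewrite Cmod_pow. apply pow_lt_1_compat; auto. split; [apply Cmod_ge_0|auto].
Qed.

Lemma qpoch_fin_exp (q : C) N : Cmod q < 1 ->
  qpoch_fin q q N = Cexp (csum (fun k => Clog (1 - q ^ S k)) N).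
Proof.
  intros Hq. induction N as [|N IH]; [simpl; rewrite Cexp_0; reflexivity|]. rewrite csum_S.
  rewrite Cexp_plus, <- IH, Cexp_Clog; [reflexivity|].
  apply Re_1_minus_pos, Cmod_pow_lt_1; auto; lia.
Qed.

Lemma qpoch_fin_limit (q : C) : Cmod q < 1 ->
  exists L, Clim (csum (fun k => Clog (1 - q ^ S k))) L /\ Clim (qpoch_fin q q) (Cexp L).
Proof.
  intros Hq. pose proof (Cmod_ge_0 q) as H0.
  destruct (csum_converges (fun k => Clog (1 - q ^ S k)) (fun k => / (1 - Cmod q) * Cmod q ^ k)) as [L HL].
  - intros k. eapply Rle_trans; [apply Clog_le, Cmod_pow_lt_1; auto; lia|].
    rewrite Cmod_pow. rewrite Rmult_comm.
    assert (B1 : Cmod q ^ S k <= Cmod q ^ k).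
    { simpl. pose proof (pow_le _ k H0). nra. }
    assert (B2 : Cmod q ^ S k <= Cmod q).
    { simpl. pose proof (pow_le_1 (Cmod q) k). nra. }
    apply Rmult_le_compat; [apply pow_le; auto|left; apply Rinv_0_lt_compat; lra|auto|].
    apply Rinv_le_contravar; lra.
  - apply (ex_series_scal_l (V := R_NormedModule) (/ (1 - Cmod q)) (fun k => Cmod q ^ k)). apply ex_series_geom.
    rewrite Rabs_pos_eq; auto.
  - exists L. split; [exact HL|]. eapply Clim_ext; [intros N; symmetry; apply qpoch_fin_exp; auto|].
    apply (Clim_Cexp _ _ HL).
Qed.

(** A logarithm of the product of [1 - q^n] over [n <= t J], [t] not dividing [n]. *)
Definition log_quotient (t : nat) (q : C) (J : nat) : C :=
  csum (fun j => csum (fun r => Clog (1 - q ^ (t * j + S r))) (t - 1)) J.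

Definition is_quotient (t : nat) (q F : C) : Prop :=
  Clim (fun J => Cexp (log_quotient t q J)) F.

Lemma log_quotient_eq (t : nat) (q : C) (J : nat) : (0 < t)%nat ->
  csum (fun k => Clog (1 - q ^ S k)) (t * J) =
  (log_quotient t q J + csum (fun k => Clog (1 - (q ^ t) ^ S k)) J)%C.
Proof.
  intros Ht. unfold log_quotient. rewrite <- csum_plus.
  induction J as [|J IH]; [rewrite Nat.mul_0_r; reflexivity|].
  replace (t * S J)%nat with (t * J + t)%nat by lia.
  rewrite csum_add, IH, csum_S. f_equal.
  transitivity (csum (fun k => Clog (1 - q ^ S (t * J + k))) (S (t - 1))); [f_equal; lia|].
  rewrite csum_S. f_equal.
  - apply csum_ext. intros k _. do 3 f_equal. lia.
  - do 2 f_equal. rewrite <- Cpow_mult_r. f_equal. nia.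
Qed.

Lemma eta_quotient_limit (t m : nat) (q : C) : (0 < t)%nat -> Cmod q < 1 ->
  exists F : C,
    (qpoch_inf q q ^ m / qpoch_inf (q ^ t) (q ^ t) ^ m)%C = (F ^ m)%C /\
    is_quotient t q F.
Proof.
  intros Ht Hq.
  assert (Hqt : Cmod (q ^ t) < 1) by (apply Cmod_pow_lt_1; auto).
  destruct (qpoch_fin_limit q Hq) as [L1 [_ HL1]].
  destruct (qpoch_fin_limit (q ^ t) Hqt) as [L2 [HS2 HL2]].
  exists (Cexp (L1 - L2)). split.
  - unfold qpoch_inf. rewrite (Clim_C_lim_seq _ _ HL1), (Clim_C_lim_seq _ _ HL2).
    rewrite !Cexp_pow, <- Cexp_minus. f_equal. ring.
  - set (S2 := fun J => csum (fun k => Clog (1 - (q ^ t) ^ S k)) J).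
    unfold is_quotient. rewrite Cexp_minus.
    apply Clim_ext with (fun J => qpoch_fin q q (t * J) * Cexp (- S2 J))%C.
    { intros J. rewrite qpoch_fin_exp, <- Cexp_plus by auto. f_equal.
      rewrite log_quotient_eq by auto. unfold S2; ring. }
    apply Clim_mult.
    + apply (Clim_subseq (qpoch_fin q q)); auto. intros n. nia.
    + rewrite <- Cexp_opp. apply Clim_Cexp, Clim_opp, HS2.
Qed.

(** * Lambert series and an upper bound for the product *)

(** The sum of the powers [w^n], [n >= 1]: the series of [log (1 - q^n)] becomes a series
    in the values of this function at powers of [q]. *)
Definition lambert (w : C) : C := (w / (1 - w))%C.

Lemma one_minus_nz (w : C) : Cmod w < 1 -> (1 - w)%C <> 0%C.
Proof. intros H. apply Cmod_gt_0. pose proof (Cmod_1_minus_ge w); lra. Qed.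

Lemma Cmod_lambert_le (w : C) : Cmod w < 1 -> Cmod (lambert w) <= Cmod w / (1 - Cmod w).
Proof.
  intros H. unfold lambert. rewrite Cmod_div by (apply one_minus_nz; auto).
  apply Rmult_le_compat_l; [apply Cmod_ge_0|].
  apply Rinv_le_contravar; [lra|apply Cmod_1_minus_ge].
Qed.

Lemma Re_lambert (w : C) : Cmod w < 1 ->
  Re (lambert w) = (Re w - Cmod w * Cmod w) / (1 - 2 * Re w + Cmod w * Cmod w).
Proof.
  intros H. pose proof (one_minus_nz w H) as Hn. apply C_nz_sqr in Hn.
  rewrite Cmod_sqr. unfold lambert. destruct w as [a b]. simpl in *. field.
  nra.
Qed.

(** After clearing the denominator the difference is affine in [Re w], hence it is enough
    that it is nonnegative at [Re w = |w|] and [Re w = - |w|]. *)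
Lemma Re_lambert_ge (w : C) : Cmod w < 1 -> - Cmod w <= Re (lambert w).
Proof.
  intros H. rewrite Re_lambert by auto.
  pose proof (re_le w) as H1.
  assert (H2 : - Cmod w <= Re w).
  { pose proof (re_le_Cmod w) as H2. apply Rabs_le_between in H2. lra. }
  set (r := Cmod w) in *. set (x := Re w) in *.
  assert (Hp : 0 < 1 - 2 * x + r * r) by nra.
  apply (Rmult_le_reg_r (1 - 2 * x + r * r)); [auto|].
  unfold Rdiv. rewrite Rmult_assoc, Rinv_l, Rmult_1_r by lra.
  nra.
Qed.

(** Expand each logarithm and exchange the two sums: the inner one is geometric. Keeping
    both [J] and [K] finite makes the exchange trivial and the error explicit. *)
Lemma log_sum_lambert (q : C) (J K : nat) : Cmod q < 1 ->
  Cmod (csum (fun n => Clog (1 - q ^ S n)) J + csum (fun k => lambert (q ^ S k) / INR (S k))%C K)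
  <= INR J / (1 - Cmod q) * Cmod q ^ K + / (1 - Cmod q) ^ 2 * Cmod q ^ J.
Proof.
  intros Hq. pose proof (Cmod_ge_0 q) as H0. set (r := Cmod q) in *.
  set (A1 := csum (fun n => Clog (1 - q ^ S n) + csum (fun k => (q ^ S n) ^ S k / INR (S k)) K)%C J).
  set (A2 := csum (fun k => lambert (q ^ S k) * (q ^ S k) ^ J / INR (S k))%C K).
  assert (E : (csum (fun n => Clog (1 - q ^ S n)) J + csum (fun k => lambert (q ^ S k) / INR (S k)) K)%C
    = (A1 + A2)%C).
  { unfold A1. rewrite csum_plus, csum_swap. unfold A2. rewrite <- Cplus_assoc. f_equal.
    rewrite <- csum_plus. apply csum_ext. intros k _.
    rewrite (csum_ext _ (fun n => (q ^ S k / INR (S k)) * (q ^ S k) ^ n)%C).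
    2:{ intros n _. rewrite <- Cpow_mult_r, (Nat.mul_comm (S n)), Cpow_mult_r, (Cpow_S _ n).
        unfold Cdiv; ring. }
    assert (Hn : (1 - q ^ S k)%C <> 0%C) by (apply one_minus_nz, Cmod_pow_lt_1; auto; lia).
    rewrite csum_scal, csum_geom by auto. unfold lambert. field.
    repeat split; auto; apply RtoC_INR_S_nz. }
  rewrite E. eapply Rle_trans; [apply Cmod_triangle|]. apply Rplus_le_compat.
  - eapply Rle_trans; [apply Cmod_csum|].
    apply Rle_trans with (rsum (fun _ => / (1 - r) * r ^ K) J).
    + apply rsum_le. intros n _.
      assert (Hn : Cmod (q ^ S n) < 1) by (apply Cmod_pow_lt_1; auto; lia).
      assert (Hn2 : Cmod (q ^ S n) <= r).
      { rewrite Cmod_pow. fold r. simpl. pose proof (pow_le_1 r n). nra. }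
      pose proof (Cmod_ge_0 (q ^ S n)) as Hn0.
      eapply Rle_trans; [apply Clog_series_disc; auto|].
      unfold Rdiv; rewrite Rmult_comm.
      apply Rmult_le_compat.
      * left; apply Rinv_0_lt_compat; lra.
      * apply pow_le; auto.
      * apply Rinv_le_contravar; lra.
      * apply Rle_trans with (r ^ S K); [apply pow_incr; lra|]. simpl.
        pose proof (pow_le r K H0). nra.
    + rewrite rsum_const. unfold Rdiv. lra.
  - eapply Rle_trans; [apply Cmod_csum|].
    apply Rle_trans with (rsum (fun k => (/ (1 - r) * r ^ J) * r ^ k) K).
    + apply rsum_le. intros k _.
      assert (Hn : Cmod (q ^ S k) < 1) by (apply Cmod_pow_lt_1; auto; lia).
      rewrite Cmod_div by apply RtoC_INR_S_nz. rewrite Cmod_mult, Cmod_R.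
      rewrite Rabs_pos_eq by (left; apply INR_S_pos).
      assert (B0 : Cmod (q ^ S k) <= r ^ k).
      { rewrite Cmod_pow. fold r. simpl. pose proof (pow_le r k H0). nra. }
      assert (B00 : Cmod (q ^ S k) <= r).
      { rewrite Cmod_pow. fold r. simpl. pose proof (pow_le_1 r k). nra. }
      assert (B1 : Cmod (lambert (q ^ S k)) <= / (1 - r) * r ^ k).
      { eapply Rle_trans; [apply Cmod_lambert_le; auto|]. unfold Rdiv; rewrite Rmult_comm.
        apply Rmult_le_compat; auto; [left; apply Rinv_0_lt_compat; lra|apply Cmod_ge_0|].
        apply Rinv_le_contravar; lra. }
      assert (B2 : Cmod ((q ^ S k) ^ J) <= r ^ J).
      { rewrite Cmod_pow. apply pow_incr; split; [apply Cmod_ge_0|auto]. }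
      apply Rle_trans with (Cmod (lambert (q ^ S k)) * Cmod ((q ^ S k) ^ J)).
      * rewrite <- (Rmult_1_r (_ * _)) at 2. apply Rmult_le_compat_l.
        -- apply Rmult_le_pos; apply Cmod_ge_0.
        -- rewrite <- Rinv_1. apply Rinv_le_contravar; [lra|].
           rewrite S_INR. pose proof (pos_INR k); lra.
      * replace (/ (1 - r) * r ^ J * r ^ k) with ((/ (1 - r) * r ^ k) * r ^ J) by ring.
        apply Rmult_le_compat; auto; apply Cmod_ge_0.
    + rewrite rsum_scal.
      replace (/ (1 - r) ^ 2 * r ^ J) with ((/ (1 - r) * r ^ J) * / (1 - r)) by (field; lra).
      apply Rmult_le_compat_l; [|apply rsum_geom_le; lra].
      apply Rmult_le_pos; [left; apply Rinv_0_lt_compat; lra|apply pow_le; auto].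
Qed.

Lemma rsum_multiples_ge (u : nat -> R) (t K i : nat) : (forall k, 0 <= u k) -> (S i < t)%nat ->
  (0 < K)%nat -> rsum (fun j => u (t * S j - 1)%nat) K + u i <= rsum u (t * K).
Proof.
  intros Hu Hi HK.
  assert (Block : forall n a, (a < n)%nat -> u a <= rsum u n).
  { intros n a. induction n as [|n IH]; [lia|]. intros Ha. simpl.
    destruct (Nat.eq_dec a n) as [->|]; [|pose proof (Hu n); assert (u a <= rsum u n) by (apply IH; lia); lra].
    assert (0 <= rsum u n) by (apply rsum_pos; auto). lra. }
  assert (Block2 : forall n, (0 < n)%nat -> forall b, u (b + (n - 1))%nat <= rsum (fun k => u (b + k)%nat) n).
  { intros n Hn b. destruct n as [|n]; [lia|]. simpl. rewrite Nat.sub_0_r.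
    assert (0 <= rsum (fun k => u (b + k)%nat) n) by (apply rsum_pos; auto). lra. }
  induction K as [|K IH]; [lia|]. destruct K as [|K].
  - simpl rsum at 1. rewrite Nat.mul_1_r. replace t with (S (t - 1)) at 2 by lia. simpl.
    pose proof (Block (t - 1)%nat i ltac:(lia)). lra.
  - assert (IH' := IH ltac:(lia)).
    change (rsum (fun j => u (t * S j - 1)%nat) (S (S K)))
      with (rsum (fun j => u (t * S j - 1)%nat) (S K) + u (t * S (S K) - 1)%nat).
    replace (t * S (S K))%nat with (t * S K + t)%nat by lia. rewrite rsum_add.
    pose proof (Block2 t ltac:(lia) (t * S K)%nat) as B2.
    replace (t * S K + (t - 1))%nat with (t * S K + t - 1)%nat in B2 by lia. lra.
Qed.

(** The difference of the two sides is monotone in [r]: its derivative compares a finite with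
    the full geometric sum. *)
Lemma rsum_log_le (r : R) K : 0 <= r < 1 -> rsum (fun k => r ^ S k / INR (S k)) K <= - ln (1 - r).
Proof.
  intros Hr.
  pose proof (decreasing_of_derive (fun s => rsum (fun k => s ^ S k / INR (S k)) K + ln (1 - s))
    (fun s => rsum (fun k => s ^ k) K - / (1 - s)) 0 r ltac:(lra)) as H.
  cbv beta in H. rewrite Rminus_0_r, ln_1 in H.
  rewrite (rsum_ext (fun k => 0 ^ S k / INR (S k)) (fun _ => 0)), rsum_const in H.
  2:{ intros k _. simpl pow. unfold Rdiv; ring. }
  enough (rsum (fun k => r ^ S k / INR (S k)) K + ln (1 - r) <= INR K * 0 + 0) by lra. apply H.
  - intros s Hs. apply (@is_derive_plus R_AbsRing R_NormedModule).
    + clear H. induction K as [|K IH]; [simpl rsum; apply (@is_derive_const R_AbsRing R_NormedModule)|].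
      change (is_derive (fun s => rsum (fun k => s ^ S k / INR (S k)) K + s ^ S K / INR (S K)) s
        (rsum (fun k => s ^ k) K + s ^ K)).
      apply (@is_derive_plus R_AbsRing R_NormedModule); [exact IH|].
      pose proof (pos_INR K). rewrite S_INR. auto_derive; [lra|].
      destruct K as [|K]; [simpl; field|]. simpl Init.Nat.pred. simpl pow. field. lra.
    + auto_derive; [lra|]. field. lra.
  - intros s Hs. pose proof (rsum_geom_le s K). lra.
Qed.

Lemma exp_lambert_le (s : R) : 0 < s -> exp (- s) / (1 - exp (- s)) <= / s.
Proof.
  intros Hs. pose proof (exp_ineq1 s ltac:(lra)) as H. rewrite exp_Ropp.
  replace (/ exp s / (1 - / exp s)) with (/ (exp s - 1)) by (field; lra).
  apply Rinv_le_contravar; lra.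
Qed.

Lemma exp_pow (x : R) n : exp x ^ n = exp (INR n * x).
Proof.
  induction n as [|n IH]; [simpl; rewrite Rmult_0_l, exp_0; reflexivity|].
  rewrite S_INR. simpl. rewrite IH, <- exp_plus. f_equal; ring.
Qed.

Lemma exp_neg_lt_1 (y : R) : 0 < y -> exp (- y) < 1.
Proof. intros. rewrite <- exp_0. apply exp_increasing; lra. Qed.

Lemma Re_lambert_le_inv (w : C) (s : R) : 0 < s -> Cmod w = exp (- s) -> Re (lambert w) <= / s.
Proof.
  intros Hs Hw. pose proof (exp_neg_lt_1 s Hs). eapply Rle_trans; [apply re_le|].
  eapply Rle_trans; [apply Cmod_lambert_le; lra|]. rewrite Hw. apply exp_lambert_le; auto.
Qed.

(** The terms [u k] are nonnegative, so among them only the multiples of [t], which match the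
    first Lambert series up to the factor [1/t], and one further term [k = i + 1 < t] need be kept.
    The parameters [d] and [g] record what is gained in the first term of the first series and in
    that further term. *)
Lemma quotient_upper_bound (t : nat) (q F : C) (y Z d g : R) (i : nat) :
  0 < y -> Cmod q = exp (- y) ->
  (forall K, rsum (fun j => / INR (S j) ^ 2) K <= Z) ->
  Re (lambert (q ^ t)) <= (1 - d) / (INR t * y) ->
  (S i < t)%nat -> g <= (Re (lambert (q ^ S i)) + Cmod q ^ S i) / INR (S i) ->
  is_quotient t q F ->
  Cmod F <= exp ((1 - / INR t) / (INR t * y) * (Z - d) - g) / (1 - exp (- y)).
Proof.
  intros Hy Hq HZ Hd Hi Hg HF.
  pose proof (exp_neg_lt_1 y Hy) as Hr1. pose proof (exp_pos (- y)) as Hr0.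
  set (r := exp (- y)) in *.
  assert (Ht : 1 < INR t) by (apply lt_1_INR; lia).
  assert (Hti : 0 < / INR t < 1).
  { split; [apply Rinv_0_lt_compat; lra|]. rewrite <- Rinv_1. apply Rinv_lt_contravar; lra. }
  set (B := (1 - / INR t) / (INR t * y) * (Z - d) - g - ln (1 - r)).
  set (LK := fun (w : C) K => csum (fun k => lambert (w ^ S k) / INR (S k))%C K).
  assert (Hlt : forall k, Cmod (q ^ S k) < 1) by (intros; apply Cmod_pow_lt_1; [lra|lia]).
  assert (REL : forall w K, Re (LK w K) = rsum (fun k => Re (lambert (w ^ S k)) / INR (S k)) K).
  { intros w K. unfold LK. rewrite Re_csum. apply rsum_ext. intros k _.
    unfold Cdiv. rewrite <- RtoC_inv by (pose proof (INR_S_pos k); lra).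
    rewrite re_scal_r. reflexivity. }
  set (u := fun k => (Re (lambert (q ^ S k)) + r ^ S k) / INR (S k)).
  assert (Hu : forall k, 0 <= u k).
  { intros k. unfold u. pose proof (Re_lambert_ge (q ^ S k) (Hlt k)) as G.
    rewrite Cmod_pow, Hq in G. apply Rmult_le_pos; [fold r in G; lra|].
    left; apply Rinv_0_lt_compat, INR_S_pos. }
  (* Truncating the two series at [K] and [t * K] keeps the multiples of [t] aligned. *)
  assert (DK : forall K, (0 < K)%nat -> Re (LK (q ^ t)%C K) - Re (LK q (t * K)%nat) <= B).
  { intros K HK. rewrite !REL.
    assert (E1 : rsum (fun k => Re (lambert (q ^ S k)) / INR (S k)) (t * K) =
      rsum u (t * K) - rsum (fun k => r ^ S k / INR (S k)) (t * K)).
    { rewrite <- rsum_minus. apply rsum_ext. intros k _. unfold u. field.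
      pose proof (INR_S_pos k); lra. }
    pose proof (rsum_multiples_ge u t K i Hu Hi HK) as E2.
    pose proof (rsum_log_le r (t * K) ltac:(lra)) as E3.
    assert (Hgi : g <= u i) by (unfold u; rewrite <- Hq; exact Hg).
    assert (E4 : rsum (fun k => Re (lambert ((q ^ t) ^ S k)) / INR (S k)) K
      - rsum (fun j => u (t * S j - 1)%nat) K <=
      rsum (fun k => (1 - / INR t) * (Re (lambert ((q ^ t) ^ S k)) / INR (S k))) K).
    { rewrite <- rsum_minus. apply rsum_le. intros k _. unfold u.
      replace (S (t * S k - 1)) with (t * S k)%nat by nia.
      rewrite <- Cpow_mult_r, mult_INR.
      pose proof (INR_S_pos k). pose proof (pow_lt r (t * S k) Hr0).
      assert (0 <= r ^ (t * S k) / (INR t * INR (S k))).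
      { apply Rmult_le_pos; [lra|]. left; apply Rinv_0_lt_compat; nra. }
      replace ((Re (lambert (q ^ (t * S k))) + r ^ (t * S k)) / (INR t * INR (S k)))
        with (/ INR t * (Re (lambert (q ^ (t * S k))) / INR (S k)) + r ^ (t * S k) / (INR t * INR (S k)))
        by (field; lra). lra. }
    assert (E5 : rsum (fun k => Re (lambert ((q ^ t) ^ S k)) / INR (S k)) K <= (Z - d) / (INR t * y)).
    { destruct K as [|K]; [lia|].
      apply Rle_trans with (rsum (fun k => / (INR t * y) * / INR (S k) ^ 2) (S K) - d / (INR t * y)).
      2:{ rewrite rsum_scal. specialize (HZ (S K)).
          assert (0 < / (INR t * y)) by (apply Rinv_0_lt_compat; nra).
          unfold Rdiv. nra. }
      change (S K) with (1 + K)%nat. rewrite !rsum_add.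
      assert (R1 : forall h : nat -> R, rsum h 1 = h O) by (intros; simpl; ring).
      rewrite !R1.
      assert (T1 : Re (lambert ((q ^ t) ^ 1)) / INR 1 <= / (INR t * y) * / INR 1 ^ 2 - d / (INR t * y)).
      { rewrite Cpow_1_r. simpl INR. replace (Re (lambert (q ^ t)) / 1) with (Re (lambert (q ^ t))) by field.
        eapply Rle_trans; [exact Hd|]. right; field. split; lra. }
      assert (T2 : rsum (fun k => Re (lambert ((q ^ t) ^ S (1 + k))) / INR (S (1 + k))) K <=
        rsum (fun k => / (INR t * y) * / INR (S (1 + k)) ^ 2) K).
      { apply rsum_le. intros k _. pose proof (INR_S_pos (1 + k)) as Hk.
        replace (/ (INR t * y) * / INR (S (1 + k)) ^ 2) with
          (/ (INR t * INR (S (1 + k)) * y) / INR (S (1 + k))) by (field; lra).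
        apply Rmult_le_compat_r; [left; apply Rinv_0_lt_compat; auto|].
        apply Re_lambert_le_inv; [repeat apply Rmult_lt_0_compat; lra|].
        rewrite <- Cpow_mult_r, Cmod_pow, Hq. unfold r. rewrite exp_pow, mult_INR. f_equal; ring. }
      lra. }
    rewrite rsum_scal in E4.
    assert (E6 : (1 - / INR t) * rsum (fun k => Re (lambert ((q ^ t) ^ S k)) / INR (S k)) K
       <= (1 - / INR t) * ((Z - d) / (INR t * y))).
    { apply Rmult_le_compat_l; lra. }
    unfold B. replace ((1 - / INR t) / (INR t * y) * (Z - d)) with
      ((1 - / INR t) * ((Z - d) / (INR t * y))) by (unfold Rdiv; ring). lra. }
  assert (ER : forall J, Re (log_quotient t q J) <= B + 2 * / (1 - r) ^ 2 * r ^ J).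
  { intros J.
    apply (is_lim_seq_le (fun _ => Re (log_quotient t q J))
      (fun K => (B + 2 * / (1 - r) ^ 2 * r ^ J) + 2 * INR (t * J) / (1 - r) * r ^ (S K))
      (Re (log_quotient t q J)) (B + 2 * / (1 - r) ^ 2 * r ^ J)).
    2:{ apply is_lim_seq_const. }
    2:{ apply lim_const_plus, lim0_scal. apply -> (is_lim_seq_incr_1 (fun n => r ^ n)).
        apply is_lim_seq_geom. rewrite Rabs_pos_eq; lra. }
    (* The bound [B] is reached by letting [K] and then [J] tend to infinity. *)
    intros K'. set (K := S K').
    assert (Hqt : Cmod (q ^ t) < 1) by (apply Cmod_pow_lt_1; [lra|lia]).
    assert (Hqt2 : Cmod (q ^ t) <= r).
    { rewrite Cmod_pow, Hq. fold r. replace t with (S (t - 1)) by lia. simpl.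
      pose proof (pow_le_1 r (t - 1) ltac:(lra)). nra. }
    pose proof (log_sum_lambert q (t * J) (t * K) ltac:(lra)) as G1.
    pose proof (log_sum_lambert (q ^ t)%C J K Hqt) as G2.
    fold (LK q (t * K)%nat) in G1. fold (LK (q ^ t)%C K) in G2.
    rewrite log_quotient_eq in G1 by lia. rewrite Hq in G1. fold r in G1.
    set (X := csum (fun k => Clog (1 - (q ^ t) ^ S k)) J) in *.
    pose proof (DK K ltac:(unfold K; lia)) as G3.
    pose proof (re_le (log_quotient t q J + X + LK q (t * K)%nat)) as G4.
    pose proof (re_le (- (X + LK (q ^ t)%C K))) as G5. rewrite Cmod_opp in G5.
    rewrite !re_plus in G4. rewrite re_opp, re_plus in G5.
    assert (P0 : forall n, 0 <= r ^ n) by (intros; apply pow_le; lra).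
    assert (PM : forall n n', (n <= n')%nat -> r ^ n' <= r ^ n).
    { intros n n' Hn. replace n' with (n + (n' - n))%nat by lia. rewrite pow_add.
      pose proof (pow_le_1 r (n' - n) ltac:(lra)). pose proof (P0 n). nra. }
    assert (I1 : 0 < / (1 - r)) by (apply Rinv_0_lt_compat; lra).
    assert (I2 : 0 < / (1 - r) ^ 2) by (apply Rinv_0_lt_compat, pow_lt; lra).
    assert (G1' : INR (t * J) / (1 - r) * r ^ (t * K) + / (1 - r) ^ 2 * r ^ (t * J)
      <= INR (t * J) / (1 - r) * r ^ K + / (1 - r) ^ 2 * r ^ J).
    { apply Rplus_le_compat; apply Rmult_le_compat_l; try (apply PM; nia); try lra.
      apply Rmult_le_pos; [apply pos_INR|lra]. }
    assert (G2' : INR J / (1 - Cmod (q ^ t)) * Cmod (q ^ t) ^ K + / (1 - Cmod (q ^ t)) ^ 2 * Cmod (q ^ t) ^ J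
      <= INR (t * J) / (1 - r) * r ^ K + / (1 - r) ^ 2 * r ^ J).
    { pose proof (Cmod_ge_0 (q ^ t)).
      assert (J1 : / (1 - Cmod (q ^ t)) <= / (1 - r)) by (apply Rinv_le_contravar; lra).
      assert (J0 : 0 < / (1 - Cmod (q ^ t))) by (apply Rinv_0_lt_compat; lra).
      apply Rplus_le_compat.
      - apply Rmult_le_compat.
        + apply Rmult_le_pos; [apply pos_INR|lra].
        + apply pow_le; auto.
        + apply Rmult_le_compat; [apply pos_INR|lra| |auto]. apply le_INR. nia.
        + apply pow_incr; lra.
      - apply Rmult_le_compat.
        + left; apply Rinv_0_lt_compat, pow_lt; lra.
        + apply pow_le; auto.
        + apply Rinv_le_contravar; [apply pow_lt; lra|]. apply pow_incr; lra.
        + apply pow_incr; lra. }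
    unfold Rdiv in *. lra. }
  assert (ELIM : is_lim_seq (fun J => exp (B + 2 * / (1 - r) ^ 2 * r ^ J)) (exp B)).
  { apply is_lim_seq_continuous; [apply derivable_continuous_pt, derivable_pt_exp|].
    apply lim_const_plus.
    apply lim0_scal. apply is_lim_seq_geom. rewrite Rabs_pos_eq; lra. }
  replace (exp ((1 - / INR t) / (INR t * y) * (Z - d) - g) / (1 - r)) with (exp B).
  2:{ unfold B. set (e := (1 - / INR t) / (INR t * y) * (Z - d) - g).
      replace (e - ln (1 - r)) with (e + - ln (1 - r)) by ring.
      rewrite exp_plus, exp_Ropp, exp_ln by lra. reflexivity. }
  apply (is_lim_seq_le _ _ (Cmod F) (exp B)) with (2 := Clim_Cmod _ _ HF) (3 := ELIM).
  intros J. rewrite Cmod_Cexp. apply exp_le, ER.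
Qed.

(** * Euler-Maclaurin summation near a primitive root of unity *)

(** Both sides agree to first order in the Taylor expansion of [g] at [a]: the quadratic
    parts are [1/2] and [rho + (1/2 - rho)] times [g1 a]. The antiderivative [h] of [g] is only
    known through an approximation [p] of its derivative. *)
Lemma euler_maclaurin_step (h p g g1 g2 : R -> C) (a M eta rho : R) :
  0 <= rho <= 1 ->
  (forall s, a <= s <= a + 1 -> cderive h s (p s)) ->
  (forall s, a <= s <= a + 1 -> Cmod (p s - g s) <= eta) ->
  (forall s, a <= s <= a + 1 -> cderive g s (g1 s)) ->
  (forall s, a <= s <= a + 1 -> cderive g1 s (g2 s)) ->
  (forall s, a <= s <= a + 1 -> Cmod (g2 s) <= M) ->
  Cmod (h (a + 1)%R - h a - g (a + rho)%R - RtoC (1 / 2 - rho) * (g (a + 1)%R - g a)) <= eta + 3 * M.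
Proof.
  intros Hrho Hh Hp Hg Hg1 HM.
  assert (HM0 : 0 <= M).
  { pose proof (Cmod_ge_0 (g2 a)). pose proof (HM a ltac:(lra)). lra. }
  set (D := g1 a).
  assert (T1 : forall s, a <= s <= a + 1 -> Cmod (g1 s - D) <= M).
  { intros s Hs. eapply Rle_trans; [apply (mean_value_const g1 g2 M a s)|].
    - lra.
    - intros; apply Hg1; lra.
    - intros; apply HM; lra.
    - nra. }
  (* The second-order remainder, bounded by [M] since the step has length 1. *)
  assert (T2 : forall s, a <= s <= a + 1 -> Cmod (g s - g a - RtoC (s - a) * D) <= M).
  { intros s Hs.
    replace (g s - g a - RtoC (s - a) * D)%C with ((g s - D * s) - (g a - D * a))%C
      by (rewrite RtoC_minus; ring).
    eapply Rle_trans; [apply (mean_value_const (fun s => g s - D * s)%C (fun s => g1 s - D * 1)%C M a s)|].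
    - lra.
    - intros x Hx. apply cderive_minus; [apply Hg; lra|apply cderive_scal, cderive_id].
    - intros x Hx. rewrite Cmult_1_r. apply T1; lra.
    - nra. }
  assert (T3 : Cmod (h (a + 1)%R - h a - g a - D / 2) <= eta + M).
  { pose proof (mean_value_const
      (fun s => h s - (g a * s + D * RtoC ((s - a) * (s - a) / 2)))%C
      (fun s => p s - (g a * 1 + D * RtoC (s - a)))%C (eta + M) a (a + 1) ltac:(lra)) as K.
    replace ((eta + M) * (a + 1 - a)) with (eta + M) in K by ring.
    match type of K with _ -> _ -> Cmod ?e <= _ => replace e with (h (a + 1)%R - h a - g a - D / 2)%C in K end.
    - apply K.
      + intros s Hs. apply cderive_minus; [apply Hh; auto|].
        apply cderive_plus; [apply cderive_scal, cderive_id|].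
        apply cderive_scal. apply (cderive_RtoC (fun s => (s - a) * (s - a) / 2)).
        auto_derive; auto; field.
      + intros s Hs. pose proof (T2 s Hs) as G1. pose proof (Hp s Hs) as G2.
        replace (p s - (g a * 1 + D * RtoC (s - a)))%C with
          ((p s - g s) + (g s - g a - RtoC (s - a) * D))%C by ring.
        eapply Rle_trans; [apply Cmod_triangle|lra].
    - replace ((a + 1 - a) * (a + 1 - a) / 2) with (/ 2) by field.
      replace ((a - a) * (a - a) / 2) with 0 by field.
      rewrite RtoC_plus, RtoC_inv by lra. field. }
  pose proof (T2 (a + rho) ltac:(lra)) as G1. pose proof (T2 (a + 1) ltac:(lra)) as G2.
  replace (a + rho - a) with rho in G1 by ring. replace (a + 1 - a) with 1 in G2 by ring.
  replace (h (a + 1)%R - h a - g (a + rho)%R - RtoC (1 / 2 - rho) * (g (a + 1)%R - g a))%C with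
    ((h (a + 1)%R - h a - g a - D / 2) + (- (g (a + rho)%R - g a - rho * D) +
     - (RtoC (1 / 2 - rho) * (g (a + 1)%R - g a - RtoC 1 * D))))%C.
  2:{ rewrite RtoC_minus, RtoC_div by lra. field. }
  eapply Rle_trans; [apply Cmod_triangle|].
  eapply Rle_trans; [apply Rplus_le_compat_l, Cmod_triangle|].
  rewrite !Cmod_opp, Cmod_mult, Cmod_R.
  assert (Rabs (1 / 2 - rho) <= 1) by (apply Rabs_le; lra).
  pose proof (Cmod_ge_0 (g (a + 1)%R - g a - RtoC 1 * D)).
  nra.
Qed.

Lemma Re_lt_1 (z : C) : Cmod z <= 1 -> z <> 1%C -> Re z < 1.
Proof.
  intros H1 H2. apply Rnot_le_lt; intros H. apply H2.
  pose proof (Cmod_sqr z) as E. pose proof (Cmod_ge_0 z).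
  apply C_eq; simpl; nra.
Qed.

(** The points [zeta e^(-w) s] stay away from 1: either their modulus is at most [1 - D/10],
    or both [1 - s] and [w] are small and they are close to [zeta], at distance [D] from 1. *)
Lemma cone_lower_bound (zeta : C) : Cmod zeta = 1 -> zeta <> 1%C ->
  exists c, 0 < c <= 1 /\ forall w s, Rabs (Im w) <= Re w -> 0 <= s <= 1 ->
    c <= Cmod (1 - zeta * Cexp (- w) * RtoC s).
Proof.
  intros H1 H2. set (D := Cmod (1 - zeta)).
  assert (HD : 0 < D).
  { apply Cmod_gt_0. intros E. apply H2.
    replace zeta with (1 - (1 - zeta))%C by ring. rewrite E. ring. }
  assert (HD2 : D <= 2).
  { unfold D. eapply Rle_trans; [apply Cmod_triangle_minus|]. rewrite Cmod_1; lra. }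
  exists (D / 10). split; [lra|]. intros w s Hw Hs.
  assert (Ha : 0 <= Re w) by (pose proof (Rabs_pos (Im w)); lra).
  set (a := Re w) in *.
  assert (Hm : Cmod (zeta * Cexp (- w) * RtoC s) = exp (- a) * s).
  { rewrite !Cmod_mult, H1, Cmod_Cexp, re_opp, Cmod_R, Rabs_pos_eq by lra. fold a. ring. }
  assert (Hexp : exp (- a) <= 1) by (rewrite <- exp_0; apply exp_le; lra).
  destruct (Rle_dec (exp (- a) * s) (1 - D / 10)) as [H|H].
  - pose proof (Cmod_1_minus_ge (zeta * Cexp (- w) * RtoC s)) as K. rewrite Hm in K. lra.
  - apply Rnot_le_lt in H.
    assert (Ha1 : a <= D / 5).
    { pose proof (exp_ineq1_le a) as G.
      pose proof (exp_mult_opp a).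
      nra. }
    assert (B1 : Cmod (Cexp (- w) - 1) <= 2 * a).
    { eapply Rle_trans; [apply Cexp_minus_1_nonpos; rewrite re_opp; fold a; lra|].
      rewrite Cmod_opp. eapply Rle_trans; [apply Cmod_le_abs|].
      fold a. rewrite (Rabs_pos_eq a) by lra. lra. }
    replace (1 - zeta * Cexp (- w) * RtoC s)%C with
      ((1 - zeta) - (zeta * (Cexp (- w) * RtoC (s - 1)) + zeta * (Cexp (- w) - 1)))%C
      by (rewrite RtoC_minus; ring).
    eapply Rle_trans; [|apply Cmod_triangle_inv]. fold D.
    assert (Cmod (zeta * (Cexp (- w) * RtoC (s - 1)) + zeta * (Cexp (- w) - 1)) <= D / 10 + 2 * a); [|lra].
    eapply Rle_trans; [apply Cmod_triangle|]. rewrite !Cmod_mult, H1, Cmod_Cexp, Cmod_R, re_opp.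
    fold a. rewrite Rabs_left1 by lra. nra.
Qed.

Lemma rsum_inv_sqr_le K : rsum (fun k => / INR (S k) ^ 2) K <= 2.
Proof.
  destruct K as [|K]; [simpl; lra|].
  assert (H : rsum (fun k => / INR (S k) ^ 2) (S K) <= 2 - / INR (S K)).
  { induction K as [|K IH]; [simpl; lra|].
    change (rsum (fun k => / INR (S k) ^ 2) (S (S K))) with
      (rsum (fun k => / INR (S k) ^ 2) (S K) + / INR (S (S K)) ^ 2).
    pose proof (INR_S_pos K) as HK. rewrite (S_INR (S K)).
    set (n := INR (S K)) in *.
    assert (G : / n - / (n + 1) - / (n + 1) ^ 2 = / (n * (n + 1) ^ 2)) by (field; lra).
    assert (0 < / (n * (n + 1) ^ 2)) by (apply Rinv_0_lt_compat; nra). lra. }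
  pose proof (Rinv_0_lt_compat _ (INR_S_pos K)). lra.
Qed.

Lemma uniform_const (P : nat -> R -> Prop) (n : nat) :
  (forall r C C', C <= C' -> P r C -> P r C') ->
  (forall r, (r < n)%nat -> exists C, P r C) ->
  exists C, 0 < C /\ forall r, (r < n)%nat -> P r C.
Proof.
  intros Hm. induction n as [|n IH]; intros H.
  - exists 1. split; [lra|intros; lia].
  - destruct IH as [C1 [HC1 H1]]; [intros; apply H; lia|].
    destruct (H n ltac:(lia)) as [C2 H2].
    exists (Rmax C1 C2). split; [pose proof (Rmax_l C1 C2); lra|].
    intros r Hr. destruct (Nat.eq_dec r n) as [->|].
    + apply (Hm _ C2); [apply Rmax_r|auto].
    + apply (Hm _ C1); [apply Rmax_l|apply H1; lia].
Qed.

(** Multiplied by [X], the summand is a function [g] of the real variable [s = j + rho] whose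
    antiderivative is the dilogarithm of [zeta e^(- s X)]. The truncated dilogarithm [h] is used,
    which avoids differentiating an infinite series; [g2] has size [|X|^3] and decays
    like [e^(- s Re X)], so that the errors of the steps add up to [O(|X|^2)]. *)
Lemma euler_maclaurin_log (zeta : C) : Cmod zeta = 1 -> zeta <> 1%C ->
  exists C0, forall (X : C) (rho : R) (J K : nat),
    0 < Re X <= 1 -> Rabs (Im X) <= Re X -> 0 <= rho <= 1 ->
    Cmod (X * csum (fun j => Clog (1 - zeta * Cexp (- (X * (INR j + rho)%R))))%C J
          + csum (fun k => zeta ^ S k / INR (S k) ^ 2)%C K
          - RtoC (1 / 2 - rho) * (X * Clog (1 - zeta)))
    <= C0 * (Cmod X * Cmod X + exp (- (INR J * Re X)) + INR J * Cmod X / INR (S K)).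
Proof.
  intros H1 H2. destruct (cone_lower_bound zeta H1 H2) as [c [Hc Hlow]].
  exists (24 / c ^ 2 + 2 + 2 / c). intros X rho J K HX HI Hrho.
  set (al := Re X) in *.
  assert (HXpos : 0 < Cmod X) by (pose proof (re_le X); unfold al in *; lra).
  assert (HX2 : Cmod X <= 2 * al).
  { eapply Rle_trans; [apply Cmod_le_abs|]. fold al. rewrite (Rabs_pos_eq al) by lra. lra. }
  set (z := fun s : R => (zeta * Cexp (- (X * s)))%C).
  assert (Hzlow : forall s x, 0 <= s -> 0 <= x <= 1 -> c <= Cmod (1 - z s * RtoC x)).
  { intros s x Hs Hx. apply Hlow; auto. rewrite re_scal_r, im_scal_r, Rabs_mult, (Rabs_pos_eq s) by lra.
    fold al. nra. }
  assert (Hzlow1 : forall s, 0 <= s -> c <= Cmod (1 - z s)).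
  { intros s Hs. pose proof (Hzlow s 1 Hs ltac:(lra)) as G. rewrite Cmult_1_r in G. exact G. }
  assert (Hznz : forall s, 0 <= s -> (1 - z s)%C <> 0%C).
  { intros s Hs. apply Cmod_gt_0. pose proof (Hzlow1 s Hs); lra. }
  assert (Hzm : forall s, Cmod (z s) = exp (- (s * al))).
  { intros s. unfold z. rewrite Cmod_mult, H1, Cmod_Cexp, re_opp, re_scal_r. fold al.
    rewrite Rmult_1_l. f_equal; ring. }
  assert (Hzm1 : forall s, 0 <= s -> Cmod (z s) <= 1).
  { intros s Hs. rewrite Hzm, <- exp_0. apply exp_le. nra. }
  assert (HzRe : forall s, 0 <= s -> Re (z s) < 1).
  { intros s Hs. apply Re_lt_1; auto. intros E. apply (Hznz s Hs). rewrite E; ring. }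
  assert (Hzd : forall s, cderive z s (- X * z s)%C).
  { intros s. eapply cderive_eq; [apply cderive_scal, (cderive_Cexp (fun s => - (X * s))%C),
      cderive_opp, cderive_scal, cderive_id|]. unfold z; ring. }
  set (h := fun s => csum (fun k => z s ^ S k / INR (S k) ^ 2)%C K).
  set (p := fun s => csum (fun k => - X * (z s ^ S k / INR (S k)))%C K).
  set (g := fun s => (X * Clog (1 - z s))%C).
  set (g1 := fun s => (X * (X * z s / (1 - z s)))%C).
  set (g2 := fun s => (X * (X * (- X * z s) / ((1 - z s) * (1 - z s))))%C).
  assert (Hh : forall s, cderive h s (p s)).
  { intros s. unfold h, p. apply (cderive_csum (fun k s => z s ^ S k / INR (S k) ^ 2)%C
      (fun k => - X * (z s ^ S k / INR (S k)))%C). intros k _.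
    eapply cderive_eq.
    - unfold Cdiv. apply cderive_mult; [apply cderive_pow, Hzd|apply cderive_const].
    - cbv beta. rewrite (Cpow_S _ k). simpl. field. apply RtoC_INR_S_nz. }
  set (eta := Cmod X / (c * INR (S K))).
  assert (Hp : forall s, 0 <= s -> Cmod (p s - g s) <= eta).
  { intros s Hs. unfold p, g. rewrite csum_scal.
    replace (- X * csum (fun k => z s ^ S k / INR (S k))%C K - X * Clog (1 - z s))%C
      with (- (X * (Clog (1 - z s) + csum (fun k => z s ^ S k / INR (S k))%C K)))%C by ring.
    rewrite Cmod_opp, Cmod_mult. unfold eta, Rdiv. apply Rmult_le_compat_l; [lra|].
    eapply Rle_trans; [apply (Clog_series_remainder (z s) c K); auto; lra|].
    rewrite <- (Rmult_1_l (/ (c * INR (S K)))). apply Rmult_le_compat_r.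
    - left; apply Rinv_0_lt_compat. pose proof (INR_S_pos K); nra.
    - apply pow_le_1. split; [apply Cmod_ge_0|auto]. }
  assert (Hg : forall s, 0 <= s -> cderive g s (g1 s)).
  { intros s Hs. unfold g, g1. eapply cderive_eq.
    - apply cderive_scal, (cderive_Clog (fun s => 1 - z s)%C).
      + apply cderive_minus; [apply cderive_const|apply Hzd].
      + rewrite re_minus, re_RtoC. pose proof (HzRe s Hs); lra.
    - cbv beta. field. auto. }
  assert (Hg1 : forall s, 0 <= s -> cderive g1 s (g2 s)).
  { intros s Hs. unfold g1, g2. eapply cderive_eq.
    - apply cderive_scal, cderive_div; [apply cderive_scal, Hzd| |auto].
      apply cderive_minus; [apply cderive_const|apply Hzd].
    - cbv beta. field. auto. }
  set (M := fun j : nat => Cmod X ^ 3 / c ^ 2 * exp (- al) ^ j).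
  assert (Hg2 : forall (j : nat) s, INR j <= s -> Cmod (g2 s) <= M j).
  { intros j s Hs. pose proof (pos_INR j) as Hj. unfold g2.
    rewrite Cmod_mult, Cmod_div, !Cmod_mult, Cmod_opp by (apply Cmult_neq_0; apply Hznz; lra).
    unfold M. rewrite exp_pow.
    replace (Cmod X * (Cmod X * (Cmod X * Cmod (z s)) / (Cmod (1 - z s) * Cmod (1 - z s))))
      with (Cmod X ^ 3 * (/ (Cmod (1 - z s) * Cmod (1 - z s)) * Cmod (z s))).
    2:{ field. pose proof (Hzlow1 s ltac:(lra)); lra. }
    unfold Rdiv. rewrite Rmult_assoc. apply Rmult_le_compat_l; [apply pow_le; lra|].
    pose proof (Hzlow1 s ltac:(lra)).
    apply Rmult_le_compat.
    - left; apply Rinv_0_lt_compat; nra.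
    - apply Cmod_ge_0.
    - apply Rinv_le_contravar; [apply pow_lt; lra|]. nra.
    - rewrite Hzm. apply exp_le. nra. }
  assert (Hsteps : forall n, Cmod (h (INR n) - h 0 - csum (fun j => g (INR j + rho)%R) n
      - RtoC (1 / 2 - rho) * (g (INR n) - g 0)) <= INR n * eta + 3 * rsum M n).
  { induction n as [|n IH].
    - simpl INR. simpl csum. simpl rsum.
      replace (h 0 - h 0 - 0 - RtoC (1 / 2 - rho) * (g 0 - g 0))%C with (RtoC 0) by ring.
      rewrite Cmod_0; lra.
    - pose proof (pos_INR n) as Hn.
      pose proof (euler_maclaurin_step h p g g1 g2 (INR n) (M n) eta rho Hrho) as St.
      rewrite S_INR. rewrite csum_S. change (rsum M (S n)) with (rsum M n + M n).
      replace (h (INR n + 1)%R - h 0 - (csum (fun j => g (INR j + rho)%R) n + g (INR n + rho)%R) -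
        RtoC (1 / 2 - rho) * (g (INR n + 1)%R - g 0))%C with
        ((h (INR n) - h 0 - csum (fun j => g (INR j + rho)%R) n - RtoC (1 / 2 - rho) * (g (INR n) - g 0))
        + (h (INR n + 1)%R - h (INR n) - g (INR n + rho)%R - RtoC (1 / 2 - rho) * (g (INR n + 1)%R - g (INR n))))%C by ring.
      eapply Rle_trans; [apply Cmod_triangle|].
      assert (Cmod (h (INR n + 1)%R - h (INR n) - g (INR n + rho)%R - RtoC (1 / 2 - rho) * (g (INR n + 1)%R - g (INR n))) <= eta + 3 * M n); [|lra].
      apply St; intros s Hs; [apply Hh|apply Hp; lra|apply Hg; lra|apply Hg1; lra|apply Hg2; lra]. }
  assert (Hex : exp (- al) <= 1 - al / 2).
  { apply exp_neg_le_half; lra. }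
  pose proof (exp_pos (- al)) as Hex0.
  assert (HM : rsum M J <= 8 / c ^ 2 * (Cmod X * Cmod X)).
  { unfold M. rewrite rsum_scal.
    assert (G : rsum (fun j => exp (- al) ^ j) J <= 2 / al).
    { eapply Rle_trans; [apply rsum_geom_le; lra|].
      replace (2 / al) with (/ (al / 2)) by (field; lra). apply Rinv_le_contravar; lra. }
    apply Rle_trans with (Cmod X ^ 3 / c ^ 2 * (2 / al)).
    - apply Rmult_le_compat_l; auto. apply Rmult_le_pos; [apply pow_le; lra|].
      left; apply Rinv_0_lt_compat, pow_lt; lra.
    - replace (Cmod X ^ 3 / c ^ 2 * (2 / al)) with ((Cmod X * Cmod X / c ^ 2 / al) * (2 * Cmod X)) by (field; lra).
      replace (8 / c ^ 2 * (Cmod X * Cmod X)) with ((Cmod X * Cmod X / c ^ 2 / al) * (8 * al)) by (field; lra).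
      apply Rmult_le_compat_l; [|nra].
      repeat apply Rmult_le_pos; try lra; left; apply Rinv_0_lt_compat; [apply pow_lt; lra|lra]. }
  assert (HhJ : Cmod (h (INR J)) <= 2 * exp (- (INR J * al))).
  { unfold h. eapply Rle_trans; [apply Cmod_csum|].
    apply Rle_trans with (rsum (fun k => exp (- (INR J * al)) * / INR (S k) ^ 2) K).
    - apply rsum_le. intros k _. pose proof (INR_S_pos k) as Hk.
      rewrite <- RtoC_pow, Cmod_div, Cmod_R, Rabs_pos_eq, Cmod_pow.
      2:{ apply pow_le; lra. }
      2:{ apply RtoC_nz. pose proof (pow_lt _ 2 Hk); lra. }
      unfold Rdiv. apply Rmult_le_compat_r; [left; apply Rinv_0_lt_compat, pow_lt; lra|].
      rewrite <- Hzm. simpl. pose proof (Hzm1 (INR J) (pos_INR J)) as G.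
      pose proof (Cmod_ge_0 (z (INR J))) as G0. pose proof (pow_le_1 _ k (conj G0 G)). nra.
    - rewrite rsum_scal. pose proof (rsum_inv_sqr_le K). pose proof (exp_pos (- (INR J * al))). nra. }
  assert (HgJ : Cmod (g (INR J)) <= 2 / c * exp (- (INR J * al))).
  { unfold g. rewrite Cmod_mult.
    pose proof (Clog_series_remainder (z (INR J)) c 0 ltac:(lra) (HzRe _ (pos_INR J))
      (fun x Hx => Hzlow _ x (pos_INR J) Hx)) as G.
    simpl csum in G. rewrite Cplus_0_r in G. simpl pow in G. simpl INR in G.
    rewrite !Rmult_1_r, Hzm in G.
    replace (2 / c * exp (- (INR J * al))) with (2 * (exp (- (INR J * al)) / c)) by (field; lra).
    apply Rmult_le_compat; auto; try apply Cmod_ge_0; lra. }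
  specialize (Hsteps J).
  assert (Hz0 : z 0 = zeta).
  { unfold z. replace (- (X * RtoC 0))%C with (RtoC 0) by ring. rewrite Cexp_0; ring. }
  assert (Hh0 : h 0 = csum (fun k => zeta ^ S k / INR (S k) ^ 2)%C K) by (unfold h; rewrite Hz0; reflexivity).
  assert (Hg0 : g 0 = (X * Clog (1 - zeta))%C) by (unfold g; rewrite Hz0; reflexivity).
  assert (HS : csum (fun j => g (INR j + rho)%R) J =
    (X * csum (fun j => Clog (1 - zeta * Cexp (- (X * (INR j + rho)%R)))) J)%C).
  { rewrite <- csum_scal. reflexivity. }
  rewrite <- HS, <- Hh0, <- Hg0.
  replace (csum (fun j => g (INR j + rho)%R) J + h 0 - RtoC (1 / 2 - rho) * g 0)%C with
    (- (h (INR J) - h 0 - csum (fun j => g (INR j + rho)%R) J - RtoC (1 / 2 - rho) * (g (INR J) - g 0))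
     + (h (INR J) + - (RtoC (1 / 2 - rho) * g (INR J))))%C by ring.
  eapply Rle_trans; [apply Cmod_triangle|]. eapply Rle_trans; [apply Rplus_le_compat_l, Cmod_triangle|].
  rewrite !Cmod_opp, Cmod_mult, Cmod_R.
  assert (Hr1 : Rabs (1 / 2 - rho) <= 1) by (apply Rabs_le; lra).
  assert (Hlast : Rabs (1 / 2 - rho) * Cmod (g (INR J)) <= 2 / c * exp (- (INR J * al))).
  { pose proof (Cmod_ge_0 (g (INR J))). nra. }
  set (E := exp (- (INR J * al))) in *.
  assert (HE : 0 < E) by apply exp_pos.
  assert (Heta : INR J * eta = / c * (INR J * Cmod X / INR (S K))).
  { unfold eta. field. pose proof (INR_S_pos K); lra. }
  assert (HT : 0 <= INR J * Cmod X / INR (S K)).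
  { repeat apply Rmult_le_pos; [apply pos_INR|lra|left; apply Rinv_0_lt_compat, INR_S_pos]. }
  set (T := INR J * Cmod X / INR (S K)) in *.
  assert (Hic : 0 < / c) by (apply Rinv_0_lt_compat; lra).
  assert (Hic2 : 0 < / c ^ 2) by (apply Rinv_0_lt_compat, pow_lt; lra).
  assert (HXX : 0 <= Cmod X * Cmod X) by nra.
  unfold Rdiv in *. set (XX := Cmod X * Cmod X) in *.
  assert (Q1 : 0 <= (2 + 2 * / c) * XX) by (apply Rmult_le_pos; lra).
  assert (Q2 : 0 <= (24 * / c ^ 2) * E) by (apply Rmult_le_pos; lra).
  assert (Q3 : 0 <= (24 * / c ^ 2 + 2 + / c) * T) by (apply Rmult_le_pos; lra).
  lra.
Qed.

Lemma root_pow_sum (w : C) (t : nat) : (0 < t)%nat -> w <> 1%C -> (w ^ t)%C = 1%C ->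
  csum (fun r => w ^ S r)%C (t - 1) = (- (1))%C.
Proof.
  intros Ht Hw Hwt.
  assert (Hn : (1 - w)%C <> 0%C).
  { intros E. apply Hw. replace w with (1 - (1 - w))%C by ring. rewrite E; ring. }
  pose proof (csum_geom w t Hn) as G. rewrite Hwt in G.
  replace t with (1 + (t - 1))%nat in G at 1 by lia. rewrite csum_add in G.
  simpl csum at 1 in G. change (fun k => (w ^ (1 + k))%C) with (fun r => (w ^ S r)%C) in G.
  assert (G2 : (0 + 1 + csum (fun r => w ^ S r)%C (t - 1))%C = 0%C).
  { rewrite G. field; auto. }
  transitivity ((0 + 1 + csum (fun r => w ^ S r)%C (t - 1)) - 1)%C; [ring|]. rewrite G2; ring.
Qed.

Definition inv_sqr_sum (K : nat) : R := rsum (fun k => / INR (S k) ^ 2) K.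

(** For [w = zeta^k] the sum of [w^r] over [0 < r < t] is [t - 1] if [t] divides [k] and [- 1]
    otherwise, so the dilogarithms at the nontrivial roots of unity add up to multiples of the Basel sum. *)
Lemma dilog_roots_sum (t : nat) (zeta : C) (K : nat) : (0 < t)%nat -> (zeta ^ t)%C = 1%C ->
  (forall n, (0 < n < t)%nat -> (zeta ^ n)%C <> 1%C) ->
  csum (fun r => csum (fun k => (zeta ^ S r) ^ S k / INR (S k) ^ 2)%C (t * K)) (t - 1)
  = RtoC (inv_sqr_sum K / INR t - inv_sqr_sum (t * K)).
Proof.
  intros Ht Hzt Hprim. rewrite csum_swap.
  assert (Htn : INR t <> 0) by (apply not_0_INR; lia).
  assert (Hk : forall k, csum (fun r => (zeta ^ S r) ^ S k / INR (S k) ^ 2)%C (t - 1) =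
    (csum (fun r => (zeta ^ S k) ^ S r)%C (t - 1) * RtoC (/ INR (S k) ^ 2))%C).
  { intros k. rewrite Cmult_comm, <- csum_scal. apply csum_ext. intros r _.
    rewrite <- !Cpow_mult_r, (Nat.mul_comm (S r)), RtoC_inv, RtoC_pow.
    - unfold Cdiv; ring.
    - pose proof (INR_S_pos k). apply pow_nonzero; lra. }
  assert (Hpow : forall n, (zeta ^ (t * n))%C = 1%C).
  { intros n. rewrite Cpow_mult_r, Hzt. apply Cpow_1_l. }
  rewrite (csum_ext _ _ _ (fun k _ => Hk k)).
  induction K as [|K IH].
  - rewrite Nat.mul_0_r. simpl. unfold inv_sqr_sum; simpl. apply f_equal. field; auto.
  - replace (t * S K)%nat with (t * K + t)%nat by lia. rewrite csum_add, IH.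
    set (f := fun k => (csum (fun r => (zeta ^ S (t * K + k)) ^ S r)%C (t - 1) *
      RtoC (/ INR (S (t * K + k)) ^ 2))%C).
    transitivity (RtoC (inv_sqr_sum K / INR t - inv_sqr_sum (t * K)) + csum f (S (t - 1)))%C.
    { f_equal. f_equal; lia. }
    rewrite csum_S.
    rewrite (csum_ext f (fun k => RtoC (- / INR (S (t * K + k)) ^ 2))).
    2:{ intros k Hk'. unfold f. rewrite root_pow_sum; auto.
        - rewrite RtoC_opp. ring.
        - replace (S (t * K + k)) with (t * K + S k)%nat by lia.
          rewrite Cpow_add_r, Hpow, Cmult_1_l. apply Hprim. lia.
        - rewrite <- Cpow_mult_r, Nat.mul_comm. apply Hpow. }
    assert (F : f (t - 1)%nat = RtoC ((INR t - 1) * / INR (t * S K) ^ 2)).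
    { unfold f. replace (S (t * K + (t - 1))) with (t * S K)%nat by nia.
      rewrite Hpow. rewrite (csum_ext _ (fun _ => 1%C)) by (intros; apply Cpow_1_l).
      rewrite csum_const, Cmult_1_r, <- RtoC_mult. rewrite minus_INR by lia. reflexivity. }
    rewrite F.
    assert (HR : csum (fun k => RtoC (- / INR (S (t * K + k)) ^ 2)) (t - 1) =
      RtoC (- rsum (fun k => / INR (S (t * K + k)) ^ 2) (t - 1))).
    { generalize (t - 1)%nat. intros n. induction n as [|n IHn].
      - simpl. rewrite Ropp_0; reflexivity.
      - rewrite csum_S, IHn, <- RtoC_plus. f_equal.
        rewrite rsum_S. ring. }
    rewrite HR, <- !RtoC_plus. f_equal. unfold inv_sqr_sum.
    change (rsum (fun k => / INR (S k) ^ 2) (S K)) with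
      (rsum (fun k => / INR (S k) ^ 2) K + / INR (S K) ^ 2).
    rewrite rsum_add.
    replace (rsum (fun k => / INR (S (t * K + k)) ^ 2) t) with
      (rsum (fun k => / INR (S (t * K + k)) ^ 2) (t - 1) + / INR (t * S K) ^ 2).
    2:{ transitivity (rsum (fun k => / INR (S (t * K + k)) ^ 2) (S (t - 1))); [|f_equal; lia].
        rewrite rsum_S. f_equal. replace (S (t * K + (t - 1)))%nat with (t * S K)%nat by nia. reflexivity. }
    rewrite mult_INR. pose proof (INR_S_pos K). field. lra.
Qed.

(** Add the [t - 1] sums of [euler_maclaurin_log] with [X = t x] and [rho = r/t], let the
    truncation of the dilogarithm tend to infinity, and then the number of factors. *)
Lemma quotient_near_root (t : nat) (zeta : C) (Z : R) :
  (1 < t)%nat -> Cmod zeta = 1 -> (zeta ^ t)%C = 1%C ->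
  (forall n, (0 < n < t)%nat -> (zeta ^ n)%C <> 1%C) ->
  is_lim_seq inv_sqr_sum Z ->
  exists C1, 0 < C1 /\ forall (x F : C),
    0 < INR t * Re x <= 1 -> Rabs (Im x) <= Re x ->
    is_quotient t (zeta * Cexp (- x)) F ->
    Cmod (F * Cexp (- (RtoC ((1 - / INR t) * Z / INR t) / x +
      csum (fun r => RtoC (1 / 2 - INR (S r) / INR t) * Clog (1 - zeta ^ S r))%C (t - 1))) - 1)
    <= C1 * Cmod x.
Proof.
  intros Ht H1 Hzt Hprim HZ.
  assert (HtR : 1 < INR t) by (apply lt_1_INR; lia).
  assert (Htn : RtoC (INR t) <> 0%C) by (apply RtoC_nz; lra).
  destruct (uniform_const (fun r C0 => forall (X : C) (rho : R) (J K : nat),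
    0 < Re X <= 1 -> Rabs (Im X) <= Re X -> 0 <= rho <= 1 ->
    Cmod (X * csum (fun j => Clog (1 - zeta ^ S r * Cexp (- (X * (INR j + rho)%R))))%C J
          + csum (fun k => (zeta ^ S r) ^ S k / INR (S k) ^ 2)%C K
          - RtoC (1 / 2 - rho) * (X * Clog (1 - zeta ^ S r)))
    <= C0 * (Cmod X * Cmod X + exp (- (INR J * Re X)) + INR J * Cmod X / INR (S K))) (t - 1))
    as [C0 [HC0 HEM]].
  { intros r C C' HC H X rho J K HX HI Hr. eapply Rle_trans; [apply H; auto|].
    apply Rmult_le_compat_r; auto.
    pose proof (exp_pos (- (INR J * Re X))). pose proof (Cmod_ge_0 X).
    assert (0 <= INR J * Cmod X / INR (S K)).
    { repeat apply Rmult_le_pos; [apply pos_INR|auto|left; apply Rinv_0_lt_compat, INR_S_pos]. }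
    nra. }
  { intros r Hr. apply (euler_maclaurin_log (zeta ^ S r)%C).
    - rewrite Cmod_pow, H1. apply pow1.
    - apply Hprim; lia. }
  set (Bc := csum (fun r => RtoC (1 / 2 - INR (S r) / INR t) * Clog (1 - zeta ^ S r))%C (t - 1)).
  set (C' := INR (t - 1) * C0).
  assert (HC' : 0 < C') by (apply Rmult_lt_0_compat; [apply lt_0_INR; lia|auto]).
  exists (C' * INR t * exp (2 * C')). split.
  { apply Rmult_lt_0_compat; [apply Rmult_lt_0_compat; [exact HC'|lra]|apply exp_pos]. }
  intros x F HX0 HI0 HF.
  set (X := (INR t * x)%C).
  assert (HX : 0 < Re X <= 1) by (unfold X; rewrite re_scal_l; auto).
  assert (HI : Rabs (Im X) <= Re X).
  { unfold X; rewrite re_scal_l, im_scal_l, Rabs_mult, (Rabs_pos_eq (INR t)) by lra. nra. }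
  assert (HXpos : 0 < Cmod X) by (pose proof (re_le X); lra).
  assert (HXnz : X <> 0%C) by (apply Cmod_gt_0; auto).
  assert (HX2 : Cmod X <= 2).
  { eapply Rle_trans; [apply Cmod_le_abs|]. rewrite (Rabs_pos_eq (Re X)) by lra. lra. }
  set (LQ := log_quotient t (zeta * Cexp (- x))).
  assert (HLQ : forall J, LQ J = csum (fun r => csum (fun j =>
    Clog (1 - zeta ^ S r * Cexp (- (X * (INR j + INR (S r) / INR t)%R))))%C J) (t - 1)).
  { intros J. unfold LQ, log_quotient. rewrite csum_swap. apply csum_ext. intros r _.
    apply csum_ext. intros j _. do 2 f_equal. f_equal.
    rewrite Cpow_mult_l, Cpow_add_r, Cpow_mult_r, Hzt, Cpow_1_l, Cmult_1_l. f_equal.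
    rewrite Cexp_pow. f_equal. unfold X.
    rewrite plus_INR, mult_INR, !RtoC_plus, RtoC_mult, RtoC_div by lra. field. auto. }
  assert (Hbd : forall J K, Cmod (X * LQ J + RtoC (inv_sqr_sum K / INR t - inv_sqr_sum (t * K)) - X * Bc)
    <= C' * (Cmod X * Cmod X + exp (- (INR J * Re X)) + INR J * Cmod X / INR (S (t * K)))).
  { intros J K. rewrite <- (dilog_roots_sum t zeta K) by (auto; lia). rewrite HLQ. unfold Bc.
    rewrite <- !csum_scal, <- csum_plus, <- csum_minus.
    eapply Rle_trans; [apply Cmod_csum|].
    unfold C'. rewrite Rmult_assoc, <- rsum_const. apply rsum_le. intros r Hr.
    eapply Rle_trans; [|apply (HEM r Hr X (INR (S r) / INR t) J (t * K)%nat HX HI)].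
    - right. f_equal. ring.
    - assert (INR (S r) <= INR t) by (apply le_INR; lia). pose proof (INR_S_pos r).
      split.
      + apply Rmult_le_pos; [lra|left; apply Rinv_0_lt_compat; lra].
      + apply (Rmult_le_reg_r (INR t)); [lra|]. unfold Rdiv. rewrite Rmult_assoc, Rinv_l; lra. }
  set (A1 := (1 - / INR t) * Z).
  assert (HlimT : is_lim_seq (fun K => inv_sqr_sum K / INR t - inv_sqr_sum (t * K)) (- A1)).
  { replace (Finite (- A1)) with (Finite (Z / INR t - Z)) by (unfold A1; f_equal; field; lra).
    apply is_lim_seq_minus'.
    - apply (is_lim_seq_scal_r _ (/ INR t) Z HZ).
    - apply (lim_subseq inv_sqr_sum Z (fun K => (t * K)%nat)); auto. intros; nia. }
  (* The dilogarithms are truncated at multiples of [t], where their sum is known exactly. *)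
  assert (Hbd2 : forall J, Cmod (X * LQ J - A1 - X * Bc) <= C' * (Cmod X * Cmod X + exp (- (INR J * Re X)))).
  { intros J.
    apply (is_lim_seq_le (fun K => Cmod (X * LQ J + RtoC (inv_sqr_sum K / INR t - inv_sqr_sum (t * K)) - X * Bc))
      (fun K => C' * (Cmod X * Cmod X + exp (- (INR J * Re X))) + C' * (INR J * Cmod X) * / INR (S (t * K)))
      (Cmod (X * LQ J - A1 - X * Bc)) (C' * (Cmod X * Cmod X + exp (- (INR J * Re X))))).
    - intros K. eapply Rle_trans; [apply Hbd|]. right; unfold Rdiv; ring.
    - apply Clim_Cmod. apply Clim_minus; [|apply Clim_const].
      apply Clim_plus; [apply Clim_const|]. rewrite <- RtoC_opp.
      apply Clim_of_components; [exact HlimT|apply is_lim_seq_const].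
    - apply lim_const_plus, lim0_scal.
      replace (Finite 0) with (Rbar_inv p_infty) by reflexivity.
      apply is_lim_seq_inv; [|discriminate].
      apply (lim_subseq INR p_infty (fun K => S (t * K))); [intros; nia|apply is_lim_seq_INR]. }
  set (T := (RtoC ((1 - / INR t) * Z / INR t) / x + Bc)%C).
  assert (Hxnz : x <> 0%C) by (intros E; apply HXnz; unfold X; rewrite E; ring).
  assert (HT : (X * T)%C = (A1 + X * Bc)%C).
  { unfold T, X, A1. rewrite RtoC_div by lra. field. auto. }
  assert (Hbd3 : forall J, Cmod (LQ J - T) <= C' * Cmod X + C' / Cmod X * exp (- (INR J * Re X))).
  { intros J. apply (Rmult_le_reg_l (Cmod X)); auto. rewrite <- Cmod_mult.
    replace (X * (LQ J - T))%C with (X * LQ J - A1 - X * Bc)%C.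
    2:{ replace (X * (LQ J - T))%C with (X * LQ J - X * T)%C by ring. rewrite HT. ring. }
    eapply Rle_trans; [apply Hbd2|]. right. field. lra. }
  set (ep := fun J => C' * Cmod X + C' / Cmod X * exp (- (INR J * Re X))).
  assert (Hep : is_lim_seq ep (C' * Cmod X)).
  { unfold ep. apply lim_const_plus, lim0_scal.
    apply is_lim_seq_ext with (fun J => exp (- Re X) ^ J).
    { intros J. rewrite exp_pow. f_equal; ring. }
    apply is_lim_seq_geom. rewrite Rabs_pos_eq by (left; apply exp_pos). apply exp_neg_lt_1; lra. }
  apply Rle_trans with (C' * Cmod X * exp (C' * Cmod X)).
  - apply (is_lim_seq_le (fun J => Cmod (Cexp (LQ J) * Cexp (- T) - 1)) (fun J => ep J * exp (ep J))
      (Cmod (F * Cexp (- T) - 1)) (C' * Cmod X * exp (C' * Cmod X))).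
    + intros J. rewrite <- Cexp_plus. eapply Rle_trans; [apply Cexp_minus_1_gen|].
      pose proof (Hbd3 J) as G. fold (ep J) in G. pose proof (Cmod_ge_0 (LQ J - T)) as G0.
      change (LQ J + - T)%C with (LQ J - T)%C.
      apply Rmult_le_compat; auto; [left; apply exp_pos|apply exp_le; auto].
    + apply Clim_Cmod, Clim_minus; [|apply Clim_const]. apply Clim_mult; [exact HF|apply Clim_const].
    + apply is_lim_seq_mult'; auto.
      apply is_lim_seq_continuous; [apply derivable_continuous_pt, derivable_pt_exp|auto].
  - unfold X at 1. rewrite Cmod_mult, Cmod_R, Rabs_pos_eq by lra.
    replace (C' * INR t * exp (2 * C') * Cmod x) with ((C' * (INR t * Cmod x)) * exp (2 * C')) by ring.
    apply Rmult_le_compat_l.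
    + apply Rmult_le_pos; [lra|]. apply Rmult_le_pos; [lra|apply Cmod_ge_0].
    + apply exp_le. nra.
Qed.

(** * Roots of unity and the Dedekind sum *)

Definition cis (x : R) : C := Cexp (Ci * x).

Lemma cis_eq x : cis x = (cos x, sin x).
Proof. apply Cexp_Ci. Qed.

Lemma cis_plus x y : cis (x + y) = (cis x * cis y)%C.
Proof. unfold cis. rewrite <- Cexp_plus, RtoC_plus. f_equal; ring. Qed.

Lemma cis_pow x n : (cis x ^ n)%C = cis (INR n * x).
Proof. unfold cis. rewrite Cexp_pow, RtoC_mult. f_equal; ring. Qed.

Lemma Cmod_cis x : Cmod (cis x) = 1.
Proof. unfold cis. rewrite Cmod_Cexp. simpl. replace (0 * x - 1 * 0) with 0 by ring. apply exp_0. Qed.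

Lemma cis_0 : cis 0 = 1%C.
Proof. unfold cis. rewrite Cmult_0_r. apply Cexp_0. Qed.

Lemma cis_opp x : cis (- x) = Cconj (cis x).
Proof. rewrite !cis_eq, cos_neg, sin_neg. reflexivity. Qed.

Lemma cis_2PI_nat k : cis (2 * PI * INR k) = 1%C.
Proof. rewrite cis_eq. replace (2 * PI * INR k) with (0 + 2 * INR k * PI) by ring.
  rewrite cos_period, sin_period, cos_0, sin_0. reflexivity. Qed.

Lemma cis_2PI_Z (k : Z) : cis (2 * PI * IZR k) = 1%C.
Proof.
  destruct (Z_le_gt_dec 0 k) as [H|H].
  - rewrite <- (Z2Nat.id k H), <- INR_IZR_INZ. apply cis_2PI_nat.
  - replace k with (- Z.of_nat (Z.to_nat (- k)))%Z by lia.
    rewrite opp_IZR, <- INR_IZR_INZ.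
    replace (2 * PI * - INR (Z.to_nat (- k))) with (- (2 * PI * INR (Z.to_nat (- k)))) by ring.
    rewrite cis_opp, cis_2PI_nat. apply C_eq; simpl; lra.
Qed.

Lemma cis_half_angle (phi : R) : (1 - cis (2 * PI * phi))%C =
  (2 * (sin (PI * phi) * sin (PI * phi)), - (2 * (sin (PI * phi) * cos (PI * phi)))).
Proof.
  rewrite cis_eq. replace (2 * PI * phi) with (2 * (PI * phi)) by ring.
  rewrite sin_2a, cos_2a_sin. apply C_eq; simpl; ring.
Qed.

Lemma sin_PI_pos (phi : R) : 0 < phi < 1 -> 0 < sin (PI * phi).
Proof. intros H. pose proof PI_RGT_0. apply sin_gt_0; nra. Qed.

Lemma cis_neq_1 (phi : R) : 0 < phi < 1 -> cis (2 * PI * phi) <> 1%C.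
Proof.
  intros H E. pose proof (sin_PI_pos phi H). pose proof (cis_half_angle phi) as K.
  rewrite E in K. apply (f_equal Re) in K. simpl in K. nra.
Qed.

(** The chord from [e^(2 pi i phi)] to 1 is perpendicular to the bisector, that is
    [1 - e^(2 pi i phi) = 2 sin (pi phi) e^(i pi (phi - 1/2))]. *)
Lemma Im_Clog_sawtooth (phi : R) : 0 < phi < 1 ->
  Im (Clog (1 - cis (2 * PI * phi))) = PI * (phi - 1 / 2).
Proof.
  intros H. pose proof (sin_PI_pos phi H) as Hs. pose proof PI_RGT_0 as HP.
  rewrite cis_half_angle. unfold Clog; simpl.
  transitivity (atan (tan (PI * (phi - 1 / 2)))); [|apply atan_tan; nra].
  f_equal. unfold tan. replace (PI * (phi - 1 / 2)) with (- (PI / 2 - PI * phi)) by field.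
  rewrite sin_neg, cos_neg, sin_shift, cos_shift. field. lra.
Qed.

Lemma Clog_conj (w : C) : 0 < Re w -> Clog (Cconj w) = Cconj (Clog w).
Proof.
  intros H. unfold Clog. apply C_eq; simpl.
  - replace (- snd w * - snd w) with (snd w * snd w) by ring. reflexivity.
  - unfold Re, Im in *; simpl. rewrite <- atan_opp. f_equal. field. lra.
Qed.

Lemma root_residue (h t n : nat) : (0 < t)%nat ->
  cis (2 * PI * (INR h * INR n / INR t)) = cis (2 * PI * (INR ((h * n) mod t) / INR t)).
Proof.
  intros Ht. assert (HtR : INR t <> 0) by (apply not_0_INR; lia).
  assert (E : INR h * INR n = INR t * INR ((h * n) / t) + INR ((h * n) mod t)).
  { rewrite <- !mult_INR, <- plus_INR. f_equal. apply Nat.div_mod_eq. }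
  rewrite E.
  replace (2 * PI * ((INR t * INR (h * n / t) + INR ((h * n) mod t)) / INR t)) with
    (2 * PI * INR (h * n / t) + 2 * PI * (INR ((h * n) mod t) / INR t)) by (field; auto).
  rewrite cis_plus, cis_2PI_nat. ring.
Qed.

Definition root (h t : nat) : C := cis (2 * PI * (INR h / INR t)).

Lemma root_pow (h t n : nat) : (root h t ^ n)%C = cis (2 * PI * (INR h * INR n / INR t)).
Proof. unfold root. rewrite cis_pow. f_equal. unfold Rdiv; ring. Qed.

Lemma root_pow_t (h t : nat) : (0 < t)%nat -> (root h t ^ t)%C = 1%C.
Proof.
  intros Ht. rewrite root_pow. rewrite <- (cis_2PI_nat h). f_equal. field.
  apply not_0_INR; lia.
Qed.

Lemma root_primitive (h t n : nat) : Nat.gcd h t = 1%nat -> (0 < n < t)%nat -> (root h t ^ n)%C <> 1%C.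
Proof.
  intros Hg Hn. rewrite root_pow, root_residue by lia. apply cis_neq_1.
  assert (HtR : 0 < INR t) by (apply lt_0_INR; lia).
  assert (Hm : ((h * n) mod t < t)%nat) by (apply Nat.mod_upper_bound; lia).
  assert (Hm0 : ((h * n) mod t <> 0)%nat).
  { intros E. apply Nat.Lcm0.mod_divide in E.
    apply Nat.gauss in E; [|rewrite Nat.gcd_comm; auto].
    apply Nat.divide_pos_le in E; lia. }
  assert (G1 : 0 < INR ((h * n) mod t)) by (apply lt_0_INR; lia).
  assert (G2 : INR ((h * n) mod t) < INR t) by (apply lt_INR; lia).
  split; [apply Rdiv_lt_0_compat; auto|].
  apply (Rmult_lt_reg_r (INR t)); auto. unfold Rdiv. rewrite Rmult_assoc, Rinv_l; lra.
Qed.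

Lemma sum_n_m_rsum (f : nat -> R) n : sum_n_m f 1 n = rsum (fun r => f (S r)) n.
Proof.
  induction n as [|n IH].
  - rewrite sum_n_m_zero by lia. reflexivity.
  - rewrite sum_n_Sm by lia. rewrite IH. reflexivity.
Qed.

(** Under [r -> t - r] the logarithm is conjugated and the weight [1/2 - r/t] changes sign. So
    the sum is purely imaginary, and the arguments add up to zero, which removes the [1/2]. *)
Lemma dedekind_constant (h t : nat) : (1 < t)%nat -> Nat.gcd h t = 1%nat ->
  csum (fun r => RtoC (1 / 2 - INR (S r) / INR t) * Clog (1 - root h t ^ S r))%C (t - 1)
  = (- PI * Ci * dedekind_sum (Z.of_nat h) t)%C.
Proof.
  intros Ht Hg. assert (HtR : 0 < INR t) by (apply lt_0_INR; lia).
  set (L := fun r => Clog (1 - root h t ^ S r)).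
  set (B := csum (fun r => RtoC (1 / 2 - INR (S r) / INR t) * L r)%C (t - 1)).
  assert (Hre : forall r, (r < t - 1)%nat -> 0 < Re (1 - root h t ^ S r)).
  { intros r Hr. rewrite re_minus, re_RtoC.
    assert (Re (root h t ^ S r) < 1); [|lra]. apply Re_lt_1.
    - rewrite Cmod_pow. unfold root. rewrite Cmod_cis, pow1. lra.
    - apply root_primitive; auto; lia. }
  assert (Hrev : forall r, (r < t - 1)%nat -> L (t - 1 - 1 - r)%nat = Cconj (L r)).
  { intros r Hr. unfold L. rewrite <- Clog_conj by auto. f_equal.
    rewrite Cminus_conj. f_equal; [apply C_eq; simpl; lra|].
    rewrite !root_pow, <- cis_opp.
    replace (S (t - 1 - 1 - r)) with (t - S r)%nat by lia. rewrite minus_INR by lia.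
    replace (2 * PI * (INR h * (INR t - INR (S r)) / INR t)) with
      (2 * PI * INR h + - (2 * PI * (INR h * INR (S r) / INR t))) by (field; lra).
    rewrite cis_plus, cis_2PI_nat. ring. }
  assert (HB : B = (- Cconj B)%C).
  { unfold B at 1. rewrite <- csum_rev.
    unfold B. rewrite Cconj_csum, <- csum_opp. apply csum_ext. intros r Hr. rewrite Hrev by auto.
    rewrite Cmult_conj.
    replace (S (t - 1 - 1 - r)) with (t - S r)%nat by lia. rewrite minus_INR by lia.
    replace (Cconj (RtoC (1 / 2 - INR (S r) / INR t))) with (RtoC (1 / 2 - INR (S r) / INR t))
      by (apply C_eq; simpl; lra).
    replace (1 / 2 - (INR t - INR (S r)) / INR t) with (- (1 / 2 - INR (S r) / INR t)) by (field; lra).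
    rewrite RtoC_opp. ring. }
  assert (HS0 : rsum (fun r => Im (L r)) (t - 1) = 0).
  { rewrite <- Im_csum. set (S0 := csum L (t - 1)).
    assert (E : S0 = Cconj S0).
    { unfold S0 at 1. rewrite <- csum_rev. unfold S0; rewrite Cconj_csum. apply csum_ext; intros; auto. }
    apply (f_equal Im) in E. rewrite im_conj in E. unfold S0 in *. lra. }
  assert (HIm : forall r, (r < t - 1)%nat -> Im (L r) =
    PI * (INR h * INR (S r) / INR t - IZR (Int_part (INR h * INR (S r) / INR t)) - 1 / 2)).
  { intros r Hr. unfold L. rewrite root_pow. set (th := INR h * INR (S r) / INR t).
    set (phi := th - IZR (Int_part th)).
    assert (E : cis (2 * PI * th) = cis (2 * PI * phi)).
    { replace (2 * PI * th) with (2 * PI * IZR (Int_part th) + 2 * PI * phi) by (unfold phi; ring).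
      rewrite cis_plus, cis_2PI_Z. ring. }
    rewrite E. rewrite Im_Clog_sawtooth; [unfold phi; ring|].
    destruct (base_Int_part th) as [G1 G2]. unfold phi.
    destruct (Rle_lt_or_eq_dec 0 (th - IZR (Int_part th)) ltac:(lra)) as [|E0]; [lra|].
    exfalso. apply (root_primitive h t (S r) Hg ltac:(lia)). rewrite root_pow. fold th. rewrite E.
    unfold phi. rewrite <- E0, Rmult_0_r. apply cis_0. }
  fold B. apply C_eq.
  - apply (f_equal Re) in HB. rewrite re_opp, re_conj in HB. transitivity (Re B); [reflexivity|]. transitivity 0; [lra|simpl; ring].
  - rewrite Im_csum.
    transitivity (- rsum (fun r => INR (S r) / INR t * Im (L r)) (t - 1)).
    + transitivity (rsum (fun r => 1 / 2 * Im (L r) - INR (S r) / INR t * Im (L r)) (t - 1)).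
      * apply rsum_ext. intros r _. rewrite im_scal_l. change (Clog (1 - root h t ^ S r)) with (L r). ring.
      * rewrite rsum_minus, rsum_scal, HS0. ring.
    + transitivity (- (PI * dedekind_sum (Z.of_nat h) t)); [|simpl; ring].
      f_equal. unfold dedekind_sum. rewrite sum_n_m_rsum, <- rsum_scal. apply rsum_ext.
      intros r Hr. rewrite HIm by auto. rewrite <- INR_IZR_INZ. ring.
Qed.

(** * The Basel sum *)

Lemma rsum_rev (f : nat -> R) n : rsum (fun k => f (n - 1 - k)%nat) n = rsum f n.
Proof.
  revert f; induction n as [|n IH]; intros f; [reflexivity|].
  transitivity (rsum (fun k => f (1 + k)%nat) n + f O).
  - rewrite <- (IH (fun k => f (1 + k)%nat)). rewrite rsum_S. f_equal; [|f_equal; lia].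
    apply rsum_ext; intros k Hk. f_equal; lia.
  - change (rsum f (S n)) with (rsum f (1 + n)). rewrite rsum_add. simpl; ring.
Qed.

Definition basel_angle (n k : nat) : R := INR (2 * k + 1) * PI / 2 ^ (n + 2).

Lemma basel_angle_bounds n k : (k < 2 ^ n)%nat -> 0 < basel_angle n k < PI / 2.
Proof.
  intros Hk. pose proof PI_RGT_0. assert (Hp : 0 < 2 ^ (n + 2)) by (apply pow_lt; lra).
  assert (H1 : 0 < INR (2 * k + 1)) by (apply lt_0_INR; lia).
  assert (H2 : INR (2 * k + 1) < 2 ^ (n + 1)).
  { replace (2 ^ (n + 1)) with (INR (2 ^ (n + 1))) by (rewrite pow_INR; reflexivity).
    apply lt_INR. rewrite Nat.pow_add_r. simpl. lia. }
  unfold basel_angle. split.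
  - apply Rdiv_lt_0_compat; nra.
  - replace (2 ^ (n + 2)) with (2 * 2 ^ (n + 1)) in * by (rewrite !pow_add; simpl; ring).
    apply (Rmult_lt_reg_r (2 * 2 ^ (n + 1))); [auto|].
    unfold Rdiv at 1. rewrite Rmult_assoc, Rinv_l by lra. nra.
Qed.

Lemma inv_sin_sqr_double x : sin x <> 0 -> cos x <> 0 ->
  / sin x ^ 2 + / cos x ^ 2 = 4 * / sin (2 * x) ^ 2.
Proof.
  intros Hs Hc. rewrite sin_2a. pose proof (sin2_cos2 x) as H. unfold Rsqr in H.
  transitivity ((sin x * sin x + cos x * cos x) / (sin x ^ 2 * cos x ^ 2)); [field; auto|].
  rewrite H. field; auto.
Qed.

(** Going from [n] to [n + 1] each angle [x] is replaced by [x/2] and [pi/2 - x/2], and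
    [4/sin^2 x = 1/sin^2 (x/2) + 1/cos^2 (x/2)]. *)
Lemma basel_identity n : rsum (fun k => / sin (basel_angle n k) ^ 2) (2 ^ n) = 2 * 4 ^ n.
Proof.
  induction n as [|n IH].
  - simpl rsum. unfold basel_angle. simpl.
    replace (1 * PI / (2 * (2 * 1))) with (PI / 4) by field.
    rewrite sin_PI4. pose proof (sqrt_sqrt 2 ltac:(lra)). pose proof (sqrt_lt_R0 2 ltac:(lra)).
    replace (1 / sqrt 2 * (1 / sqrt 2 * 1)) with (/ (sqrt 2 * sqrt 2)) by (field; lra).
    rewrite H. field.
  - replace (2 ^ S n)%nat with (2 ^ n + 2 ^ n)%nat by (simpl; lia).
    rewrite rsum_add, <- (rsum_rev (fun k => / sin (basel_angle (S n) (2 ^ n + k)) ^ 2)), <- rsum_plus.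
    replace (2 * 4 ^ S n) with (4 * (2 * 4 ^ n)) by (simpl; ring). rewrite <- IH, <- rsum_scal.
    apply rsum_ext. intros k Hk.
    assert (Hp : 2 ^ n <> 0) by (apply pow_nonzero; lra).
    pose proof (basel_angle_bounds n k Hk) as Hb.
    assert (E1 : basel_angle n k = 2 * basel_angle (S n) k).
    { unfold basel_angle. replace (S n + 2)%nat with (S (n + 2)) by lia. simpl pow. field.
      apply pow_nonzero; lra. }
    assert (E2 : basel_angle (S n) (2 ^ n + (2 ^ n - 1 - k)) = PI / 2 - basel_angle (S n) k).
    { unfold basel_angle.
      replace (INR (2 * (2 ^ n + (2 ^ n - 1 - k)) + 1)) with (4 * 2 ^ n - INR (2 * k + 1)).
      - replace (S n + 2)%nat with (n + 3)%nat by lia. rewrite pow_add. simpl (2 ^ 3). field. auto.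
      - replace (2 * (2 ^ n + (2 ^ n - 1 - k)) + 1)%nat with (4 * 2 ^ n - (2 * k + 1))%nat by lia.
        rewrite minus_INR by lia. rewrite (mult_INR 4), pow_INR. replace (INR 4) with 4 by (simpl; ring). replace (INR 2) with 2 by (simpl; ring). ring. }
    rewrite E2, sin_shift, E1.
    apply inv_sin_sqr_double; apply Rgt_not_eq; [apply sin_gt_0|apply cos_gt_0]; lra.
Qed.

Lemma x_cos_lt_sin x : 0 < x < PI / 2 -> x * cos x <= sin x.
Proof.
  intros H.
  pose proof (decreasing_of_derive (fun s => s * cos s - sin s) (fun s => - (s * sin s)) 0 x ltac:(lra)) as K.
  cbv beta in K. rewrite sin_0 in K.
  assert (x * cos x - sin x <= 0 * cos 0 - 0); [|lra]. apply K.
  - intros s Hs. auto_derive; auto. ring.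
  - intros s Hs. assert (0 <= sin s) by (apply sin_ge_0; lra). nra.
Qed.

(** Compare [1/x^2] with [1/sin^2 x] and [1/tan^2 x = 1/sin^2 x - 1] in [basel_identity]. *)
Lemma basel_odd_bounds n :
  let O := rsum (fun k => / INR (2 * k + 1) ^ 2) (2 ^ n) in
  PI ^ 2 / 8 - PI ^ 2 / 16 * (/ 2) ^ n <= O <= PI ^ 2 / 8.
Proof.
  intros O. pose proof PI_RGT_0 as HP.
  set (c := 4 ^ n * 16 / PI ^ 2).
  assert (H4 : 0 < 4 ^ n) by (apply pow_lt; lra).
  assert (HPP : 0 < PI ^ 2) by (apply pow_lt; lra).
  assert (E4 : 4 ^ n = 2 ^ n * 2 ^ n) by (rewrite <- Rpow_mult_distr; f_equal; ring).
  assert (H2n : 0 < 2 ^ n) by (apply pow_lt; lra).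
  assert (Hx : forall k, / basel_angle n k ^ 2 = c * / INR (2 * k + 1) ^ 2).
  { intros k. unfold basel_angle, c. rewrite pow_add, E4. simpl (2 ^ 2).
    assert (INR (2 * k + 1) <> 0) by (apply not_0_INR; lia). field. lra. }
  assert (HO : rsum (fun k => / basel_angle n k ^ 2) (2 ^ n) = c * O).
  { unfold O. rewrite <- rsum_scal. apply rsum_ext; intros; apply Hx. }
  assert (U : c * O <= 2 * 4 ^ n).
  { rewrite <- HO, <- basel_identity. apply rsum_le. intros k Hk.
    pose proof (basel_angle_bounds n k Hk) as Hb. apply Rinv_le_contravar.
    - apply pow_lt, sin_gt_0; lra.
    - apply pow_incr. split; [apply sin_ge_0; lra|]. left; apply sin_lt_x; lra. }
  assert (L : 2 * 4 ^ n - 2 ^ n <= c * O).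
  { rewrite <- HO, <- basel_identity.
    replace (2 ^ n) with (rsum (fun _ => 1) (2 ^ n)) by (rewrite rsum_const, pow_INR; replace (INR 2) with 2 by (simpl; ring); ring).
    rewrite <- rsum_minus. apply rsum_le. intros k Hk.
    pose proof (basel_angle_bounds n k Hk) as Hb. set (x := basel_angle n k) in *.
    assert (Hs : 0 < sin x) by (apply sin_gt_0; lra).
    assert (Hc : 0 < cos x) by (apply cos_gt_0; lra).
    pose proof (x_cos_lt_sin x Hb) as T. pose proof (sin2_cos2 x) as G. unfold Rsqr in G.
    replace (/ sin x ^ 2 - 1) with (cos x ^ 2 / sin x ^ 2).
    2:{ replace (cos x ^ 2) with (1 - sin x ^ 2) by (simpl; lra). field. lra. }
    apply (Rmult_le_reg_r (sin x ^ 2)); [apply pow_lt; auto|].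
    unfold Rdiv. rewrite Rmult_assoc, Rinv_l by (apply pow_nonzero; lra).
    apply (Rmult_le_reg_l (x ^ 2)); [apply pow_lt; lra|].
    replace (x ^ 2 * (/ x ^ 2 * sin x ^ 2)) with (sin x ^ 2) by (field; lra).
    rewrite Rmult_1_r, <- Rpow_mult_distr.
    apply pow_incr. split; [nra|auto]. }
  assert (Hi : (/ 2) ^ n * 2 ^ n = 1) by (rewrite <- Rpow_mult_distr, Rinv_l, pow1; lra).
  assert (Hc : 0 < c).
  { unfold c. apply Rdiv_lt_0_compat; lra. }
  assert (Ec1 : c * (PI ^ 2 / 8) = 2 * 4 ^ n) by (unfold c; field; lra).
  assert (Ec2 : c * (PI ^ 2 / 16 * (/ 2) ^ n) = 2 ^ n).
  { unfold c. rewrite E4.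
    replace (2 ^ n * 2 ^ n * 16 / PI ^ 2 * (PI ^ 2 / 16 * (/ 2) ^ n)) with
      (2 ^ n * ((/ 2) ^ n * 2 ^ n)) by (field; lra). rewrite Hi; ring. }
  split; apply (Rmult_le_reg_l c); auto; lra.
Qed.

Lemma basel : is_lim_seq inv_sqr_sum (PI ^ 2 / 6).
Proof.
  assert (Hmono : forall n, inv_sqr_sum n <= inv_sqr_sum (S n)).
  { intros n. unfold inv_sqr_sum. rewrite rsum_S.
    pose proof (Rinv_0_lt_compat _ (pow_lt _ 2 (INR_S_pos n))). lra. }
  destruct (ex_finite_lim_seq_incr inv_sqr_sum 2 Hmono) as [Z HZ].
  { intros n. apply rsum_inv_sqr_le. }
  assert (Hsub : forall phi : nat -> nat, (forall n, (n <= phi n)%nat) ->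
     is_lim_seq (fun n => inv_sqr_sum (phi n)) Z).
  { intros phi Hphi. apply lim_subseq; auto. }
  assert (Hpow : forall n, (n <= 2 ^ n)%nat).
  { intros n. apply Nat.lt_le_incl, Nat.pow_gt_lin_r; lia. }
  assert (Hodd : forall K, rsum (fun k => / INR (2 * k + 1) ^ 2) K =
    inv_sqr_sum (2 * K) - / 4 * inv_sqr_sum K).
  { intros K. unfold inv_sqr_sum. induction K as [|K IH]; [simpl; ring|].
    replace (2 * S K)%nat with (S (S (2 * K))) by lia. rewrite !rsum_S, IH.
    replace (2 * K + 1)%nat with (S (2 * K)) by lia.
    replace (INR (S (S (2 * K)))) with (2 * INR (S K)).
    2:{ rewrite !S_INR, mult_INR. simpl; ring. }
    pose proof (INR_S_pos K). pose proof (INR_S_pos (2 * K)). field. lra. }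
  assert (L1 : is_lim_seq (fun n => rsum (fun k => / INR (2 * k + 1) ^ 2) (2 ^ n)) (Z - / 4 * Z)).
  { apply is_lim_seq_ext with (fun n => inv_sqr_sum (2 * 2 ^ n) - / 4 * inv_sqr_sum (2 ^ n)).
    { intros n; symmetry; apply Hodd. }
    apply is_lim_seq_minus'.
    - apply (Hsub (fun n => (2 * 2 ^ n)%nat)). intros n; specialize (Hpow n); lia.
    - apply (is_lim_seq_scal_l _ (/ 4) Z). apply Hsub; auto. }
  assert (L2 : is_lim_seq (fun n => rsum (fun k => / INR (2 * k + 1) ^ 2) (2 ^ n)) (PI ^ 2 / 8)).
  { apply (is_lim_seq_le_le (fun n => PI ^ 2 / 8 + - (PI ^ 2 / 16) * (/ 2) ^ n) _ (fun _ => PI ^ 2 / 8)).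
    - intros n. pose proof (basel_odd_bounds n) as H. cbv zeta in H. lra.
    - apply lim_const_plus.
      apply lim0_scal, is_lim_seq_geom. rewrite Rabs_pos_eq; lra.
    - apply is_lim_seq_const. }
  apply is_lim_seq_unique in L1, L2. rewrite L1 in L2. injection L2 as L2.
  replace (PI ^ 2 / 6) with Z by lra. exact HZ.
Qed.

(** * The Gaussian integral *)

Definition gauss (x : R) : R := RInt (fun t => exp (- (t * t))) 0 x.

Lemma continuous_gauss_integrand k x : continuous (fun t => exp (- (k * (t * t)))) x.
Proof.
  apply continuous_of_ex_derive. auto_derive; auto.
Qed.

Lemma ex_RInt_cont (f : R -> R) a b : (forall x, continuous f x) -> ex_RInt f a b.
Proof. intros H. apply (@ex_RInt_continuous R_CompleteNormedModule). intros; apply H. Qed.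

Lemma continuous_gauss x : continuous (fun t => exp (- (t * t))) x.
Proof. apply continuous_of_ex_derive. auto_derive; auto. Qed.

Lemma is_derive_gauss x : is_derive gauss x (exp (- (x * x))).
Proof.
  unfold gauss. apply (@is_derive_RInt R_NormedModule (fun t => exp (- (t * t))) _ 0 x).
  - exists (mkposreal 1 Rlt_0_1). intros y _.
    apply (@RInt_correct R_CompleteNormedModule), ex_RInt_cont, continuous_gauss.
  - apply continuous_gauss.
Qed.

(** The classical companion of the Gaussian: the derivative in [x] of its integral over
    [0, 1] cancels that of the square of [gauss]. *)
Definition gauss_aux (x t : R) : R := exp (- (x * x * (1 + t * t))) / (1 + t * t).

Lemma one_plus_sqr_pos t : 0 < 1 + t * t.
Proof. nra. Qed.

Lemma is_derive_gauss_aux x t :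
  is_derive (fun u => gauss_aux u t) x (- 2 * x * exp (- (x * x * (1 + t * t)))).
Proof.
  unfold gauss_aux. pose proof (one_plus_sqr_pos t). auto_derive; [lra|]. field. lra.
Qed.

Lemma gauss_sqr x : 0 <= x ->
  gauss x * gauss x + RInt (gauss_aux x) 0 1 = PI / 4.
Proof.
  intros Hx.
  assert (Ck : forall y, ex_RInt (gauss_aux y) 0 1).
  { intros y. apply ex_RInt_cont. intros t. apply continuous_of_ex_derive.
    unfold gauss_aux. pose proof (one_plus_sqr_pos t). auto_derive. lra. }
  assert (DK : forall y, is_derive (fun u => RInt (gauss_aux u) 0 1) y (- 2 * exp (- (y * y)) * gauss y)).
  { intros y. evar_last.
    - apply is_derive_RInt_param.
      + apply filter_forall. intros u t _. eexists. apply is_derive_gauss_aux.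
      + intros t _.
        apply continuity_2d_pt_ext with (fun u v => - 2 * u * exp (- (u * u * (1 + v * v)))).
        { intros u v. symmetry. apply is_derive_unique, is_derive_gauss_aux. }
        apply continuity_2d_pt_mult.
        * apply continuity_2d_pt_mult; [apply continuity_2d_pt_const|apply continuity_2d_pt_id1].
        * apply (continuity_1d_2d_pt_comp exp).
          -- apply derivable_continuous_pt, derivable_pt_exp.
          -- apply continuity_2d_pt_opp. repeat apply continuity_2d_pt_mult;
             try apply continuity_2d_pt_id1.
             apply continuity_2d_pt_plus; [apply continuity_2d_pt_const|].
             apply continuity_2d_pt_mult; apply continuity_2d_pt_id2.
      + apply filter_forall. intros u. apply Ck.
    - transitivity (@RInt R_CompleteNormedModule (fun t => @scal R_AbsRing R_NormedModule (- 2 * exp (- (y * y)))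
        (@scal R_AbsRing R_NormedModule y (exp (- ((y * t + 0) * (y * t + 0)))))) 0 1).
      { apply RInt_ext. intros t _. etransitivity; [apply is_derive_unique, is_derive_gauss_aux|].
          unfold scal; simpl; unfold mult; simpl.
          replace (- (y * y * (1 + t * t))) with (- (y * y) + - ((y * t + 0) * (y * t + 0))) by ring.
          rewrite exp_plus. ring. }
      etransitivity; [apply (@RInt_scal R_CompleteNormedModule)|].
      { apply ex_RInt_cont. intros t. apply continuous_of_ex_derive.
        unfold scal; simpl; unfold mult; simpl. auto_derive; auto. }
      unfold scal at 1; simpl; unfold mult; simpl. f_equal.
      etransitivity; [refine (@RInt_comp_lin R_CompleteNormedModule (fun t => exp (- (t * t))) y 0 0 1 _)|].
      { apply ex_RInt_cont, continuous_gauss. }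
      unfold gauss. f_equal; ring. }
  set (Phi := fun x => gauss x * gauss x + RInt (gauss_aux x) 0 1).
  assert (DPhi : forall y, is_derive Phi y 0).
  { intros y. unfold Phi. evar_last.
    - apply (@is_derive_plus R_AbsRing R_NormedModule); [|apply DK].
      apply (@is_derive_mult R_AbsRing); [apply is_derive_gauss|apply is_derive_gauss|].
      intros; apply Rmult_comm.
    - unfold plus, mult; simpl. ring. }
  assert (E0 : Phi 0 = PI / 4).
  { unfold Phi, gauss. rewrite RInt_point. unfold zero; simpl.
    rewrite (RInt_ext _ (fun t => / (1 + t * t))).
    2:{ intros t _. unfold gauss_aux. replace (- (0 * 0 * (1 + t * t))) with 0 by ring.
        rewrite exp_0. exact (Rmult_1_l _). }
    assert (HI : is_RInt (fun t => / (1 + t * t)) 0 1 (minus (atan 1) (atan 0))).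
    { apply (@is_RInt_derive R_CompleteNormedModule).
      - intros t _. pose proof (one_plus_sqr_pos t). auto_derive; auto. field. lra.
      - intros t _. pose proof (one_plus_sqr_pos t).
        apply continuous_of_ex_derive. auto_derive. lra. }
    rewrite (is_RInt_unique _ _ _ _ HI). rewrite atan_0, atan_1. unfold minus, plus, opp; simpl. ring. }
  change (Phi x = PI / 4). rewrite <- E0.
  destruct (MVT_gen Phi 0 x (fun _ => 0)) as [c [_ Ec]].
  - intros; apply DPhi.
  - intros y _. apply continuity_pt_filterlim.
    apply continuous_of_ex_derive. exists 0; apply DPhi.
  - lra.
Qed.

Lemma gauss_bounds x : 0 <= x -> sqrt PI / 2 - 2 * exp (- (x * x)) <= gauss x <= sqrt PI / 2.
Proof.
  intros Hx. pose proof (gauss_sqr x Hx) as E. pose proof PI_RGT_0 as HP.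
  assert (Hsp : 0 < sqrt PI) by (apply sqrt_lt_R0; auto).
  pose proof (sqrt_sqrt PI ltac:(lra)) as Hss.
  assert (Hint : ex_RInt (gauss_aux x) 0 1).
  { apply ex_RInt_cont. intros t. apply continuous_of_ex_derive.
    unfold gauss_aux. pose proof (one_plus_sqr_pos t). auto_derive. lra. }
  assert (Haux : forall t, 0 <= gauss_aux x t <= exp (- (x * x))).
  { intros t. unfold gauss_aux. pose proof (one_plus_sqr_pos t). split.
    - apply Rmult_le_pos; [left; apply exp_pos|left; apply Rinv_0_lt_compat; auto].
    - apply (Rmult_le_reg_r (1 + t * t)); auto. unfold Rdiv. rewrite Rmult_assoc, Rinv_l by lra.
      pose proof (exp_pos (- (x * x))). rewrite Rmult_1_r.
      apply Rle_trans with (exp (- (x * x))); [apply exp_le; nra|nra]. }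
  assert (K0 : 0 <= RInt (gauss_aux x) 0 1).
  { apply RInt_ge_0; auto; [lra|]. intros; apply Haux. }
  assert (K1 : RInt (gauss_aux x) 0 1 <= exp (- (x * x))).
  { replace (exp (- (x * x))) with (RInt (fun _ => exp (- (x * x))) 0 1).
    - apply RInt_le; auto; [lra|apply ex_RInt_const|]. intros; apply Haux.
    - rewrite RInt_const. unfold scal; simpl; unfold mult; simpl. ring. }
  assert (G0 : 0 <= gauss x).
  { unfold gauss. apply RInt_ge_0; auto; [apply ex_RInt_cont, continuous_gauss|].
    intros; left; apply exp_pos. }
  pose proof PI2_1 as HP2.
  assert (Hs1 : 1 <= sqrt PI) by nra.
  split; [|nra].
  apply Rnot_lt_le; intros Habs. nra.
Qed.

Lemma gauss_interval (k V : R) : 0 < k -> 0 <= V ->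
  exists I, is_RInt (fun t => exp (- (k * (t * t)))) (- V) V I /\
    sqrt (PI / k) - 4 / sqrt k * exp (- (k * (V * V))) <= I <= sqrt (PI / k).
Proof.
  intros Hk HV. pose proof (sqrt_lt_R0 k Hk) as Hs. pose proof (sqrt_sqrt k ltac:(lra)) as Hss.
  assert (Hex : forall a b, ex_RInt (fun t => exp (- (k * (t * t)))) a b).
  { intros; apply ex_RInt_cont, continuous_gauss_integrand. }
  assert (Hhalf : RInt (fun t => exp (- (k * (t * t)))) 0 V = / sqrt k * gauss (sqrt k * V)).
  { unfold gauss. pose proof (RInt_comp_lin (fun t => exp (- (t * t))) (sqrt k) 0 0 V) as E.
    rewrite !Rplus_0_r, Rmult_0_r in E. rewrite <- E by (apply ex_RInt_cont, continuous_gauss).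
    transitivity (/ sqrt k * RInt (fun t => @scal R_AbsRing R_NormedModule (sqrt k) (exp (- (k * (t * t))))) 0 V).
    - rewrite (@RInt_scal R_CompleteNormedModule) by apply Hex. unfold scal; simpl; unfold mult; simpl.
      rewrite <- Rmult_assoc, Rinv_l, Rmult_1_l by lra. reflexivity.
    - f_equal. apply RInt_ext. intros t _. unfold scal; simpl; unfold mult; simpl. f_equal. f_equal.
      replace ((sqrt k * t + 0) * (sqrt k * t + 0)) with ((sqrt k * sqrt k) * (t * t)) by ring.
      rewrite Hss; reflexivity. }
  assert (Hneg : RInt (fun t => exp (- (k * (t * t)))) (- V) 0 = RInt (fun t => exp (- (k * (t * t)))) 0 V).
  { pose proof (RInt_comp_lin (fun t => exp (- (k * (t * t)))) (-1) 0 V 0) as E.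
    replace (-1 * V + 0) with (- V) in E by ring. replace (-1 * 0 + 0) with 0 in E by ring.
    rewrite <- E by apply Hex.
    rewrite <- (opp_RInt_swap (fun t => exp (- (k * (t * t)))) V 0) by apply Hex.
    rewrite <- (@RInt_opp R_CompleteNormedModule) by apply Hex.
    apply RInt_ext. intros t _. unfold scal, opp; simpl; unfold mult; simpl.
    replace ((-1 * t + 0) * (-1 * t + 0)) with (t * t) by ring. ring. }
  assert (Hval : RInt (fun t => exp (- (k * (t * t)))) (- V) V = 2 / sqrt k * gauss (sqrt k * V)).
  { rewrite <- (RInt_Chasles (fun t => exp (- (k * (t * t)))) (- V) 0 V) by apply Hex.
    rewrite Hneg, Hhalf. unfold plus; simpl.
    set (G := gauss (sqrt k * V)). transitivity ((/ sqrt k + / sqrt k) * G); [|field; lra].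
    symmetry; apply Rmult_plus_distr_r. }
  exists (RInt (fun t => exp (- (k * (t * t)))) (- V) V). split.
  - apply (@RInt_correct R_CompleteNormedModule), Hex.
  - rewrite Hval.
    pose proof (gauss_bounds (sqrt k * V) ltac:(nra)) as G.
    replace (sqrt k * V * (sqrt k * V)) with (k * (V * V)) in G by (rewrite <- Hss at 1; ring).
    pose proof PI_RGT_0 as HP. rewrite sqrt_div by lra.
    assert (Hi : 0 < / sqrt k) by (apply Rinv_0_lt_compat; auto).
    unfold Rdiv in *. split; nra.
Qed.

(** * Coefficients as integrals over the circle *)

Definition is_CInt (f : R -> C) (a b : R) (l : C) : Prop :=
  is_RInt (fun s => Re (f s)) a b (Re l) /\ is_RInt (fun s => Im (f s)) a b (Im l).

Lemma is_CInt_ext f g a b l : (forall s, f s = g s) -> is_CInt f a b l -> is_CInt g a b l.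
Proof.
  intros E [H1 H2]; split.
  - apply is_RInt_ext with (2 := H1). intros s _; rewrite E; reflexivity.
  - apply is_RInt_ext with (2 := H2). intros s _; rewrite E; reflexivity.
Qed.

Lemma is_CInt_plus f g a b l l' : is_CInt f a b l -> is_CInt g a b l' ->
  is_CInt (fun s => f s + g s)%C a b (l + l')%C.
Proof.
  intros [H1 H2] [H3 H4]; split.
  - exact (@is_RInt_plus R_NormedModule _ _ _ _ _ _ H1 H3).
  - exact (@is_RInt_plus R_NormedModule _ _ _ _ _ _ H2 H4).
Qed.

Lemma is_CInt_scal (k : C) f a b l : is_CInt f a b l -> is_CInt (fun s => k * f s)%C a b (k * l)%C.
Proof.
  intros [H1 H2]; split.
  - pose proof (@is_RInt_minus R_NormedModule _ _ _ _ _ _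
      (@is_RInt_scal R_NormedModule _ _ _ (Re k) _ H1)
      (@is_RInt_scal R_NormedModule _ _ _ (Im k) _ H2)) as H. exact H.
  - pose proof (@is_RInt_plus R_NormedModule _ _ _ _ _ _
      (@is_RInt_scal R_NormedModule _ _ _ (Re k) _ H2)
      (@is_RInt_scal R_NormedModule _ _ _ (Im k) _ H1)) as H. exact H.
Qed.

Lemma is_CInt_minus f g a b l l' : is_CInt f a b l -> is_CInt g a b l' ->
  is_CInt (fun s => f s - g s)%C a b (l - l')%C.
Proof.
  intros H1 H2. replace (l - l')%C with (l + (- (1)) * l')%C by ring.
  apply is_CInt_ext with (fun s => f s + (- (1)) * g s)%C; [intros; ring|].
  apply is_CInt_plus; [auto|apply is_CInt_scal; auto].
Qed.

Lemma is_CInt_csum (f : nat -> R -> C) (l : nat -> C) a b n :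
  (forall k, (k < n)%nat -> is_CInt (f k) a b (l k)) ->
  is_CInt (fun s => csum (fun k => f k s) n) a b (csum l n).
Proof.
  induction n as [|n IH]; intros H; simpl.
  - split; simpl.
    + evar_last; [apply (@is_RInt_const R_NormedModule)|]. unfold scal; simpl; unfold mult; simpl. apply Rmult_0_r.
    + evar_last; [apply (@is_RInt_const R_NormedModule)|]. unfold scal; simpl; unfold mult; simpl. apply Rmult_0_r.
  - apply is_CInt_plus; [apply IH; intros; apply H; lia|apply H; lia].
Qed.

Lemma is_CInt_bound f g a b l lg : a <= b -> is_CInt f a b l -> is_RInt g a b lg ->
  (forall s, a <= s <= b -> Cmod (f s) <= g s) -> Cmod l <= 2 * lg.
Proof.
  intros Hab [H1 H2] Hg Hle.
  assert (B1 : Rabs (Re l) <= lg).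
  { apply (@norm_RInt_le R_NormedModule (fun s => Re (f s)) g a b (Re l) lg Hab); auto.
    intros s Hs. eapply Rle_trans; [apply re_le_Cmod|apply Hle; auto]. }
  assert (B2 : Rabs (Im l) <= lg).
  { apply (@norm_RInt_le R_NormedModule (fun s => Im (f s)) g a b (Im l) lg Hab); auto.
    intros s Hs. eapply Rle_trans; [apply im_le_Cmod|apply Hle; auto]. }
  eapply Rle_trans; [apply Cmod_le_abs|lra].
Qed.

Lemma is_CInt_derive (F f : R -> C) a b :
  (forall s, cderive F s (f s)) ->
  (forall s, continuous (fun s => Re (f s)) s) -> (forall s, continuous (fun s => Im (f s)) s) ->
  is_CInt f a b (F b - F a)%C.
Proof.
  intros HF H1 H2; split.
  - apply (@is_RInt_derive R_CompleteNormedModule (fun s => Re (F s))); intros; [apply HF|apply H1].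
  - apply (@is_RInt_derive R_CompleteNormedModule (fun s => Im (F s))); intros; [apply HF|apply H2].
Qed.

Lemma is_CInt_const (k : C) a b : is_CInt (fun _ => k) a b (RtoC (b - a) * k)%C.
Proof.
  eapply is_CInt_ext; [intros; reflexivity|].
  split; simpl.
  - evar_last; [apply (@is_RInt_const R_NormedModule)|]. unfold scal; simpl; unfold mult; simpl.
    unfold Re; ring.
  - evar_last; [apply (@is_RInt_const R_NormedModule)|]. unfold scal; simpl; unfold mult; simpl.
    unfold Im; ring.
Qed.

Lemma is_CInt_cis (d : R) a b : d <> 0 ->
  is_CInt (fun s => cis (d * s)) a b ((cis (d * b) - cis (d * a)) / (Ci * d))%C.
Proof.
  intros Hd.
  assert (HdC : RtoC d <> 0%C) by (apply RtoC_nz; auto).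
  replace ((cis (d * b) - cis (d * a)) / (Ci * d))%C with
    (/ (Ci * d) * cis (d * b) - / (Ci * d) * cis (d * a))%C by (field; split; [auto|apply Ci_nz]).
  apply (is_CInt_derive (fun s => / (Ci * d) * cis (d * s))%C).
  - intros s. replace (cis (d * s)) with (/ (Ci * d) * (Ci * RtoC d * Cexp (Ci * RtoC (d * s))))%C.
    2:{ unfold cis. field. split; [auto|apply Ci_nz]. }
    apply cderive_scal, (cderive_Cexp (fun s => Ci * RtoC (d * s))%C), cderive_scal.
    apply (cderive_RtoC (fun s => d * s)). auto_derive; auto. ring.
  - intros s. apply continuous_ext with (fun s => cos (d * s)).
    { intros x. rewrite cis_eq. reflexivity. }
    apply continuous_of_ex_derive. auto_derive; auto.
  - intros s. apply continuous_ext with (fun s => sin (d * s)).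
    { intros x. rewrite cis_eq. reflexivity. }
    apply continuous_of_ex_derive. auto_derive; auto.
Qed.

Definition arc_integral (t k n h : nat) : C :=
  let d := INR k - INR n in
  if Nat.eqb k n then RtoC (2 * PI / INR t)
  else (cis (2 * PI * (d / INR t)) ^ h *
    ((cis (d * (PI / INR t)) - cis (d * - (PI / INR t))) / (Ci * d)))%C.

Lemma is_CInt_arc (t k n h : nat) : (0 < t)%nat ->
  is_CInt (fun s => cis ((INR k - INR n) * (2 * PI * (INR h / INR t) + s)))
    (- (PI / INR t)) (PI / INR t) (arc_integral t k n h).
Proof.
  intros Ht. assert (HtR : 0 < INR t) by (apply lt_0_INR; lia). unfold arc_integral.
  destruct (Nat.eqb_spec k n) as [->|Hne].
  - apply is_CInt_ext with (fun _ => 1%C).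
    { intros s. rewrite Rminus_diag, Rmult_0_l, cis_0. reflexivity. }
    replace (RtoC (2 * PI / INR t)) with (RtoC (PI / INR t - - (PI / INR t)) * 1)%C.
    + apply is_CInt_const.
    + rewrite Cmult_1_r. f_equal. field; lra.
  - set (d := INR k - INR n).
    apply is_CInt_ext with (fun s => cis (2 * PI * (d / INR t)) ^ h * cis (d * s))%C.
    { intros s. rewrite cis_pow, <- cis_plus. f_equal. field; lra. }
    apply is_CInt_scal, is_CInt_cis. unfold d; intros E; apply Hne, INR_eq; lra.
Qed.

(** With [d = k - n] and [w = e^(2 pi i d/t)], the integral over the arc at [h] is [w^h] times a
    fixed multiple of [w - 1], and [(w - 1) (1 + w + ... + w^(t-1)) = w^t - 1 = 0]. So the arcs need
    not be glued together to a full circle. *)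
Lemma arc_orthogonality (t k n : nat) : (0 < t)%nat ->
  csum (arc_integral t k n) t = if Nat.eqb k n then RtoC (2 * PI) else 0%C.
Proof.
  intros Ht. assert (HtR : 0 < INR t) by (apply lt_0_INR; lia). unfold arc_integral.
  destruct (Nat.eqb_spec k n) as [->|Hne].
  - rewrite csum_const, <- RtoC_mult. f_equal. field; lra.
  - set (d := INR k - INR n). set (w := cis (2 * PI * (d / INR t))).
    assert (HdC : RtoC d <> 0%C) by (apply RtoC_nz; unfold d; intros E; apply Hne, INR_eq; lra).
    assert (Hwt : (w ^ t)%C = 1%C).
    { unfold w. rewrite cis_pow.
      replace (INR t * (2 * PI * (d / INR t))) with (2 * PI * IZR (Z.of_nat k - Z.of_nat n)).
      - apply cis_2PI_Z.
      - rewrite minus_IZR, <- !INR_IZR_INZ. fold d. field; lra. }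
    assert (HG : forall m, ((w - 1) * csum (Cpow w) m = w ^ m - 1)%C).
    { intros m. induction m as [|m IH]; [simpl; ring|].
      rewrite csum_S, Cpow_S. transitivity ((w - 1) * csum (Cpow w) m + (w - 1) * w ^ m)%C; [ring|].
      rewrite IH. ring. }
    set (D := (cis (d * - (PI / INR t)) / (Ci * d))%C).
    rewrite (csum_ext _ (fun h => D * (w - 1) * w ^ h)%C).
    + rewrite csum_scal. change (fun h => (w ^ h)%C) with (Cpow w).
      transitivity (D * ((w - 1) * csum (Cpow w) t))%C; [ring|]. rewrite HG, Hwt. ring.
    + intros h _. unfold D.
      replace (d * (PI / INR t)) with (2 * PI * (d / INR t) + d * - (PI / INR t)) by (field; lra).
      rewrite cis_plus. fold w. field. split; [auto|apply Ci_nz].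
Qed.

(** The terms are bounded at the larger radius [(1 + r)/2], hence dominated by a geometric
    series on the circle of radius [r]. *)
Lemma pseries_uniform (c : nat -> C) (f : C -> C) (r : R) :
  (forall q, Cmod q < 1 -> Clim (csum (fun k => c k * q ^ k)%C) (f q)) ->
  0 < r < 1 -> forall eps, 0 < eps -> exists N, forall L, (N <= L)%nat -> forall q, Cmod q = r ->
    Cmod (f q - csum (fun k => c k * q ^ k)%C L) <= eps.
Proof.
  intros Hf Hr eps Heps. set (r1 := (1 + r) / 2).
  assert (Hr1 : r < r1 < 1) by (unfold r1; lra).
  assert (HM : exists M, 0 < M /\ forall k, Cmod (c k) * r1 ^ k <= M).
  { pose proof (Hf (RtoC r1)) as H. rewrite Cmod_R, Rabs_pos_eq in H by lra. specialize (H ltac:(lra)).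
    apply Clim_Cmod in H as HC.
    assert (HB : exists B, forall n, Cmod (csum (fun k => c k * RtoC r1 ^ k)%C n) <= B).
    { destruct (filterlim_bounded (fun n => Cmod (csum (fun k => c k * RtoC r1 ^ k)%C n))) as [B HB].
      - eexists; apply HC.
      - exists B. intros n. specialize (HB n). eapply Rle_trans; [apply Rle_abs|apply HB]. }
    destruct HB as [B HB]. exists (2 * B + 1).
    assert (0 <= B) by (eapply Rle_trans; [apply Cmod_ge_0|apply (HB O)]).
    split; [lra|]. intros k.
    replace (Cmod (c k) * r1 ^ k) with (Cmod (csum (fun k => c k * RtoC r1 ^ k)%C (S k) - csum (fun k => c k * RtoC r1 ^ k)%C k)).
    - eapply Rle_trans; [apply Cmod_triangle_minus|]. pose proof (HB (S k)). pose proof (HB k). lra.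
    - rewrite csum_S.
      replace (csum (fun k0 : nat => (c k0 * r1 ^ k0)%C) k + c k * r1 ^ k -
        csum (fun k0 : nat => (c k0 * r1 ^ k0)%C) k)%C with (c k * r1 ^ k)%C by ring.
      rewrite Cmod_mult, Cmod_pow, Cmod_R, Rabs_pos_eq by lra. reflexivity. }
  destruct HM as [M [HM0 HM]].
  set (u := r / r1).
  assert (Hu : 0 < u < 1).
  { unfold u. split; [apply Rdiv_lt_0_compat; lra|].
    apply (Rmult_lt_reg_r r1); [lra|]. unfold Rdiv. rewrite Rmult_assoc, Rinv_l; lra. }
  destruct (pow_lt_1_zero u ltac:(rewrite Rabs_pos_eq; lra) (eps * (1 - u) / M)) as [N HN].
  { apply Rdiv_lt_0_compat; nra. }
  exists N. intros L HL q Hq.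
  specialize (HN L HL). rewrite Rabs_pos_eq in HN by (apply pow_le; lra).
  apply (Clim_le (fun n => csum (fun k => c k * q ^ k)%C (L + n))).
  - apply (Clim_subseq (csum (fun k => c k * q ^ k)%C) (f q) (fun n => (L + n)%nat)); [intros; lia|].
    apply Hf. lra.
  - intros n. rewrite csum_add.
    replace (csum (fun k => c k * q ^ k)%C L + csum (fun k => c (L + k)%nat * q ^ (L + k))%C n - csum (fun k => c k * q ^ k)%C L)%C
      with (csum (fun k => c (L + k)%nat * q ^ (L + k))%C n) by ring.
    eapply Rle_trans; [apply Cmod_csum|].
    apply Rle_trans with (rsum (fun k => M * u ^ L * u ^ k) n).
    + apply rsum_le. intros k _. rewrite Cmod_mult, Cmod_pow, Hq.
      rewrite Rmult_assoc, <- pow_add.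
      replace (r ^ (L + k)) with (r1 ^ (L + k) * u ^ (L + k)).
      2:{ rewrite <- Rpow_mult_distr. f_equal. unfold u. field. lra. }
      rewrite <- Rmult_assoc. apply Rmult_le_compat_r; [apply pow_le; lra|apply HM].
    + rewrite rsum_scal. apply Rle_trans with (M * u ^ L * / (1 - u)).
      * apply Rmult_le_compat_l; [|apply rsum_geom_le; lra].
        apply Rmult_le_pos; [lra|apply pow_le; lra].
      * apply (Rmult_le_reg_r (1 - u)); [lra|]. rewrite Rmult_assoc, Rinv_l, Rmult_1_r by lra.
        apply (Rmult_lt_compat_l M) in HN; [|auto].
        replace (M * (eps * (1 - u) / M)) with (eps * (1 - u)) in HN by (field; lra). lra.
Qed.

(** Cauchy's formula with the integrand replaced by models of it on the arcs around the
    [t]-th roots of unity. It is applied to a partial sum of the series, uniformly close to [f],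
    so that nothing has to be known about the integrability of [f]. *)
Lemma circle_method (c : nat -> C) (f : C -> C) (r : R) (n t : nat)
  (model : nat -> R -> C) (I : nat -> C) (b : R -> R) (Ib : R) :
  (forall q, Cmod q < 1 -> Clim (csum (fun k => c k * q ^ k)%C) (f q)) ->
  0 < r < 1 -> (0 < t)%nat ->
  (forall h, (h < t)%nat -> is_CInt (model h) (- (PI / INR t)) (PI / INR t) (I h)) ->
  is_RInt b (- (PI / INR t)) (PI / INR t) Ib ->
  (forall h s, (h < t)%nat -> - (PI / INR t) <= s <= PI / INR t ->
    Cmod (f (r * cis (2 * PI * (INR h / INR t) + s))%C * (RtoC (/ r ^ n) * cis (- (INR n * (2 * PI * (INR h / INR t) + s))))
          - model h s) <= b s) ->
  Cmod (2 * PI * c n - csum I t) <= 2 * INR t * Ib.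
Proof.
  intros Hf Hr Ht HI Hb Hle.
  assert (HtR : 0 < INR t) by (apply lt_0_INR; lia).
  pose proof PI_RGT_0 as HP. assert (HPt : 0 < PI / INR t) by (apply Rdiv_lt_0_compat; auto).
  assert (Hrn : 0 < r ^ n) by (apply pow_lt; lra).
  apply Rnot_lt_le; intros Habs.
  set (gap := Cmod (2 * PI * c n - csum I t) - 2 * INR t * Ib).
  set (eps := gap / (8 * PI)).
  assert (Heps : 0 < eps) by (unfold eps, gap; apply Rdiv_lt_0_compat; lra).
  destruct (pseries_uniform c f r Hf Hr (eps * r ^ n)) as [N HN]; [nra|].
  set (L := Nat.max N (S n)).
  set (th := fun h s => 2 * PI * (INR h / INR t) + s).
  set (SL := fun q => csum (fun k => c k * q ^ k)%C L).
  set (g := fun h s => (SL (r * cis (th h s))%C * (RtoC (/ r ^ n) * cis (- (INR n * th h s))))%C).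
  assert (Hg : exists G : nat -> C, (forall h, (h < t)%nat -> is_CInt (g h) (- (PI / INR t)) (PI / INR t) (G h))
     /\ csum G t = (2 * PI * c n)%C).
  { exists (fun h => csum (fun k => c k * RtoC (r ^ k * / r ^ n) * arc_integral t k n h)%C L). split.
    - intros h Hh. apply is_CInt_ext with
        (fun s => csum (fun k => c k * RtoC (r ^ k * / r ^ n) * cis ((INR k - INR n) * th h s))%C L).
      + intros s. unfold g, SL. rewrite Cmult_comm, <- csum_scal. apply csum_ext. intros k _.
        rewrite Cpow_mult_l, cis_pow, RtoC_mult, RtoC_pow.
        replace ((INR k - INR n) * th h s) with (INR k * th h s + - (INR n * th h s)) by ring.
        rewrite cis_plus. ring.
      + apply (is_CInt_csum (fun k s => c k * RtoC (r ^ k * / r ^ n) * cis ((INR k - INR n) * th h s))%C).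
        intros k _. apply is_CInt_scal, is_CInt_arc; auto.
    - rewrite csum_swap.
      rewrite (csum_ext _ (fun k => if Nat.eqb k n then (2 * PI * c n)%C else 0%C)).
      2:{ intros k _. rewrite csum_scal, arc_orthogonality by auto.
          destruct (Nat.eqb_spec k n) as [->|]; [|ring].
          rewrite Rinv_r by lra. rewrite RtoC_mult. ring. }
      assert (HnL : (n < L)%nat) by (unfold L; lia).
      revert HnL. generalize L. intros m. induction m as [|m IH]; [lia|]. intros Hm.
      rewrite csum_S. destruct (Nat.eqb_spec m n) as [->|].
      + rewrite (csum_ext _ (fun _ => 0%C)); [rewrite csum_const; ring|].
        intros k Hk. destruct (Nat.eqb_spec k n); [lia|reflexivity].
      + rewrite IH by lia. ring. }
  destruct Hg as [G [HG1 HG2]].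
  assert (Hbnd : Cmod (csum (fun k => G k - I k)%C t) <= INR t * (2 * (Ib + (PI / INR t - - (PI / INR t)) * eps))).
  { eapply Rle_trans; [apply Cmod_csum|]. rewrite <- rsum_const. apply rsum_le. intros h Hh.
    apply (is_CInt_bound (fun s => g h s - model h s)%C (fun s => b s + eps) (- (PI / INR t)) (PI / INR t)).
    - lra.
    - apply is_CInt_minus; [apply HG1; auto|apply HI; auto].
    - apply (@is_RInt_plus R_NormedModule); [exact Hb|]. apply (@is_RInt_const R_NormedModule).
    - intros s Hs. set (q := (r * cis (th h s))%C). set (e := (RtoC (/ r ^ n) * cis (- (INR n * th h s)))%C).
      replace (g h s - model h s)%C with ((f q * e - model h s) + - ((f q - SL q) * e))%C
        by (unfold g, q, e; ring).
      eapply Rle_trans; [apply Cmod_triangle|]. apply Rplus_le_compat; [apply Hle; auto|].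
      rewrite Cmod_opp, Cmod_mult. unfold e. rewrite Cmod_mult, Cmod_cis, Cmod_R, Rabs_pos_eq, Rmult_1_r.
      2:{ left; apply Rinv_0_lt_compat; auto. }
      assert (Hq : Cmod q = r) by (unfold q; rewrite Cmod_mult, Cmod_cis, Cmod_R, Rabs_pos_eq; lra).
      pose proof (HN L ltac:(unfold L; lia) q Hq) as G1. fold (SL q) in G1.
      apply (Rmult_le_reg_r (r ^ n)); auto. rewrite Rmult_assoc, Rinv_l, Rmult_1_r by lra. exact G1. }
  replace (INR t * (2 * (Ib + (PI / INR t - - (PI / INR t)) * eps))) with (2 * INR t * Ib + 4 * PI * eps) in Hbnd by (field; lra).
  replace (4 * PI * eps) with (gap / 2) in Hbnd by (unfold eps; field; lra).
  rewrite csum_minus, HG2 in Hbnd. unfold gap in *. lra.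
Qed.

Lemma pseries_Clim (c : nat -> C) (q l : C) :
  is_pseries (K := C_AbsRing) (V := C_NormedModule) c q l -> Clim (csum (fun k => c k * q ^ k)%C) l.
Proof.
  intros H.
  assert (E : forall n, sum_n (fun k => scal (pow_n (K := C_AbsRing) q k) (c k)) n = csum (fun k => c k * q ^ k)%C (S n)).
  { assert (Hp : forall k, pow_n (K := C_AbsRing) q k = (q ^ k)%C).
    { intros k. induction k as [|k IH]; [reflexivity|]. rewrite Cpow_S, <- IH. reflexivity. }
    intros n. induction n as [|n IH].
    - rewrite sum_O. change (1 * c O = 0 + c O * 1)%C. ring.
    - rewrite sum_Sn, IH, Hp, (csum_S _ (S n)).
      change (csum (fun k => c k * q ^ k)%C (S n) + q ^ S n * c (S n) = csum (fun k => c k * q ^ k)%C (S n) + c (S n) * q ^ S n)%C.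
      ring. }
  assert (HL : Clim (fun n => csum (fun k => c k * q ^ k)%C (S n)) l).
  { apply Clim_ext with (1 := E). unfold Clim. apply is_lim_seq_spec. intros eps.
    unfold is_pseries, is_series in H.
    pose proof (proj1 (filterlim_locally_ball_norm (K := C_AbsRing) (U := C_NormedModule) _ _) H eps) as H0; clear H; rename H0 into H.
    destruct H as [N HN]. exists N. intros n Hn. specialize (HN n Hn).
    rewrite Rminus_0_r, Rabs_pos_eq by apply Cmod_ge_0. exact HN. }
  unfold Clim in *. apply is_lim_seq_incr_1. exact HL.
Qed.

(** * The minor arcs *)

(** [sin x = 2 sin (x/2) cos (x/2) >= x cos^2 (x/2) = x (1 + cos x)/2]. *)
Lemma sin_ge_half x : 0 <= x <= PI / 2 -> x / 2 <= sin x.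
Proof.
  intros Hx. destruct (Req_dec x 0) as [->|Hx0]; [rewrite sin_0; lra|].
  assert (Hc : 0 <= cos x) by (apply cos_ge_0; lra).
  pose proof (x_cos_lt_sin (x / 2) ltac:(lra)) as H.
  assert (Hc2 : 0 < cos (x / 2)) by (apply cos_gt_0; lra).
  replace x with (2 * (x / 2)) in Hc at 1 by field. rewrite cos_2a_cos in Hc.
  replace (sin x) with (2 * sin (x / 2) * cos (x / 2)) by (rewrite <- sin_2a; f_equal; field).
  nra.
Qed.

Lemma sin_sqr_ge x : Rabs x <= PI / 2 -> x * x / 4 <= sin x * sin x.
Proof.
  intros Hx. destruct (Rle_dec 0 x) as [H|H].
  - rewrite Rabs_pos_eq in Hx by auto. pose proof (sin_ge_half x ltac:(lra)). nra.
  - rewrite Rabs_left in Hx by lra. pose proof (sin_ge_half (- x) ltac:(lra)) as G.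
    rewrite sin_neg in G. nra.
Qed.

Lemma one_minus_cos x : 1 - cos x = 2 * (sin (x / 2) * sin (x / 2)).
Proof. replace x with (2 * (x / 2)) at 1 by field. rewrite cos_2a_sin. ring. Qed.

Lemma sin_sqr_le x : sin x * sin x <= x * x.
Proof.
  assert (H : forall z, 0 <= z -> sin z * sin z <= z * z).
  { intros z Hz. destruct (Req_dec z 0) as [->|]; [rewrite sin_0; lra|].
    destruct (Rle_dec z 1) as [H1|H1].
    - pose proof (sin_lt_x z ltac:(lra)). pose proof PI2_1.
      pose proof (sin_ge_0 z ltac:(lra) ltac:(lra)). nra.
    - pose proof (SIN_bound z). nra. }
  destruct (Rle_dec 0 x); [auto|].
  pose proof (H (- x) ltac:(lra)) as G. rewrite sin_neg in G. lra.
Qed.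

Lemma cos_ge_quadratic x : 1 - x * x / 2 <= cos x.
Proof. pose proof (one_minus_cos x). pose proof (sin_sqr_le (x / 2)). lra. Qed.

Lemma Re_lambert_exp (A B : R) : 0 < A ->
  Re (lambert (Cexp (- (A - Ci * B)))) =
  (exp A * cos B - 1) / ((exp A - 1) * (exp A - 1) + 4 * exp A * (sin (B / 2) * sin (B / 2))).
Proof.
  intros HA. pose proof (exp_ineq1 A ltac:(lra)) as HE1.
  assert (Hm : Cmod (Cexp (- (A - Ci * B))) = / exp A).
  { rewrite Cmod_Cexp, re_opp. simpl. rewrite <- exp_Ropp. f_equal. ring. }
  assert (Hr : Re (Cexp (- (A - Ci * B))) = / exp A * cos B).
  { unfold Cexp. rewrite re_scal_l, re_opp, im_opp. simpl. rewrite <- exp_Ropp.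
    f_equal; f_equal; ring. }
  rewrite Re_lambert by (rewrite Hm, <- Rinv_1; apply Rinv_lt_contravar; lra).
  rewrite Hm, Hr. pose proof (one_minus_cos B) as Hc.
  assert (Hs : 0 <= sin (B / 2) * sin (B / 2)) by nra.
  replace (sin (B / 2) * sin (B / 2)) with ((1 - cos B) / 2) in * by lra.
  field. repeat split; nra.
Qed.

(** If [|B| >= A] then [4 e^A sin^2 (B/2) >= A^2/4], so that [e^A |1 - w|], with
    [w = e^(-(A - i B))], is at least [sqrt (5/4) A > 11/10 A]. *)
Lemma Re_lambert_far (A B : R) : 0 < A -> A <= Rabs B <= PI ->
  Re (lambert (Cexp (- (A - Ci * B)))) <= (1 - / 11) / A.
Proof.
  intros HA HB. rewrite Re_lambert_exp by auto.
  pose proof (exp_ineq1 A ltac:(lra)) as HE.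
  pose proof (sin_sqr_ge (B / 2)) as Hs.
  assert (HBB : A * A <= B * B).
  { rewrite <- (Rabs_mult_self B). nra. }
  unfold Rdiv at 1 in Hs. rewrite Rabs_mult, (Rabs_pos_eq (/ 2)) in Hs by lra. specialize (Hs ltac:(lra)).
  set (S := sin (B / 2) * sin (B / 2)) in *.
  assert (Hc : cos B = 1 - 2 * S) by (pose proof (one_minus_cos B); unfold S; lra).
  set (E := exp A) in *. rewrite Hc.
  assert (HD : 0 < (E - 1) * (E - 1) + 4 * E * S) by nra.
  apply (Rmult_le_reg_r ((E - 1) * (E - 1) + 4 * E * S)); auto.
  unfold Rdiv. rewrite Rmult_assoc, Rinv_l, Rmult_1_r by lra.
  apply (Rmult_le_reg_l A); auto.
  replace (A * ((1 - / 11) * / A * ((E - 1) * (E - 1) + 4 * E * S))) with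
    (10 / 11 * ((E - 1) * (E - 1) + 4 * E * S)) by (field; lra).
  assert (G1 : A * A / 16 <= E * S) by nra.
  nra.
Qed.

(** Near [w = 1] in a cone, [w/(1 - w)] is close to [1/(A - i B)], with real part at least
    [1/(2 A)]. *)
Lemma Re_lambert_near (A B : R) : 0 < A <= 1 / 2 -> Rabs B <= A ->
  / (12 * A) <= Re (lambert (Cexp (- (A - Ci * B)))).
Proof.
  intros HA HB. rewrite Re_lambert_exp by lra.
  pose proof (exp_ineq1 A ltac:(lra)) as HE. set (E := exp A) in *.
  assert (HE2 : E <= 1 + 2 * A).
  { pose proof (exp_ineq1_le (- A)) as G.
    assert (G2 : E * exp (- A) = 1) by apply exp_mult_opp.
    pose proof (exp_pos A). fold E in H. nra. }
  assert (HBB : B * B <= A * A).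
  { rewrite <- (Rabs_mult_self B). pose proof (Rabs_pos B). nra. }
  pose proof (cos_ge_quadratic B) as Hc.
  pose proof (sin_sqr_le (B / 2)) as Hs. pose proof (Rle_0_sqr (sin (B / 2))) as Hs0. unfold Rsqr in Hs0.
  set (S := sin (B / 2) * sin (B / 2)) in *.
  assert (Hnum : A / 2 <= E * cos B - 1).
  { nra. }
  assert (Hden : (E - 1) * (E - 1) + 4 * E * S <= 6 * (A * A)).
  { nra. }
  assert (Hden0 : 0 < (E - 1) * (E - 1) + 4 * E * S) by nra.
  set (D := (E - 1) * (E - 1) + 4 * E * S) in *.
  apply (Rmult_le_reg_r D); auto.
  replace ((E * cos B - 1) / D * D) with (E * cos B - 1) by (field; lra).
  apply Rle_trans with (A / 2); [|auto].
  apply Rle_trans with (/ (12 * A) * (6 * (A * A))).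
  - apply Rmult_le_compat_l; auto. left; apply Rinv_0_lt_compat; lra.
  - right; field; lra.
Qed.

(** The coefficient of [1/x] in the logarithm of the product near a primitive root of unity. *)
Definition pole_coeff (t : nat) : R := (1 - / INR t) * (PI ^ 2 / 6) / INR t.

Definition arc_point (t h : nat) (y s : R) : C :=
  (root h t * Cexp (- (RtoC y - Ci * RtoC s)))%C.

Lemma arc_point_pow (h t : nat) (y s : R) (k : nat) :
  (arc_point t h y s ^ k)%C =
  (root h t ^ k * Cexp (- (RtoC (INR k * y) - Ci * RtoC (INR k * s))))%C.
Proof. unfold arc_point. rewrite Cpow_mult_l, Cexp_pow. do 2 f_equal. rewrite !RtoC_mult. ring. Qed.

(** Away from the primitive [t]-th roots of unity the bound [pole_coeff t / y] is improved
    by a fixed multiple of [1/y]. If [|s| >= y] then [q^t] is not close to 1 on the scale [t y] and the first term of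
    the first Lambert series is smaller; if [g = gcd(h,t) > 1] then [q^(t/g)] is close to 1 and the
    term [k = t/g] of the second one is large. *)
Lemma quotient_minor_bound (t h : nat) (y s : R) (F : C) :
  (1 < t)%nat -> 0 < y -> INR t * y <= 1 / 2 -> Rabs s <= PI / INR t ->
  (y <= Rabs s \/ Nat.gcd h t <> 1%nat) ->
  is_quotient t (arc_point t h y s) F ->
  Cmod F <= exp ((pole_coeff t - / (12 * INR t ^ 2)) / y) / (1 - exp (- y)).
Proof.
  intros Ht Hy Hty Hs Hcase HF.
  assert (HtR : 2 <= INR t) by (apply (le_INR 2); lia).
  set (q := arc_point t h y s) in *.
  assert (Hqm : Cmod q = exp (- y)).
  { unfold q, arc_point. rewrite Cmod_mult. unfold root. rewrite Cmod_cis, Cmod_Cexp, re_opp. simpl.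
    rewrite Rmult_1_l. f_equal. ring. }
  pose proof (exp_neg_lt_1 y Hy) as Hlt. pose proof (exp_pos (- y)) as Hr0.
  assert (HZ : forall K, rsum (fun j => / INR (S j) ^ 2) K <= PI ^ 2 / 6).
  { intros K. apply (is_lim_seq_incr_compare inv_sqr_sum (PI ^ 2 / 6) basel).
    intros n. unfold inv_sqr_sum. rewrite rsum_S.
    pose proof (Rinv_0_lt_compat _ (pow_lt _ 2 (INR_S_pos n))). lra. }
  assert (Hqt : (q ^ t)%C = Cexp (- (RtoC (INR t * y) - Ci * RtoC (INR t * s)))).
  { unfold q. rewrite arc_point_pow, root_pow_t by lia. ring. }
  assert (Hty0 : 0 < INR t * y) by nra.
  assert (Hti : 0 < / INR t <= / 2) by (split; [apply Rinv_0_lt_compat|apply Rinv_le_contravar]; lra).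
  assert (Hfin : forall d g, / (12 * INR t ^ 2) / y <= (1 - / INR t) / (INR t * y) * d + g ->
    exp ((1 - / INR t) / (INR t * y) * (PI ^ 2 / 6 - d) - g) / (1 - exp (- y)) <=
    exp ((pole_coeff t - / (12 * INR t ^ 2)) / y) / (1 - exp (- y))).
  { intros d g Hdg. apply Rmult_le_compat_r; [left; apply Rinv_0_lt_compat; lra|].
    apply exp_le. unfold pole_coeff.
    replace (((1 - / INR t) * (PI ^ 2 / 6) / INR t - / (12 * INR t ^ 2)) / y) with
      ((1 - / INR t) / (INR t * y) * (PI ^ 2 / 6) - / (12 * INR t ^ 2) / y) by (field; lra). lra. }
  destruct (Rle_dec y (Rabs s)) as [Hys|Hys].
  - eapply Rle_trans; [apply (quotient_upper_bound t q F y (PI ^ 2 / 6) (/ 11) 0 0); auto|].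
    + rewrite Hqt. apply Re_lambert_far; auto. rewrite Rabs_mult, (Rabs_pos_eq (INR t)) by lra.
      split; [nra|]. apply (Rmult_le_compat_l (INR t)) in Hs; [|lra].
      replace (INR t * (PI / INR t)) with PI in Hs by (field; lra). auto.
    + simpl INR. rewrite !Rdiv_1_r. simpl pow. rewrite Cpow_1_r.
      pose proof (Re_lambert_ge q ltac:(lra)). lra.
    + apply Hfin. rewrite Rplus_0_r.
      replace (/ (12 * INR t ^ 2) / y) with (/ (INR t * y) * (/ INR t * / 12)) by (field; lra).
      unfold Rdiv at 1. rewrite (Rmult_comm (1 - / INR t)), Rmult_assoc.
      apply Rmult_le_compat_l; [left; apply Rinv_0_lt_compat; auto|]. nra.
  - destruct Hcase as [|Hg]; [contradiction|]. apply Rnot_le_lt in Hys.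
    set (g := Nat.gcd h t) in *.
    assert (Hg0 : g <> O) by (unfold g; intros E; apply Nat.gcd_eq_0 in E; lia).
    destruct (Nat.gcd_divide_l h t) as [h' Hh']. destruct (Nat.gcd_divide_r h t) as [t' Ht'].
    fold g in Hh', Ht'.
    assert (Ht't : (t' < t)%nat) by nia.
    assert (HtR' : 1 <= INR t') by (apply (le_INR 1); lia).
    assert (HtR'' : INR t' < INR t) by (apply lt_INR; auto).
    assert (Hqt' : (q ^ t')%C = Cexp (- (RtoC (INR t' * y) - Ci * RtoC (INR t' * s)))).
    { unfold q. rewrite arc_point_pow, root_pow.
      replace (2 * PI * (INR h * INR t' / INR t)) with (2 * PI * INR h').
      - rewrite cis_2PI_nat. ring.
      - rewrite Hh', Ht', !mult_INR. field.
        split; [apply not_0_INR; auto|lra]. }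
    eapply Rle_trans; [apply (quotient_upper_bound t q F y (PI ^ 2 / 6) 0 (/ (12 * INR t ^ 2) / y) (t' - 1)); auto|].
    + rewrite Rminus_0_r. unfold Rdiv; rewrite Rmult_1_l.
      apply Re_lambert_le_inv; auto. rewrite Hqt, Cmod_Cexp, re_opp. simpl. f_equal. ring.
    + lia.
    + replace (S (t' - 1)) with t' by lia. rewrite Hqt'.
      pose proof (Re_lambert_near (INR t' * y) (INR t' * s)) as G.
      rewrite Rabs_mult, (Rabs_pos_eq (INR t')) in G by lra.
      specialize (G ltac:(split; nra) ltac:(nra)).
      pose proof (pow_lt (Cmod q) t' ltac:(lra)) as Hp.
      apply Rle_trans with (/ (12 * (INR t' * y)) / INR t').
      * replace (/ (12 * (INR t' * y)) / INR t') with (/ (12 * INR t' ^ 2) / y) by (field; lra).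
        apply Rmult_le_compat_r; [left; apply Rinv_0_lt_compat; auto|].
        apply Rinv_le_contravar; nra.
      * apply Rmult_le_compat_r; [left; apply Rinv_0_lt_compat; lra|]. lra.
    + apply Hfin. lra.
Qed.

(** * The saddle point *)

Lemma pow_le_exp (k : nat) (c x : R) : 0 < c -> 0 <= x -> x ^ S k <= (INR (S k) * c) ^ S k * exp (x / c).
Proof.
  intros Hc Hx. pose proof (INR_S_pos k) as Hk. set (n := INR (S k)) in *.
  assert (E : exp (x / c) = exp (x / (n * c)) ^ S k).
  { rewrite exp_pow. fold n. f_equal. field. lra. }
  rewrite E, <- Rpow_mult_distr. apply pow_incr. split; auto.
  pose proof (exp_ineq1_le (x / (n * c))) as G.
  apply Rle_trans with (n * c * (x / (n * c))); [right; field; lra|].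
  apply Rmult_le_compat_l; [nra|lra].
Qed.

Lemma exp_neg_le_cube (u : R) : 0 < u -> exp (- u) <= 27 / u ^ 3.
Proof.
  intros Hu. pose proof (pow_le_exp 2 1 u ltac:(lra) ltac:(lra)) as G.
  replace (u / 1) with u in G by field. replace (INR 3 * 1) with 3 in G by (simpl; ring).
  assert (Hu3 : 0 < u ^ 3) by (apply pow_lt; auto).
  apply (Rmult_le_reg_r (u ^ 3)); auto. unfold Rdiv. rewrite Rmult_assoc, Rinv_l by lra.
  pose proof (exp_mult_opp u).
  nra.
Qed.

(** The expansion of [exp (- L v^2/(1 - i v))] with the cubic correction, which is odd in [v]:
    keeping it makes the remainder of relative size [1/L] rather than [1/sqrt L]. *)
Definition saddle_model (L v : R) : C :=
  (RtoC (exp (- (L * (v * v)))) * (1 - Ci * RtoC (L * v ^ 3)))%C.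

Lemma one_minus_Ci_nz (v : R) : (1 - Ci * v)%C <> 0%C.
Proof. intros E. apply (f_equal Re) in E. simpl in E. lra. Qed.

(** One has [- v^2/(1 - i v) = - v^2 - i v^3 + v^4/(1 - i v)]. With [X = L v^2], the last term and
    the square of the last two have size [X^2/L] and [X^3/L], and powers of [X] are absorbed by the
    exponential. *)
Lemma saddle_expansion (L v : R) : 0 < L -> Rabs v <= 1 ->
  Cmod (Cexp (- RtoC (L * (v * v)) / (1 - Ci * v)) - saddle_model L v)
  <= 6976 / L * exp (- (L * (v * v) / 4)).
Proof.
  intros HL Hv. pose proof (one_minus_Ci_nz v) as Hn.
  assert (Hvv : 0 <= v * v <= 1).
  { rewrite <- Rabs_mult_self. pose proof (Rabs_pos v). nra. }
  set (X := L * (v * v)).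
  assert (HX : 0 <= X) by (unfold X; nra).
  set (z2 := (RtoC (L * v ^ 4) / (1 - Ci * v))%C).
  set (z := (- (Ci * RtoC (L * v ^ 3)) + z2)%C).
  assert (Ez : (- RtoC X / (1 - Ci * v))%C = (RtoC (- X) + z)%C).
  { unfold z, z2, X.
    transitivity ((RtoC (- (L * (v * v))) * (1 - Ci * v) - Ci * RtoC (L * v ^ 3) * (1 - Ci * v) + RtoC (L * v ^ 4)) / (1 - Ci * v))%C;
      [|field; auto].
    f_equal. apply C_eq; simpl; ring. }
  rewrite Ez, Cexp_plus, Cexp_RtoC. unfold saddle_model. fold X.
  replace (RtoC (exp (- X)) * Cexp z - RtoC (exp (- X)) * (1 - Ci * RtoC (L * v ^ 3)))%C with
    (RtoC (exp (- X)) * ((Cexp z - 1 - z) + z2))%C by (unfold z; ring).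
  assert (Hden : Cmod (1 - Ci * v) * Cmod (1 - Ci * v) = 1 + v * v).
  { rewrite Cmod_sqr. simpl. ring. }
  assert (Hden1 : 1 <= Cmod (1 - Ci * v)).
  { pose proof (Cmod_ge_0 (1 - Ci * v)). nra. }
  assert (Hz2 : Cmod z2 <= L * v ^ 4).
  { unfold z2. rewrite Cmod_div, Cmod_R by auto.
    assert (0 <= L * v ^ 4) by (replace (v ^ 4) with ((v * v) * (v * v)) by ring; apply Rmult_le_pos; [lra|apply Rmult_le_pos; lra]).
    rewrite Rabs_pos_eq by auto. unfold Rdiv. rewrite <- (Rmult_1_r (L * v ^ 4)) at 2.
    apply Rmult_le_compat_l; auto. apply Rle_trans with (/ 1); [apply Rinv_le_contravar; lra|lra]. }
  assert (HRez : Re z <= X / 2).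
  { assert (E : Re z = L * v ^ 4 / (1 + v * v)).
    { assert (E2 : z2 = (RtoC (L * v ^ 4 / (1 + v * v)) * (1 + Ci * v))%C).
      { assert (HC : RtoC (1 + v * v) <> 0%C) by (apply RtoC_nz; nra).
        unfold z2. rewrite RtoC_div by nra.
        assert (E : RtoC (1 + v * v) = ((1 - Ci * v) * (1 + Ci * v))%C) by (apply C_eq; simpl; ring).
        rewrite E in HC |- *. field. split; [|auto]. intros E3. apply HC. rewrite E3. ring. }
      unfold z. rewrite E2. simpl. field. nra. }
    rewrite E. apply (Rmult_le_reg_r (1 + v * v)); [nra|]. unfold Rdiv at 1.
    rewrite Rmult_assoc, Rinv_l by nra. unfold X.
    replace (v ^ 4) with ((v * v) * (v * v)) by ring. set (w := v * v) in *.
    assert (0 <= L * w * (1 - w)) by (apply Rmult_le_pos; [apply Rmult_le_pos; lra|lra]). nra. }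
  assert (Hz : Cmod z * Cmod z <= 4 * (X * X * X) / L).
  { assert (Hzle : Cmod z <= 2 * (L * Rabs v ^ 3)).
    { unfold z. eapply Rle_trans; [apply Cmod_triangle|]. rewrite Cmod_opp, Cmod_mult, Cmod_Ci, Cmod_R.
      rewrite Rabs_mult, <- RPow_abs, (Rabs_pos_eq L) by lra.
      assert (v ^ 4 <= Rabs v ^ 3).
      { replace (v ^ 4) with (Rabs v ^ 4) by (rewrite RPow_abs; apply Rabs_pos_eq; replace (v ^ 4) with ((v * v) * (v * v)) by ring; nra).
        simpl. pose proof (Rabs_pos v). pose proof (pow_le (Rabs v) 3 H). simpl in H0. nra. }
      nra. }
    pose proof (Cmod_ge_0 z).
    apply Rle_trans with ((2 * (L * Rabs v ^ 3)) * (2 * (L * Rabs v ^ 3))).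
    - apply Rmult_le_compat; auto.
    - right. unfold X. rewrite <- (Rabs_mult_self v). field. lra. }
  rewrite Cmod_mult, Cmod_R, Rabs_pos_eq by (left; apply exp_pos).
  assert (HT : Cmod (Cexp z - 1 - z) <= 4 * (X * X * X) / L * exp (X / 2)).
  { eapply Rle_trans; [apply Cexp_taylor2|]. apply Rmult_le_compat; auto.
    - pose proof (Cmod_ge_0 z); nra.
    - left; apply exp_pos.
    - apply exp_le, Rmax_lub; lra. }
  assert (Hz2' : Cmod z2 <= X * X / L * exp (X / 2)).
  { eapply Rle_trans; [apply Hz2|].
    replace (L * v ^ 4) with (X * X / L * 1) by (unfold X; field; lra).
    apply Rmult_le_compat_l.
    - apply Rmult_le_pos; [nra|left; apply Rinv_0_lt_compat; auto].
    - rewrite <- exp_0. apply exp_le; lra. }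
  pose proof (pow_le_exp 1 4 X ltac:(lra) HX) as P2. pose proof (pow_le_exp 2 4 X ltac:(lra) HX) as P3.
  replace (INR 2) with 2 in P2 by (simpl; ring). replace (INR 3) with 3 in P3 by (simpl; ring).
  eapply Rle_trans; [apply Rmult_le_compat_l; [left; apply exp_pos|apply Cmod_triangle]|].
  (* Here 6976 is [64 + 4 * 1728], from [X^2 <= 8^2 e^(X/4)] and [X^3 <= 12^3 e^(X/4)]. *)
  apply Rle_trans with (exp (- X) * ((6976 / L * exp (X / 4)) * exp (X / 2))).
  - apply Rmult_le_compat_l; [left; apply exp_pos|].
    apply Rle_trans with ((4 * (X * X * X) / L + X * X / L) * exp (X / 2)); [lra|].
    apply Rmult_le_compat_r; [left; apply exp_pos|].
    replace (4 * (X * X * X) / L + X * X / L) with ((4 * X ^ 3 + X ^ 2) * / L) by (simpl; field; lra).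
    replace (6976 / L * exp (X / 4)) with ((6976 * exp (X / 4)) * / L) by (field; lra).
    apply Rmult_le_compat_r; [left; apply Rinv_0_lt_compat; auto|]. lra.
  - right. rewrite Rmult_assoc, <- exp_plus.
    replace (X / 4 + X / 2) with (X + - (X / 4)) by field. rewrite exp_plus.
    replace (exp (- X) * (6976 / L * (exp X * exp (- (X / 4))))) with
      ((exp (- X) * exp X) * (6976 / L * exp (- (X / 4)))) by ring.
    rewrite <- exp_plus, Rplus_opp_l, exp_0. ring.
Qed.

Lemma saddle_model_far (L v : R) : 1 <= L -> 1 <= Rabs v ->
  Cmod (saddle_model L v) <= 65 * exp (- (L / 2)).
Proof.
  intros HL Hv. unfold saddle_model. rewrite Cmod_mult, Cmod_R, Rabs_pos_eq by (left; apply exp_pos).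
  set (X := L * (v * v)).
  assert (Hvv : 1 <= v * v).
  { rewrite <- Rabs_mult_self. nra. }
  assert (HX : L <= X) by (unfold X; nra).
  assert (Hm : Cmod (1 - Ci * RtoC (L * v ^ 3)) <= 1 + X ^ 2).
  { eapply Rle_trans; [apply Cmod_triangle_minus|]. rewrite Cmod_1, Cmod_mult, Cmod_Ci, Cmod_R.
    rewrite Rabs_mult, <- RPow_abs, (Rabs_pos_eq L), Rmult_1_l by lra. apply Rplus_le_compat_l.
    unfold X. replace ((L * (v * v)) ^ 2) with ((L * L) * (Rabs v ^ 3 * Rabs v)).
    2:{ replace (Rabs v ^ 3 * Rabs v) with ((Rabs v * Rabs v) * (Rabs v * Rabs v)) by ring.
        rewrite <- Rabs_mult, (Rabs_pos_eq (v * v)) by lra. ring. }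
    apply Rmult_le_compat; nra. }
  pose proof (pow_le_exp 1 4 X ltac:(lra) ltac:(lra)) as P2. replace (INR 2) with 2 in P2 by (simpl; ring).
  assert (He : 1 <= exp (X / 4)) by (rewrite <- exp_0; apply exp_le; lra).
  apply Rle_trans with (exp (- X) * (65 * exp (X / 4))).
  - apply Rmult_le_compat_l; [left; apply exp_pos|]. simpl pow in *. lra.
  - replace (exp (- X) * (65 * exp (X / 4))) with (65 * (exp (- X) * exp (X / 4))) by ring.
    rewrite <- exp_plus. apply Rmult_le_compat_l; [lra|]. apply exp_le. lra.
Qed.

Lemma pow_1_plus_le (u : C) m : Cmod u <= 1 -> Cmod ((1 + u) ^ m - 1) <= 2 ^ m * Cmod u.
Proof.
  intros Hu. pose proof (Cmod_ge_0 u).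
  assert (G : Cmod ((1 + u) ^ m - 1) <= (2 ^ m - 1) * Cmod u); [|nra].
  induction m as [|m IH].
  - simpl. replace (1 - 1)%C with (RtoC 0) by ring. rewrite Cmod_0. lra.
  - rewrite Cpow_S. replace ((1 + u) * (1 + u) ^ m - 1)%C with (((1 + u) ^ m - 1) * (1 + u) + u)%C by ring.
    eapply Rle_trans; [apply Cmod_triangle|]. rewrite Cmod_mult.
    assert (Cmod (1 + u) <= 2) by (eapply Rle_trans; [apply Cmod_triangle|rewrite Cmod_1; lra]).
    pose proof (Cmod_ge_0 ((1 + u) ^ m - 1)). simpl. nra.
Qed.

(** * The integrand on each arc *)

(** The factor of the terms of [alpha] that does not depend on [n]. *)
Definition arc_weight (t m h : nat) : C :=
  if Nat.eqb (Nat.gcd h t) 1 then Cexp (- INR m * PI * Ci * dedekind_sum (Z.of_nat h) t)%C else 0%C.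

(** The coefficient of [1/x] in the logarithm of the generating function near such a root. *)
Definition growth (t m : nat) : R := INR m * pole_coeff t.

Lemma pole_coeff_pos (t : nat) : (1 < t)%nat -> 0 < pole_coeff t.
Proof.
  intros Ht. assert (1 < INR t) by (apply lt_1_INR; lia). pose proof PI_RGT_0.
  unfold pole_coeff. assert (/ INR t < 1) by (rewrite <- Rinv_1; apply Rinv_lt_contravar; lra).
  apply Rdiv_lt_0_compat; [|lra]. apply Rmult_lt_0_compat; [lra|].
  apply Rdiv_lt_0_compat; [apply pow_lt; auto|lra].
Qed.

Lemma growth_pos (t m : nat) : (1 < t)%nat -> (0 < m)%nat -> 0 < growth t m.
Proof.
  intros Ht Hm. apply Rmult_lt_0_compat; [apply lt_0_INR; auto|apply pole_coeff_pos; auto].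
Qed.

Lemma Cmod_arc_weight_le t m h : Cmod (arc_weight t m h) <= 1.
Proof.
  unfold arc_weight. destruct (Nat.eqb _ _); [|rewrite Cmod_0; lra].
  rewrite Cmod_Cexp. right.
  replace (Re _) with 0; [apply exp_0|]. simpl. ring.
Qed.

(** The distance on the arc at [h] between the integrand and its model, without the factor
    [e^(- 2 pi i n h/t)]; here [N] is [n - mu], and [s = v y] is the angle. *)
Definition arc_defect (t m h : nat) (mu0 y N v : R) (F : C) : R :=
  Cmod (F ^ m * Cexp (RtoC (N + mu0) * (RtoC y - Ci * RtoC (v * y)))
    - arc_weight t m h * (RtoC (exp (2 * (growth t m / y))) * saddle_model (growth t m / y) v)).

(** The factor [(1 - e^(-y))^(-m)] is polynomial in [1/y], and the exponential gain of
    [quotient_minor_bound] pays for it with [y^3] to spare. *)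
Lemma minor_arc_estimate (t m h : nat) (mu0 : R) : (1 < t)%nat -> (0 < m)%nat -> 0 <= mu0 ->
  exists C0, 0 < C0 /\ forall y N v F, 0 < y -> INR t * y <= 1 / 2 -> N * (y * y) = growth t m ->
    Rabs (v * y) <= PI / INR t -> (1 <= Rabs v \/ Nat.gcd h t <> 1%nat) ->
    is_quotient t (arc_point t h y (v * y)) F ->
    Cmod (F ^ m * Cexp (RtoC (N + mu0) * (RtoC y - Ci * RtoC (v * y)))) <=
      C0 * exp (2 * (growth t m / y)) * y ^ 3.
Proof.
  intros Ht Hm Hmu. assert (HtR : 2 <= INR t) by (apply (le_INR 2); lia).
  assert (HmR : 1 <= INR m) by (apply (le_INR 1); lia).
  (* The gain of [quotient_minor_bound]. *)
  set (del := / (12 * INR t ^ 2)).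
  assert (Hdel : 0 < del) by (apply Rinv_0_lt_compat; nra).
  assert (Hmd : 0 < INR m * del) by nra.
  set (c := / (INR m * del)). assert (Hc : 0 < c) by (apply Rinv_0_lt_compat; auto).
  (* The powers [(1/y)^m] and [(1/y)^3] are absorbed together into the exponential. *)
  set (Cp := (INR (S (m + 2)) * c) ^ S (m + 2)).
  assert (HCp : 0 < Cp) by (apply pow_lt, Rmult_lt_0_compat; [apply INR_S_pos|auto]).
  exists (2 ^ m * Cp * exp mu0). split.
  { apply Rmult_lt_0_compat; [apply Rmult_lt_0_compat; [apply pow_lt; lra|exact HCp]|apply exp_pos]. }
  intros y N v F Hy Hty HN Hv Hcase HF.
  assert (Hy1 : y <= 1) by nra.
  assert (HFm : Cmod F <= exp ((pole_coeff t - del) / y) / (1 - exp (- y))).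
  { apply (quotient_minor_bound t h y (v * y) F); auto.
    destruct Hcase as [H|H]; [left|right; auto]. rewrite Rabs_mult, (Rabs_pos_eq y) by lra. nra. }
  assert (Hey : y / 2 <= 1 - exp (- y)).
  { pose proof (exp_neg_le_half y). lra. }
  set (x := / y). assert (Hx : 0 < x) by (apply Rinv_0_lt_compat; auto).
  assert (HF2 : Cmod F <= exp ((pole_coeff t - del) / y) * (2 * x)).
  { eapply Rle_trans; [exact HFm|]. apply Rmult_le_compat_l; [left; apply exp_pos|].
    replace (2 * x) with (/ (y / 2)) by (unfold x; field; lra). apply Rinv_le_contravar; lra. }
  rewrite Cmod_mult, Cmod_pow, Cmod_Cexp, re_scal_l.
  replace (Re (RtoC y - Ci * RtoC (v * y))) with y by (simpl; ring).
  assert (E1 : exp ((N + mu0) * y) <= exp (growth t m / y) * exp mu0).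
  { rewrite <- exp_plus. apply exp_le.
    replace (growth t m / y) with (N * y) by (rewrite <- HN; field; lra). nra. }
  assert (E2 : Cmod F ^ m <= exp (growth t m / y) * exp (- (x / c)) * (2 ^ m * x ^ m)).
  { eapply Rle_trans; [apply pow_incr; split; [apply Cmod_ge_0|exact HF2]|].
    right. rewrite !Rpow_mult_distr, exp_pow, <- exp_plus. f_equal. f_equal.
    unfold growth, x, c. field. lra. }
  pose proof (pow_le_exp (m + 2) c x Hc ltac:(lra)) as E3. fold Cp in E3.
  assert (E4 : exp (- (x / c)) * exp (x / c) = 1) by (rewrite Rmult_comm; apply exp_mult_opp).
  assert (E5 : x ^ S (m + 2) * y ^ 3 = x ^ m).
  { replace (S (m + 2)) with (m + 3)%nat by lia. rewrite pow_add.
    replace (x ^ m * x ^ 3 * y ^ 3) with (x ^ m * (x * y) ^ 3) by ring.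
    unfold x at 2. rewrite Rinv_l by lra. ring. }
  apply Rle_trans with ((exp (growth t m / y) * exp (- (x / c)) * (2 ^ m * x ^ m)) * (exp (growth t m / y) * exp mu0)).
  { apply Rmult_le_compat; auto; [apply pow_le, Cmod_ge_0|left; apply exp_pos]. }
  rewrite <- E5. replace (2 * (growth t m / y)) with (growth t m / y + growth t m / y) by ring.
  rewrite exp_plus. set (G := exp (growth t m / y)) in *.
  replace (G * exp (- (x / c)) * (2 ^ m * (x ^ S (m + 2) * y ^ 3)) * (G * exp mu0)) with
    ((G * G * 2 ^ m * exp mu0 * y ^ 3) * (exp (- (x / c)) * x ^ S (m + 2))) by ring.
  replace (2 ^ m * Cp * exp mu0 * (G * G) * y ^ 3) with
    ((G * G * 2 ^ m * exp mu0 * y ^ 3) * Cp) by ring.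
  apply Rmult_le_compat_l.
  - assert (0 < G) by apply exp_pos. assert (0 < exp mu0) by apply exp_pos.
    assert (0 < 2 ^ m) by (apply pow_lt; lra).
    left. repeat apply Rmult_lt_0_compat; auto; lra.
  - apply Rle_trans with (exp (- (x / c)) * (Cp * exp (x / c))).
    + apply Rmult_le_compat_l; [left; apply exp_pos|exact E3].
    + right. transitivity (Cp * (exp (- (x / c)) * exp (x / c))); [ring|]. rewrite E4; ring.
Qed.

(** With [x = y (1 - i v)] and [N y^2 = a] the exponent [a/x + N x] is [L (2 - v^2/(1 - i v))].
    The factors [(1 + u)^m] and [e^(mu x)] differ from 1 by [O(y)]. *)
Lemma major_arc_estimate (t m h : nat) (mu0 : R) : (1 < t)%nat -> (0 < m)%nat -> 0 <= mu0 ->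
  Nat.gcd h t = 1%nat ->
  exists C0, 0 < C0 /\ forall y N v F, 0 < y -> INR t * y <= 1 / 2 -> C0 * y <= 1 ->
    N * (y * y) = growth t m -> Rabs v <= 1 ->
    is_quotient t (arc_point t h y (v * y)) F ->
    arc_defect t m h mu0 y N v F <= C0 * exp (2 * (growth t m / y)) * (y * exp (- (growth t m / y * (v * v) / 4))).
Proof.
  intros Ht Hm Hmu Hg. pose proof (growth_pos t m Ht Hm) as Ha.
  assert (HtR : 2 <= INR t) by (apply (le_INR 2); lia).
  destruct (quotient_near_root t (root h t) (PI ^ 2 / 6) Ht) as [C1 [HC1 Hq]].
  { unfold root; apply Cmod_cis. }
  { apply root_pow_t; lia. }
  { intros n Hn. apply root_primitive; auto. }
  { apply basel. }
  rewrite dedekind_constant in Hq by auto. fold (pole_coeff t) in Hq.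
  set (a := growth t m) in *.
  set (Cw := 2 ^ m * (2 * C1) * exp mu0 + 2 * mu0 * exp (2 * mu0)).
  assert (H2m : 0 < 2 ^ m) by (apply pow_lt; lra).
  assert (HCw : 0 <= Cw).
  { unfold Cw. pose proof (exp_pos mu0). pose proof (exp_pos (2 * mu0)).
    apply Rplus_le_le_0_compat; repeat apply Rmult_le_pos; lra. }
  assert (Hia : 0 < 6976 / a) by (apply Rdiv_lt_0_compat; lra).
  exists (2 * C1 + Cw + 6976 / a). split; [lra|].
  intros y N v F Hy Hty HCy HN Hv HF. unfold arc_defect. fold a.
  set (x := (RtoC y - Ci * RtoC (v * y))%C) in *.
  set (L := a / y). assert (HL : 0 < L) by (apply Rdiv_lt_0_compat; auto).
  assert (Hxr : Re x = y) by (unfold x; simpl; ring).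
  assert (Hxi : Im x = - (v * y)) by (unfold x; simpl; ring).
  assert (HxI : Rabs (Im x) <= Re x).
  { rewrite Hxi, Hxr, Rabs_Ropp, Rabs_mult, (Rabs_pos_eq y) by lra. nra. }
  assert (Hx2 : Cmod x <= 2 * y).
  { eapply Rle_trans; [apply Cmod_le_abs|]. rewrite Hxr in *. rewrite (Rabs_pos_eq y) by lra. lra. }
  pose proof (Cmod_ge_0 x) as Hx0.
  set (T := (RtoC (pole_coeff t) / x + - PI * Ci * dedekind_sum (Z.of_nat h) t)%C).
  assert (Hu : Cmod (F * Cexp (- T) - 1) <= C1 * Cmod x).
  { apply Hq; auto. rewrite Hxr. nra. }
  set (u := (F * Cexp (- T) - 1)%C) in *.
  assert (HF1 : F = (Cexp T * (1 + u))%C).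
  { unfold u. rewrite Cexp_opp. field. apply Cexp_nz. }
  assert (Hu1 : Cmod u <= 2 * C1 * y) by nra.
  assert (Hu2 : Cmod u <= 1) by nra.
  pose proof (one_minus_Ci_nz v) as Hvnz.
  set (P := Cexp (- RtoC (L * (v * v)) / (1 - Ci * v))).
  set (w := ((1 + u) ^ m * Cexp (mu0 * x) - 1)%C).
  assert (Hyc : RtoC y <> 0%C) by (apply RtoC_nz; lra).
  assert (EF : (F ^ m * Cexp (RtoC (N + mu0) * x))%C =
    (arc_weight t m h * (RtoC (exp (2 * L)) * (P * (1 + w))))%C).
  { rewrite HF1, Cpow_mult_l, Cexp_pow. unfold w, arc_weight. rewrite Hg, Nat.eqb_refl.
    replace (1 + ((1 + u) ^ m * Cexp (mu0 * x) - 1))%C with ((1 + u) ^ m * Cexp (mu0 * x))%C by ring.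
    assert (E : (Cexp (INR m * T) * Cexp (RtoC (N + mu0) * x))%C =
      (Cexp (- INR m * PI * Ci * dedekind_sum (Z.of_nat h) t) * (RtoC (exp (2 * L)) * P) * Cexp (mu0 * x))%C).
    { rewrite <- Cexp_RtoC. unfold P. rewrite <- !Cexp_plus. f_equal.
      assert (Ex : x = (y * (1 - Ci * v))%C) by (unfold x; rewrite RtoC_mult; ring).
      assert (EN : RtoC N = (RtoC a / (y * y))%C).
      { rewrite <- HN, !RtoC_mult. field. auto. }
      assert (Ea : RtoC a = (RtoC (INR m) * RtoC (pole_coeff t))%C) by apply RtoC_mult.
      unfold T, L. rewrite RtoC_plus, EN, !RtoC_mult, RtoC_div, Ea by lra. rewrite Ex.
      assert (ECi : (Ci * Ci)%C = (- (1))%C) by (apply C_eq; simpl; ring).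
      transitivity (- INR m * PI * Ci * dedekind_sum (Z.of_nat h) t + mu0 * (y * (1 - Ci * v)) +
        INR m * pole_coeff t / y * ((1 + (1 - Ci * v) * (1 - Ci * v)) / (1 - Ci * v)))%C; [field; auto|].
      replace (1 + (1 - Ci * v) * (1 - Ci * v))%C with (2 * (1 - Ci * v) - v * v)%C.
      2:{ transitivity (2 - 2 * Ci * v + (Ci * Ci) * (v * v))%C; [rewrite ECi|]; ring. }
      field. auto. }
    transitivity ((Cexp (INR m * T) * Cexp (RtoC (N + mu0) * x)) * (1 + u) ^ m)%C; [ring|].
    rewrite E. ring. }
  rewrite EF.
  replace (arc_weight t m h * (RtoC (exp (2 * L)) * (P * (1 + w))) - arc_weight t m h * (RtoC (exp (2 * L)) * saddle_model L v))%C
    with (arc_weight t m h * (RtoC (exp (2 * L)) * (P * w + (P - saddle_model L v))))%C by ring.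
  rewrite !Cmod_mult, Cmod_R, Rabs_pos_eq by (left; apply exp_pos).
  assert (Hvv : 0 <= v * v <= 1).
  { rewrite <- Rabs_mult_self. pose proof (Rabs_pos v). nra. }
  assert (HP : Cmod P <= exp (- (L * (v * v) / 4))).
  { unfold P. rewrite Cmod_Cexp. apply exp_le.
    assert (E : Re (- RtoC (L * (v * v)) / (1 - Ci * v)) = - (L * (v * v) / (1 + v * v))).
    { simpl. field. nra. }
    rewrite E. apply Ropp_le_contravar. apply Rmult_le_compat_l; [nra|]. apply Rinv_le_contravar; lra. }
  assert (Hw : Cmod w <= Cw * y).
  { unfold w. replace ((1 + u) ^ m * Cexp (mu0 * x) - 1)%C with
      (((1 + u) ^ m - 1) * Cexp (mu0 * x) + (Cexp (mu0 * x) - 1))%C by ring.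
    eapply Rle_trans; [apply Cmod_triangle|]. rewrite Cmod_mult.
    pose proof (pow_1_plus_le u m Hu2) as B1.
    assert (B2 : Cmod (Cexp (mu0 * x)) <= exp mu0).
    { rewrite Cmod_Cexp, re_scal_l, Hxr. apply exp_le. nra. }
    assert (B3 : Cmod (Cexp (mu0 * x) - 1) <= mu0 * (2 * y) * exp (2 * mu0)).
    { eapply Rle_trans; [apply Cexp_minus_1_gen|]. rewrite Cmod_mult, Cmod_R, (Rabs_pos_eq mu0) by lra.
      assert (mu0 * Cmod x <= mu0 * (2 * y)) by nra.
      apply Rmult_le_compat; auto; [nra|left; apply exp_pos|]. apply exp_le. nra. }
    assert (B4 : Cmod ((1 + u) ^ m - 1) * Cmod (Cexp (mu0 * x)) <= (2 ^ m * (2 * C1 * y)) * exp mu0).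
    { apply Rmult_le_compat; try apply Cmod_ge_0; auto. eapply Rle_trans; [exact B1|]. nra. }
    unfold Cw. lra. }
  pose proof (saddle_expansion L v HL Hv) as HS. fold P in HS.
  assert (HLy : 6976 / L = 6976 / a * y) by (unfold L; field; lra).
  rewrite HLy in HS. set (g := exp (- (L * (v * v) / 4))) in *. assert (Hg0 : 0 < g) by apply exp_pos.
  assert (HSum : Cmod (P * w + (P - saddle_model L v)) <= (2 * C1 + Cw + 6976 / a) * (y * g)).
  { eapply Rle_trans; [apply Cmod_triangle|]. rewrite Cmod_mult.
    assert (Cmod P * Cmod w <= g * (Cw * y)) by (apply Rmult_le_compat; auto; apply Cmod_ge_0).
    assert (0 <= C1 * (y * g)) by (apply Rmult_le_pos; [lra|nra]). nra. }
  pose proof (Cmod_arc_weight_le t m h) as HW.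
  pose proof (Cmod_ge_0 (P * w + (P - saddle_model L v))) as HS0.
  pose proof (exp_pos (2 * L)) as HE.
  set (Q := Cmod (P * w + (P - saddle_model L v))) in *.
  assert (0 <= exp (2 * L) * Q) by nra. nra.
Qed.

(** A single bound for the whole arc: the Gaussian part integrates to [y^(5/2)], like the
    main term times [y], and [y^3] is negligible against it. *)
Definition arc_bound (t m h : nat) (mu0 C0 : R) : Prop :=
  forall y N v F, 0 < y -> C0 * y <= 1 ->
    N * (y * y) = growth t m -> Rabs (v * y) <= PI / INR t ->
    is_quotient t (arc_point t h y (v * y)) F ->
    arc_defect t m h mu0 y N v F <=
      C0 * exp (2 * (growth t m / y)) * (y * exp (- (growth t m / y * (v * v) / 4)) + y ^ 3).

Lemma arc_estimate (t m h : nat) (mu0 : R) : (1 < t)%nat -> (0 < m)%nat -> 0 <= mu0 ->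
  exists C0, 0 < C0 /\ arc_bound t m h mu0 C0.
Proof.
  intros Ht Hm Hmu. pose proof (growth_pos t m Ht Hm) as Ha.
  assert (HtR : 2 <= INR t) by (apply (le_INR 2); lia).
  destruct (minor_arc_estimate t m h mu0 Ht Hm Hmu) as [Cn [HCn Hminor]].
  assert (HMaj : exists Cj, 0 < Cj /\ (Nat.gcd h t = 1%nat -> forall y N v F, 0 < y -> INR t * y <= 1 / 2 -> Cj * y <= 1 ->
    N * (y * y) = growth t m -> Rabs v <= 1 ->
    is_quotient t (arc_point t h y (v * y)) F ->
    arc_defect t m h mu0 y N v F <= Cj * exp (2 * (growth t m / y)) * (y * exp (- (growth t m / y * (v * v) / 4))))).
  { destruct (Nat.eq_dec (Nat.gcd h t) 1) as [Hg|Hg].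
    - destruct (major_arc_estimate t m h mu0 Ht Hm Hmu Hg) as [Cj [H1 H2]]. exists Cj. split; auto.
    - exists 1. split; [lra|]. intros; contradiction. }
  destruct HMaj as [Cj [HCj Hmajor]]. unfold arc_bound, arc_defect in *.
  set (a := growth t m) in *. set (Cf := 65 * (27 * 8 / a ^ 3)).
  assert (HCf : 0 < Cf).
  { unfold Cf. apply Rmult_lt_0_compat; [lra|]. apply Rdiv_lt_0_compat; [lra|apply pow_lt; auto]. }
  assert (Hia : 0 < / a) by (apply Rinv_0_lt_compat; auto).
  exists (Cn + Cj + Cf + 2 * INR t + / a). split; [lra|].
  intros y N v F Hy HC0 HN Hv HF.
  assert (Hty : INR t * y <= 1 / 2) by nra.
  assert (Hya : y <= a).
  { assert (/ a * y <= 1) by nra. apply (Rmult_le_compat_l a) in H; [|lra].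
    rewrite <- Rmult_assoc, Rinv_r in H; lra. }
  pose proof (exp_pos (2 * (a / y))) as HE. pose proof (exp_pos (- (a / y * (v * v) / 4))) as Hg0.
  assert (Hy3 : 0 < y ^ 3) by (apply pow_lt; auto).
  set (E := exp (2 * (a / y))) in *. set (g := exp (- (a / y * (v * v) / 4))) in *.
  assert (HEy : 0 < E * y ^ 3) by nra. assert (HEg : 0 < E * (y * g)) by nra.
  assert (Hpos : forall z, 0 <= z <= (Cn + Cf) * (E * y ^ 3) + Cj * (E * (y * g)) ->
    z <= (Cn + Cj + Cf + 2 * INR t + / a) * E * (y * g + y ^ 3)).
  { intros z Hz.
    assert (0 <= (Cj + 2 * INR t + / a) * (E * y ^ 3)) by (apply Rmult_le_pos; lra).
    assert (0 <= (Cn + Cf + 2 * INR t + / a) * (E * (y * g))) by (apply Rmult_le_pos; lra). lra. }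
  apply Hpos. split; [apply Cmod_ge_0|].
  assert (0 <= Cj * (E * (y * g))) by nra.
  assert (0 <= Cn * (E * y ^ 3)) by nra. assert (0 <= Cf * (E * y ^ 3)) by nra.
  destruct (Nat.eq_dec (Nat.gcd h t) 1) as [Hg|Hg].
  - destruct (Rle_dec (Rabs v) 1) as [Hv1|Hv1].
    + pose proof (Hmajor Hg y N v F Hy Hty ltac:(nra) HN Hv1 HF) as G. fold E g in G. lra.
    + eapply Rle_trans; [apply Cmod_triangle_minus|].
      pose proof (Hminor y N v F Hy Hty HN Hv ltac:(left; lra) HF) as G. fold E in G.
      assert (HL : 1 <= a / y).
      { apply (Rmult_le_reg_r y); auto. unfold Rdiv. rewrite Rmult_assoc, Rinv_l; lra. }
      pose proof (saddle_model_far (a / y) v HL ltac:(lra)) as G2.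
      pose proof (exp_neg_le_cube (a / y / 2) ltac:(lra)) as G3.
      assert (G4 : 65 * exp (- (a / y / 2)) <= Cf * y ^ 3).
      { unfold Cf. replace (65 * (27 * 8 / a ^ 3) * y ^ 3) with (65 * (27 / (a / y / 2) ^ 3)) by (field; lra). lra. }
      rewrite !Cmod_mult, Cmod_R, Rabs_pos_eq by lra.
      pose proof (Cmod_arc_weight_le t m h) as HW. pose proof (Cmod_ge_0 (arc_weight t m h)) as HW0.
      rewrite Cmod_mult in G. fold a. fold E.
      assert (G5 : E * Cmod (saddle_model (a / y) v) <= E * (Cf * y ^ 3)) by (apply Rmult_le_compat_l; lra).
      assert (G7 : Cmod (arc_weight t m h) * (E * Cmod (saddle_model (a / y) v)) <= E * (Cf * y ^ 3)) by nra.
      lra.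
  - replace (arc_weight t m h) with (RtoC 0).
    2:{ unfold arc_weight. destruct (Nat.eqb_spec (Nat.gcd h t) 1); [contradiction|reflexivity]. }
    rewrite Cmult_0_l. eapply Rle_trans; [apply Cmod_triangle_minus|]. rewrite Cmod_0.
    pose proof (Hminor y N v F Hy Hty HN Hv (or_intror Hg) HF) as G. fold E in G. lra.
Qed.

(** * The asymptotic formula *)

Lemma is_RInt_odd_cubic (k V : R) : 0 < k ->
  is_RInt (fun s => exp (- (k * (s * s))) * s ^ 3) (- V) V 0.
Proof.
  intros Hk.
  set (P := fun s => - ((s * s + / k) * exp (- (k * (s * s))) / (2 * k))).
  assert (E : minus (P V) (P (- V)) = 0).
  { unfold P. replace (- V * - V) with (V * V) by ring. apply (minus_eq_zero (G := R_AbelianGroup)). }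
  rewrite <- E.
  apply (@is_RInt_derive R_CompleteNormedModule P).
  - intros s _. unfold P. auto_derive; auto. field. lra.
  - intros s _. apply continuous_of_ex_derive. auto_derive; auto.
Qed.

Lemma saddle_model_integral (L y V : R) : 0 < L -> 0 < y -> 0 <= V ->
  exists I0, is_CInt (fun s => saddle_model L (s / y)) (- V) V (RtoC I0) /\
    sqrt (PI / (L / (y * y))) - 4 / sqrt (L / (y * y)) * exp (- (L / (y * y) * (V * V))) <= I0
      <= sqrt (PI / (L / (y * y))).
Proof.
  intros HL Hy HV. set (k := L / (y * y)).
  assert (Hk : 0 < k) by (apply Rdiv_lt_0_compat; nra).
  destruct (gauss_interval k V Hk HV) as [I0 [HI HB]].
  exists I0. split; [|exact HB].
  assert (E : forall s, L * (s / y * (s / y)) = k * (s * s)) by (intros; unfold k; field; lra).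
  split.
  - apply is_RInt_ext with (2 := HI). intros s _. unfold saddle_model. rewrite E. simpl. ring.
  - apply is_RInt_ext with (fun s => scal (- (L / y ^ 3)) (exp (- (k * (s * s))) * s ^ 3)).
    + intros s _. unfold saddle_model. rewrite E. unfold scal; simpl; unfold mult; simpl.
      field. lra.
    + evar_last; [apply (@is_RInt_scal R_NormedModule), is_RInt_odd_cubic; auto|].
      unfold scal; simpl; unfold mult; simpl. apply Rmult_0_r.
Qed.

Lemma alpha_eq (t m n : nat) : (0 < t)%nat ->
  alpha t m n = csum (fun h => cis (- (INR n * (2 * PI * (INR h / INR t)))) * arc_weight t m h)%C t.
Proof.
  intros Ht. assert (HtR : INR t <> 0) by (apply not_0_INR; lia).
  assert (HtC : RtoC (INR t) <> 0%C) by (apply RtoC_nz; auto).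
  unfold alpha.
  assert (HS : forall (f : nat -> C) k, sum_n f k = csum f (S k)).
  { intros f k. induction k as [|k IH].
    - rewrite sum_O. simpl. rewrite Cplus_0_l. reflexivity.
    - rewrite sum_Sn, IH. reflexivity. }
  rewrite HS. replace (S (t - 1)) with t by lia. apply csum_ext. intros h _.
  unfold arc_weight. destruct (Nat.eqb _ _); [|ring].
  unfold cis. rewrite <- Cexp_plus. f_equal.
  rewrite RtoC_opp, !RtoC_mult, RtoC_div by auto. field. auto.
Qed.

Lemma Cmod_alpha_le (t m n : nat) : (0 < t)%nat -> Cmod (alpha t m n) <= INR t.
Proof.
  intros Ht. rewrite alpha_eq by auto. eapply Rle_trans; [apply Cmod_csum|].
  apply Rle_trans with (rsum (fun _ => 1) t); [|rewrite rsum_const; lra].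
  apply rsum_le. intros h _. rewrite Cmod_mult, Cmod_cis, Rmult_1_l. apply Cmod_arc_weight_le.
Qed.

Lemma mu_nonneg (t m : nat) : (0 < t)%nat -> 0 <= mu t m.
Proof.
  intros Ht. unfold mu. assert (1 <= INR t) by (apply (le_INR 1); lia).
  pose proof (pos_INR m). nra.
Qed.

Lemma growth_mu (t m : nat) : (0 < t)%nat -> growth t m = 4 * PI ^ 2 * mu t m / INR t ^ 2.
Proof.
  intros Ht. assert (INR t <> 0) by (apply not_0_INR; lia).
  unfold growth, pole_coeff, mu. field. auto.
Qed.

(** In terms of the saddle point [y] the main factor is the Gaussian integral of the model,
    divided by [2 pi]. *)
Lemma main_factor_eq (t m n : nat) (y : R) : (1 < t)%nat -> (0 < m)%nat ->
  0 < INR n - mu t m -> 0 < y -> (INR n - mu t m) * (y * y) = growth t m ->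
  main_factor t m n = exp (2 * (growth t m / y)) * sqrt (PI / (growth t m / y / (y * y))) / (2 * PI).
Proof.
  intros Ht Hm HN Hy HNy. pose proof PI_RGT_0 as HP. pose proof (growth_pos t m Ht Hm) as Ha.
  assert (HtR : 1 < INR t) by (apply lt_1_INR; lia).
  assert (Hg := growth_mu t m ltac:(lia)).
  set (N := INR n - mu t m) in *. set (a := growth t m) in *.
  assert (Hmu : mu t m = a * INR t ^ 2 / (4 * PI ^ 2)) by (rewrite Hg; field; lra).
  assert (Hmu0 : 0 < mu t m).
  { rewrite Hmu. apply Rdiv_lt_0_compat; [apply Rmult_lt_0_compat; [auto|apply pow_lt; lra]|].
    apply Rmult_lt_0_compat; [lra|apply pow_lt; auto]. }
  unfold main_factor. fold N.
  assert (E1 : sqrt (mu t m * N) = a * INR t / (2 * PI * y)).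
  { replace (mu t m * N) with ((a * INR t / (2 * PI * y)) * (a * INR t / (2 * PI * y))).
    - apply sqrt_square. apply Rmult_le_pos; [nra|left; apply Rinv_0_lt_compat; nra].
    - rewrite Hmu. replace N with (a / (y * y)) by (rewrite <- HNy; field; lra). field. lra. }
  rewrite E1. replace (4 * PI * (a * INR t / (2 * PI * y)) / INR t) with (2 * (a / y)) by (field; lra).
  set (X := exp (2 * (a / y))).
  assert (HRp : 0 < Rpower N (3 / 4)) by apply exp_pos.
  assert (Hs2t : 0 < sqrt (2 * INR t)) by (apply sqrt_lt_R0; lra).
  assert (Hk : 0 < PI / (a / y / (y * y))).
  { apply Rdiv_lt_0_compat; auto. repeat apply Rdiv_lt_0_compat; nra. }
  assert (Hsk : 0 < sqrt (PI / (a / y / (y * y)))) by (apply sqrt_lt_R0; auto).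
  assert (HR2 : Rpower N (3 / 4) * Rpower N (3 / 4) = N * sqrt N).
  { rewrite <- Rpower_plus. replace (3 / 4 + 3 / 4) with (1 + / 2) by field.
    rewrite Rpower_plus, Rpower_1, Rpower_sqrt; auto. }
  assert (HsN : 0 < sqrt N) by (apply sqrt_lt_R0; auto). pose proof (sqrt_sqrt N ltac:(lra)) as HsNN.
  assert (EsM : sqrt (mu t m) = a * INR t / (2 * PI * y) / sqrt N).
  { rewrite <- E1, sqrt_mult by lra. field. lra. }
  set (S := sqrt (sqrt (mu t m)) / sqrt (2 * INR t) / Rpower N (3 / 4)).
  assert (HsM : 0 < sqrt (mu t m)) by (apply sqrt_lt_R0; auto).
  assert (HS0 : 0 < S).
  { unfold S. repeat apply Rdiv_lt_0_compat; auto. apply sqrt_lt_R0; auto. }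
  assert (HS : S = sqrt (PI / (a / y / (y * y))) / (2 * PI)).
  { apply Rsqr_inj; [lra|left; apply Rdiv_lt_0_compat; lra|]. unfold Rsqr.
    replace (sqrt (PI / (a / y / (y * y))) / (2 * PI) * (sqrt (PI / (a / y / (y * y))) / (2 * PI))) with
      ((sqrt (PI / (a / y / (y * y))) * sqrt (PI / (a / y / (y * y)))) / (4 * PI ^ 2)) by (field; lra).
    rewrite sqrt_sqrt by lra. unfold S.
    replace (sqrt (sqrt (mu t m)) / sqrt (2 * INR t) / Rpower N (3 / 4) * (sqrt (sqrt (mu t m)) / sqrt (2 * INR t) / Rpower N (3 / 4)))
      with ((sqrt (sqrt (mu t m)) * sqrt (sqrt (mu t m))) / (sqrt (2 * INR t) * sqrt (2 * INR t)) / (Rpower N (3 / 4) * Rpower N (3 / 4)))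
      by (field; lra).
    rewrite !sqrt_sqrt, HR2, EsM by lra.
    replace (a * INR t / (2 * PI * y) / sqrt N / (2 * INR t) / (N * sqrt N)) with
      (a / (4 * PI * y) / (N * (sqrt N * sqrt N))) by (field; lra).
    rewrite HsNN. replace N with (a / (y * y)) by (rewrite <- HNy; field; lra). field. lra. }
  replace (sqrt (sqrt (mu t m)) / sqrt (2 * INR t) * (X / Rpower N (3 / 4))) with (X * S) by (unfold S; field; lra).
  rewrite HS. unfold Rdiv; ring.
Qed.

Lemma exp_neg_le_inv (u : R) : 0 < u -> exp (- u) <= / u.
Proof.
  intros Hu. rewrite exp_Ropp. apply Rinv_le_contravar; auto.
  pose proof (exp_ineq1_le u); lra.
Qed.

Definition ct_series (t m : nat) (q : C) : C :=
  (qpoch_inf q q ^ m / qpoch_inf (q ^ t) (q ^ t) ^ m)%C.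

(** By [circle_method] the coefficient is [e^(2 L) I0 alpha/(2 pi)] up to the integral of
    [arc_bound], where [I0] is the integral of [saddle_model] over the arc. *)
Lemma coefficient_estimate (t m : nat) (c : nat -> Z) : (1 < t)%nat -> (0 < m)%nat ->
  is_ct_coeffs t m c ->
  exists K C0, 0 < C0 /\ forall n y, 0 < y -> C0 * y <= 1 -> 0 < INR n - mu t m ->
    (INR n - mu t m) * (y * y) = growth t m ->
    0 < main_factor t m n /\
    Cmod (RtoC (IZR (c n)) / RtoC (main_factor t m n) - alpha t m n) <= K * y.
Proof.
  intros Ht Hm Hc. pose proof (growth_pos t m Ht Hm) as Ha. pose proof PI_RGT_0 as HP.
  assert (HtR : 2 <= INR t) by (apply (le_INR 2); lia).
  assert (Hmu : 0 <= mu t m) by (apply mu_nonneg; lia).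
  destruct (uniform_const (fun h C0 => arc_bound t m h (mu t m) C0) t) as [C0 [HC0 Harc]].
  { intros h C C' HCC H y N v F Hy HCy HN Hv HF.
    eapply Rle_trans; [apply H; auto; nra|].
    pose proof (exp_pos (2 * (growth t m / y))). pose proof (exp_pos (- (growth t m / y * (v * v) / 4))).
    apply Rmult_le_compat_r; [nra|]. nra. }
  { intros h _. destruct (arc_estimate t m h (mu t m) Ht Hm Hmu) as [C1 [_ H1]]. exists C1; exact H1. }
  set (a := growth t m) in *.
  set (kV := a * (PI / INR t * (PI / INR t))).
  assert (HPt : 0 < PI / INR t) by (apply Rdiv_lt_0_compat; lra).
  assert (HkV : 0 < kV) by (apply Rmult_lt_0_compat; nra).
  exists (4 / kV * INR t + 2 * INR t * C0 * (2 + 2 * (PI / INR t) * sqrt (a / PI))), (C0 + 1).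
  split; [lra|].
  intros n y Hy HCy HN HNy. set (N := INR n - mu t m) in *.
  assert (HCy0 : C0 * y <= 1) by nra.
  rewrite (main_factor_eq t m n y Ht Hm HN Hy HNy). fold a.
  set (L := a / y). assert (HL : 0 < L) by (apply Rdiv_lt_0_compat; auto).
  set (X := exp (2 * L)). assert (HX : 0 < X) by apply exp_pos.
  set (k := L / (y * y)). assert (Hk : 0 < k) by (apply Rdiv_lt_0_compat; nra).
  set (G := sqrt (PI / k)). assert (HG : 0 < G) by (apply sqrt_lt_R0, Rdiv_lt_0_compat; auto).
  set (Mn := X * G / (2 * PI)).
  assert (HM : 0 < Mn) by (apply Rdiv_lt_0_compat; nra).
  split; [exact HM|].
  set (V := PI / INR t) in *.
  destruct (saddle_model_integral L y V HL Hy ltac:(lra)) as [I0 [HI0 HB0]]. fold k G in HB0.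
  destruct (gauss_interval (k / 4) V ltac:(lra) ltac:(lra)) as [I4 [HI4 HB4]].
  set (r := exp (- y)).
  assert (Hr : 0 < r < 1) by (split; [apply exp_pos|apply exp_neg_lt_1; auto]).
  set (e := fun h => cis (- (INR n * (2 * PI * (INR h / INR t))))).
  pose proof (circle_method (fun k => RtoC (IZR (c k))) (ct_series t m) r n t
    (fun h s => e h * arc_weight t m h * RtoC X * saddle_model L (s / y))%C
    (fun h => e h * arc_weight t m h * RtoC X * RtoC I0)%C
    (fun s => C0 * X * (y * exp (- (k / 4 * (s * s))) + y ^ 3))
    (C0 * X * (y * I4 + y ^ 3 * (2 * V)))) as CM.
  assert (HCM : Cmod (2 * PI * RtoC (IZR (c n)) - csum (fun h => e h * arc_weight t m h * RtoC X * RtoC I0)%C t)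
    <= 2 * INR t * (C0 * X * (y * I4 + y ^ 3 * (2 * V)))).
  { apply CM; clear CM; auto.
    - intros q Hq. apply pseries_Clim, (Hc q Hq).
    - lia.
    - intros h _. apply is_CInt_scal. exact HI0.
    - apply is_RInt_ext with (fun s => scal (C0 * X) (plus (scal y (exp (- (k / 4 * (s * s))))) (y ^ 3))).
      { intros s _. reflexivity. }
      evar_last.
      + apply (@is_RInt_scal R_NormedModule), (@is_RInt_plus R_NormedModule).
        * apply (@is_RInt_scal R_NormedModule). exact HI4.
        * apply (@is_RInt_const R_NormedModule).
      + unfold scal, plus; simpl; unfold mult; simpl. fold V. ring.
    - intros h s Hh Hs.
      assert (Hsy : s / y * y = s) by (field; lra).
      assert (Eq : (RtoC r * cis (2 * PI * (INR h / INR t) + s))%C = arc_point t h y (s / y * y)).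
      { rewrite Hsy, cis_plus. unfold arc_point, root, r. rewrite <- Cexp_RtoC.
        replace (- (RtoC y - Ci * RtoC s))%C with (RtoC (- y) + Ci * s)%C by (rewrite RtoC_opp; ring).
        rewrite Cexp_plus. unfold cis. ring. }
      set (q := (RtoC r * cis (2 * PI * (INR h / INR t) + s))%C) in *.
      assert (Hqm : Cmod q < 1).
      { unfold q. rewrite Cmod_mult, Cmod_cis, Cmod_R, Rabs_pos_eq by lra. lra. }
      destruct (eta_quotient_limit t m q ltac:(lia) Hqm) as [F [EF HF]].
      unfold ct_series. rewrite EF. rewrite Eq in HF.
      pose proof (Harc h Hh y N (s / y) F Hy HCy0 HNy) as G1.
      assert (HsV : Rabs (s / y * y) <= V) by (rewrite Hsy; fold V in Hs; apply Rabs_le; lra).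
      specialize (G1 HsV HF). unfold arc_defect in G1. fold a in G1.
      replace (RtoC (/ r ^ n) * cis (- (INR n * (2 * PI * (INR h / INR t) + s))))%C with
        (e h * Cexp (RtoC (N + mu t m) * (RtoC y - Ci * RtoC (s / y * y))))%C.
      2:{ rewrite Hsy. unfold e, r. rewrite exp_pow, <- exp_Ropp, <- Cexp_RtoC.
          replace (- (INR n * (2 * PI * (INR h / INR t) + s))) with
            (- (INR n * (2 * PI * (INR h / INR t))) + - (INR n * s)) by ring.
          rewrite cis_plus. unfold cis. rewrite <- !Cexp_plus. f_equal.
          replace (N + mu t m) with (INR n) by (unfold N; ring).
          replace (- (INR n * - y)) with (INR n * y) by ring.
          rewrite (RtoC_opp (INR n * s)), (RtoC_mult (INR n) s), (RtoC_mult (INR n) y). ring. }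
      replace (F ^ m * (e h * Cexp (RtoC (N + mu t m) * (RtoC y - Ci * RtoC (s / y * y)))) -
        e h * arc_weight t m h * X * saddle_model L (s / y))%C with
        (e h * (F ^ m * Cexp (RtoC (N + mu t m) * (RtoC y - Ci * RtoC (s / y * y))) -
        arc_weight t m h * (X * saddle_model L (s / y))))%C by ring.
      rewrite Cmod_mult. unfold e at 1. rewrite Cmod_cis, Rmult_1_l.
      eapply Rle_trans; [exact G1|]. right. fold L X. do 4 f_equal. unfold k. field. lra. }
  clear CM.
  assert (Esum : csum (fun h => e h * arc_weight t m h * RtoC X * RtoC I0)%C t = (RtoC (X * I0) * alpha t m n)%C).
  { rewrite alpha_eq by lia. rewrite <- csum_scal. apply csum_ext. intros h _. rewrite RtoC_mult. unfold e. ring. }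
  rewrite Esum in HCM.
  assert (HPC : RtoC PI <> 0%C) by (apply RtoC_nz; lra).
  set (cn := RtoC (IZR (c n))) in *. set (al := alpha t m n) in *.
  assert (Edec : (cn / RtoC Mn - al)%C = ((2 * PI * cn - RtoC (X * I0) * al) * RtoC (/ (X * G)) + RtoC (I0 / G - 1) * al)%C).
  { assert (HXC : RtoC X <> 0%C) by (apply RtoC_nz; lra).
    assert (HGC : RtoC G <> 0%C) by (apply RtoC_nz; lra).
    unfold Mn. rewrite RtoC_minus, !RtoC_div, RtoC_inv, !RtoC_mult by nra.
    field. auto. }
  rewrite Edec. eapply Rle_trans; [apply Cmod_triangle|]. rewrite !Cmod_mult, !Cmod_R.
  pose proof (Cmod_alpha_le t m n ltac:(lia)) as Hal. fold al in Hal. pose proof (Cmod_ge_0 al) as Hal0.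
  assert (Hy3 : 0 < y ^ 3) by (apply pow_lt; auto).
  (* Truncating the Gaussian at the ends of the arc. *)
  assert (B1 : Rabs (I0 / G - 1) <= 4 / kV * y).
  { assert (EkV : k * (V * V) = kV / y ^ 3) by (unfold k, L, kV; field; lra).
    rewrite EkV in HB0.
    pose proof (exp_neg_le_inv (kV / y ^ 3) ltac:(apply Rdiv_lt_0_compat; auto)) as G1.
    replace (/ (kV / y ^ 3)) with (y ^ 3 / kV) in G1 by (field; lra).
    assert (Hsk : 0 < sqrt k) by (apply sqrt_lt_R0; auto).
    assert (HsP : 1 <= sqrt PI).
    { rewrite <- sqrt_1. apply sqrt_le_1_alt. pose proof PI2_1; lra. }
    assert (EG : G = sqrt PI / sqrt k) by (unfold G; apply sqrt_div; lra).
    assert (G2 : / sqrt k <= G).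
    { rewrite EG. unfold Rdiv. rewrite <- (Rmult_1_l (/ sqrt k)) at 1.
      apply Rmult_le_compat_r; [left; apply Rinv_0_lt_compat; auto|auto]. }
    assert (G3 : y ^ 3 <= y) by (simpl; nra).
    assert (G4 : y ^ 3 / kV <= y / kV) by (apply Rmult_le_compat_r; [left; apply Rinv_0_lt_compat; auto|auto]).
    assert (G5 : 4 / sqrt k * exp (- (kV / y ^ 3)) <= 4 * G * (y / kV)).
    { apply Rmult_le_compat; [|left; apply exp_pos| |lra].
      - apply Rmult_le_pos; [lra|left; apply Rinv_0_lt_compat; auto].
      - unfold Rdiv; lra. }
    replace (I0 / G - 1) with ((I0 - G) / G) by (field; lra).
    unfold Rdiv at 1. rewrite Rabs_mult, (Rabs_pos_eq (/ G)) by (left; apply Rinv_0_lt_compat; auto).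
    apply (Rmult_le_reg_r G); auto. rewrite Rmult_assoc, Rinv_l, Rmult_1_r by lra.
    replace (4 / kV * y * G) with (4 * G * (y / kV)) by (field; lra).
    apply Rabs_le. split; lra. }
  assert (B2 : I4 <= 2 * G).
  { eapply Rle_trans; [apply HB4|]. right. unfold G.
    replace (PI / (k / 4)) with ((2 * 2) * (PI / k)) by (field; lra).
    rewrite sqrt_mult, sqrt_square by (try lra; left; apply Rdiv_lt_0_compat; auto). reflexivity. }
  assert (B3 : y ^ 3 <= y * G * sqrt (a / PI)).
  { assert (EGa : G * sqrt (a / PI) = sqrt (y * y * y)).
    { unfold G. rewrite <- sqrt_mult; [|left; apply Rdiv_lt_0_compat; auto|left; apply Rdiv_lt_0_compat; auto].
      f_equal. unfold k, L. field. lra. }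
    rewrite Rmult_assoc, EGa. replace (y ^ 3) with (y * (y * y)) by ring.
    apply Rmult_le_compat_l; [lra|].
    apply Rle_trans with (sqrt ((y * y) * (y * y))); [rewrite sqrt_square; nra|].
    apply sqrt_le_1_alt. replace (y * y * (y * y)) with (y ^ 3 * y) by ring.
    replace (y * y * y) with (y ^ 3) by ring. nra. }
  (* The error integral relative to the main term. *)
  assert (B4 : Cmod (2 * PI * cn - RtoC (X * I0) * al) * Rabs (/ (X * G)) <=
    2 * INR t * C0 * (2 + 2 * V * sqrt (a / PI)) * y).
  { rewrite Rabs_pos_eq by (left; apply Rinv_0_lt_compat; nra).
    apply (Rmult_le_reg_r (X * G)); [nra|]. rewrite Rmult_assoc, Rinv_l, Rmult_1_r by nra.
    eapply Rle_trans; [exact HCM|].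
    replace (2 * INR t * C0 * (2 + 2 * V * sqrt (a / PI)) * y * (X * G)) with
      (2 * INR t * (C0 * X * (y * (2 * G) + (y * G * sqrt (a / PI)) * (2 * V)))) by ring.
    apply Rmult_le_compat_l; [lra|]. apply Rmult_le_compat_l; [nra|].
    apply Rplus_le_compat; [apply Rmult_le_compat_l; lra|apply Rmult_le_compat_r; lra]. }
  assert (B5 : Rabs (I0 / G - 1) * Cmod al <= 4 / kV * y * INR t).
  { apply Rmult_le_compat; auto. apply Rabs_pos. }
  rewrite !Rmult_plus_distr_r.
  replace (4 / kV * INR t * y) with (4 / kV * y * INR t) by ring. lra.
Qed.

(** The quotient is identically 1, and integrating [q^(-n)] over the circle gives 0. *)
Lemma coefficients_of_trivial_quotient (m : nat) (c : nat -> Z) : is_ct_coeffs 1 m c ->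
  forall n, (0 < n)%nat -> RtoC (IZR (c n)) = 0%C.
Proof.
  intros Hc n Hn. pose proof PI_RGT_0 as HP.
  assert (Hone : forall q, Cmod q < 1 -> ct_series 1 m q = 1%C).
  { intros q Hq. destruct (eta_quotient_limit 1 m q ltac:(lia) Hq) as [F [EF HF]].
    unfold ct_series. rewrite EF.
    replace F with (RtoC 1); [apply Cpow_1_l|].
    apply (Clim_unique (fun _ => RtoC 1)); [apply Clim_const|].
    eapply Clim_ext; [|exact HF]. intros J. unfold log_quotient. simpl.
    rewrite csum_const, Cmult_0_r. apply Cexp_0. }
  pose proof (circle_method (fun k => RtoC (IZR (c k))) (ct_series 1 m) (/ 2) n 1
    (fun h s => RtoC (/ (/ 2) ^ n) * cis ((INR 0 - INR n) * (2 * PI * (INR h / INR 1) + s)))%C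
    (fun h => RtoC (/ (/ 2) ^ n) * arc_integral 1 0 n h)%C (fun _ => 0) 0) as CM.
  assert (H : Cmod (2 * PI * RtoC (IZR (c n)) - csum (fun h => RtoC (/ (/ 2) ^ n) * arc_integral 1 0 n h)%C 1) <= 2 * INR 1 * 0).
  { apply CM; clear CM.
    - intros q Hq. apply pseries_Clim, (Hc q Hq).
    - lra.
    - lia.
    - intros h Hh. apply is_CInt_scal, is_CInt_arc; auto.
    - evar_last; [apply (@is_RInt_const R_NormedModule)|]. unfold scal; simpl; unfold mult; simpl. apply Rmult_0_r.
    - intros h s _ _. rewrite Hone.
      + right.
        replace ((INR 0 - INR n) * (2 * PI * (INR h / INR 1) + s)) with (- (INR n * (2 * PI * (INR h / INR 1) + s))) by (simpl; ring).
        match goal with |- Cmod ?z = 0 => replace z with (RtoC 0) by ring end. apply Cmod_0.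
      + rewrite Cmod_mult, Cmod_cis, Cmod_R, Rabs_pos_eq; lra. }
  rewrite csum_scal, arc_orthogonality in H by lia. destruct (Nat.eqb_spec 0 n) as [E|]; [lia|].
  rewrite Rmult_0_r in H.
  assert (E : (2 * PI * RtoC (IZR (c n)) - RtoC (/ (/ 2) ^ n) * 0)%C = 0%C).
  { apply Cmod_eq_0. pose proof (Cmod_ge_0 (2 * PI * RtoC (IZR (c n)) - RtoC (/ (/ 2) ^ n) * 0)). lra. }
  assert (HPC : RtoC PI <> 0%C) by (apply RtoC_nz; lra).
  replace (RtoC (IZR (c n))) with ((2 * PI * RtoC (IZR (c n)) - RtoC (/ (/ 2) ^ n) * 0) / (2 * PI))%C by (field; auto).
  rewrite E. field. auto.
Qed.

Theorem corollary1p2 :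
  forall (t m : nat) (c : nat -> Z),
    (0 < t)%nat -> (0 < m)%nat -> (m * (t - 1) <= 24)%nat ->
    is_ct_coeffs t m c ->
    exists E : nat -> C,
      is_bigO E (fun n => Rpower (INR n - mu t m) (- (1 / 2))) /\
      eventually (fun n =>
        RtoC (IZR (c n)) = (main_factor t m n * (alpha t m n + E n))%C).
Proof.
  intros t m c Ht Hm _ Hc.
  destruct (Nat.eq_dec t 1) as [->|Ht1].
  - exists (fun _ => 0%C). split.
    + exists 0. exists O. intros n _. rewrite Cmod_0, Rmult_0_l. lra.
    + exists 1%nat. intros n Hn. rewrite (coefficients_of_trivial_quotient m c Hc n) by lia.
      replace (main_factor 1 m n) with 0; [ring|].
      unfold main_factor, mu. replace (INR m * (INR 1 - 1) / 24) with 0 by (simpl; field).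
      rewrite sqrt_0, sqrt_0. unfold Rdiv; ring.
  - assert (Ht2 : (1 < t)%nat) by lia.
    destruct (coefficient_estimate t m c Ht2 Hm Hc) as [K [C0 [HC0 Hest]]].
    pose proof (growth_pos t m Ht2 Hm) as Ha. set (a := growth t m) in *.
    destruct (INR_unbounded (mu t m + a * (C0 * C0))) as [n0 Hn0].
    assert (Hn : forall n, (n0 <= n)%nat -> 0 < main_factor t m n /\
      Cmod (RtoC (IZR (c n)) / RtoC (main_factor t m n) - alpha t m n) <=
        K * (sqrt a * Rpower (INR n - mu t m) (- (1 / 2)))).
    { intros n Hn. apply le_INR in Hn.
      assert (Hpos : 0 < a * (C0 * C0)) by (apply Rmult_lt_0_compat; [exact Ha|nra]).
      set (N := INR n - mu t m) in *. assert (HN : a * (C0 * C0) < N) by (unfold N; lra).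
      assert (HsN : 0 < sqrt N) by (apply sqrt_lt_R0; lra). pose proof (sqrt_sqrt N ltac:(lra)) as HsNN.
      assert (Hsa : 0 < sqrt a) by (apply sqrt_lt_R0; lra). pose proof (sqrt_sqrt a ltac:(lra)) as Hsaa.
      assert (HRp : Rpower N (- (1 / 2)) = / sqrt N).
      { rewrite Rpower_Ropp. f_equal. replace (1 / 2) with (/ 2) by field. apply Rpower_sqrt. lra. }
      rewrite HRp. apply (Hest n (sqrt a * / sqrt N)).
      - apply Rdiv_lt_0_compat; auto.
      - apply (Rmult_le_reg_r (sqrt N)); auto.
        replace (C0 * (sqrt a * / sqrt N) * sqrt N) with (C0 * sqrt a) by (field; lra).
        rewrite Rmult_1_l. apply Rsqr_incr_0_var; [|lra]. unfold Rsqr. rewrite HsNN.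
        replace (C0 * sqrt a * (C0 * sqrt a)) with ((sqrt a * sqrt a) * (C0 * C0)) by ring.
        rewrite Hsaa. lra.
      - fold N; lra.
      - fold N. fold a. transitivity ((sqrt N * sqrt N) * (sqrt a * / sqrt N * (sqrt a * / sqrt N))); [rewrite HsNN; reflexivity|].
        transitivity (sqrt a * sqrt a); [field; lra|exact Hsaa]. }
    exists (fun n => RtoC (IZR (c n)) / RtoC (main_factor t m n) - alpha t m n)%C. split.
    + exists (K * sqrt a). exists n0. intros n H. destruct (Hn n H) as [_ B].
      rewrite Rabs_pos_eq by (left; apply exp_pos). lra.
    + exists n0. intros n H. destruct (Hn n H) as [HM _].
      assert (HMC : RtoC (main_factor t m n) <> 0%C) by (apply RtoC_nz; lra).
      field. auto.
Qed.
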